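(* There exist an integer $r\geq 2$ and a finitely supported spread-out probability measure $\tau$ on a free group $\Gamma$ of rank $r$ such that the measured group $(\Gamma,\tau)$ admits a prime and essentially free $\tau$-boundary.
   Context: A probability measure $\tau$ on a countable discrete group $\Gamma$ is spread-out if its support generates $\Gamma$ as a semigroup; then $(\Gamma,\tau)$ is called a measured group. A Borel $(\Gamma,\tau)$-space $(X,\xi)$ is a standard Borel space $X$ with a Borel $\Gamma$-action and a probability measure $\xi$ that is $\tau$-stationary, i.e. $\tau*\xi=\sum_\gamma\tau(\gamma)\gamma\xi=\xi$. A measure-preserving $\Gamma$-map $(X,\xi)\to(X',\xi')$ is a $\Gamma$-equivariant Borel map between $\Gamma$-invariant conull Borel subsets pushing $\xi$ to $\xi'$; if it has a measurable inverse of the same kind it is a measurable $\Gamma$-isomorphism. If $M$ is a compact metrizable space with continuous $\Gamma$-action and $\eta$ is a $\tau$-stationary probability measure on $M$, then for $\tau^{\otimes\mathbb N}$-a.e. $\omega\in\Gamma^{\mathbb N}$ the weak*-limit $\eta_\omega=\lim_n\omega_1\cdots\omega_n\eta$ exists, and $\eta$ is $\tau$-proximal if $\eta_\omega$ is a.s. a point measure. Every Borel $(\Gamma,\tau)$-space is measurably $\Gamma$-isomorphic to such an $(M,\eta)$ (a compact model); it is called $\tau$-proximal, or a $\tau$-boundary, if its compact models are $\tau$-proximal. A non-trivial (i.e. not concentrated at a single point) Borel $(\Gamma,\tau)$-space is prime if every measure-preserving $\Gamma$-map from it to another $(\Gamma,\tau)$-space is either a measurable $\Gamma$-isomorphism or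 essentially trivial (its target is, modulo null sets, a single point). It is essentially free if almost every point has trivial stabilizer in $\Gamma$. *)

(* Defs.v *)
From HB Require Import structures.
From mathcomp Require Import all_boot all_order all_algebra.
From mathcomp Require Import all_classical all_reals all_analysis.

Set Implicit Arguments.
Unset Strict Implicit.
Unset Printing Implicit Defensive.

Import Order.TTheory GRing.Theory Num.Theory.
Import numFieldNormedType.Exports.

Local Open Scope classical_set_scope.
Local Open Scope ring_scope.

(* The universal property of the free group on 'I_r. *)
Definition free_basis (r : nat) (G : groupType) (b : 'I_r -> G) : Prop :=
  forall (H : groupType) (h : 'I_r -> H),
    exists! phi : G -> H,
      {morph phi : x y / (x * y)%g} /\ (forall i, phi (b i) = h i).

Definition free_of_rank (G : groupType) (r : nat) : Prop :=
  exists b : 'I_r -> G, free_basis b.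

Inductive semigroup_generated (G : groupType) (S : set G) : set G :=
| sg_gen g : S g -> semigroup_generated S g
| sg_mul g h : semigroup_generated S g -> semigroup_generated S h ->
    semigroup_generated S (g * h)%g.

(* A probability measure on a countable discrete group is given by its mass
   function tau : G -> R. *)
Definition mass_function (R : realType) (G : groupType) (tau : G -> R) : Prop :=
  (forall g, 0 <= tau g) /\ (\esum_(g in [set: G]) (tau g)%:E = 1)%E.

Definition mass_support (R : realType) (G : groupType) (tau : G -> R) : set G :=
  [set g | tau g != 0].

Definition spread_out (R : realType) (G : groupType) (tau : G -> R) : Prop :=
  semigroup_generated (mass_support tau) = [set: G].

Definition measured_group (R : realType) (G : groupType) (tau : G -> R) : Prop :=
  [/\ countable [set: G], mass_function tau & spread_out tau].

(* Polish spaces are rendered as separable complete Hausdorff pseudometric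
   spaces: Hausdorffness makes the pseudometric structure metrizable. *)
Definition standard_borel (R : realType) d (X : measurableType d) : Prop :=
  exists (P : completePseudoMetricType R) (f : X -> P),
    [/\ hausdorff_space P,
        (exists2 D : set P, countable D & dense D),
        bijective f
      & forall A : set X, measurable A <-> (<<s @open P >>) (f @` A)].

(* Raw data only; the axioms are in [stationary_space]. *)
Record gspace (R : realType) (G : groupType) := GSpace {
  gs_display : measure_display;
  gs_sort :> measurableType gs_display;
  gs_act : G -> gs_sort -> gs_sort;
  gs_law : probability gs_sort R }.

Definition is_group_action (G : groupType) (T : Type) (act : G -> T -> T) : Prop :=
  (forall x, act 1%g x = x) /\
  (forall g h x, act (g * h)%g x = act g (act h x)).

Definition stationary (R : realType) (G : groupType) (tau : G -> R)
    d (X : measurableType d) (act : G -> X -> X) (xi : probability X R) : Prop :=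
  forall A : set X, measurable A ->
    (\esum_(g in [set: G]) ((tau g)%:E * pushforward xi (act g) A) = xi A)%E.

Definition stationary_space (R : realType) (G : groupType) (tau : G -> R)
    (X : gspace R G) : Prop :=
  [/\ standard_borel R X,
      is_group_action (@gs_act R G X),
      (forall g, measurable_fun [set: X] (@gs_act R G X g))
    & stationary tau (@gs_act R G X) (@gs_law R G X)].

Section GMaps.
Context (R : realType) (G : groupType).
Implicit Types X Y : gspace R G.

Definition invariant_conull X (D : set X) : Prop :=
  [/\ measurable D, (gs_law X D = 1)%E
    & forall g x, D x -> D (gs_act g x)].

(* The map is D -> D'; values of [f] outside D are irrelevant. *)
Definition gmap X Y (D : set X) (D' : set Y) (f : X -> Y) : Prop :=
  [/\ invariant_conull D /\ invariant_conull D',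
      measurable_fun D f,
      (forall x, D x -> D' (f x)),
      (forall g x, D x -> f (gs_act g x) = gs_act g (f x))
    & (forall B : set Y, measurable B ->
         gs_law Y B = gs_law X (D `&` f @^-1` B))].

(* Maps are considered modulo null sets, so the domain and codomain may shrink
   before inverting. *)
Definition gmap_iso X Y (D : set X) (D' : set Y) (f : X -> Y) : Prop :=
  exists (E : set X) (E' : set Y) (f' : Y -> X),
    [/\ E `<=` D /\ E' `<=` D', gmap E E' f, gmap E' E f',
        (forall x, E x -> f' (f x) = x)
      & (forall y, E' y -> f (f' y) = y)].

Definition isomorphic X Y : Prop :=
  exists (D : set X) (D' : set Y) (f : X -> Y),
    gmap D D' f /\ gmap_iso D D' f.

Definition essentially_point X : Prop :=
  exists x : X, {ae gs_law X, forall y, y = x}.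

Definition prime_space (tau : G -> R) X : Prop :=
  ~ essentially_point X /\
  forall Y (D : set X) (D' : set Y) (f : X -> Y),
    stationary_space tau Y -> gmap D D' f ->
    gmap_iso D D' f \/ essentially_point Y.

Definition essentially_free X : Prop :=
  {ae gs_law X, forall x, forall g : G, gs_act g x = x -> g = 1%g}.

End GMaps.

Definition paths (G : groupType) : Type := nat -> G.

HB.instance Definition _ (G : groupType) := Choice.copy (paths G) (nat -> G).
HB.instance Definition _ (G : groupType) :=
  isPointed.Build (paths G) (fun=> 1%g).

Definition cylinders (G : groupType) : set (set (paths G)) :=
  [set C | exists (n : nat) (A : set G), C = [set w | A (w n)]].

Definition path_space (G : groupType) := g_sigma_algebraType (@cylinders G).

(* G carries its discrete sigma-algebra, so for countable G these cylinder
   probabilities determine mu: it is the product of copies of tau. *)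
Definition is_product_measure (R : realType) (G : groupType) (tau : G -> R)
    (mu : probability (path_space G) R) : Prop :=
  forall (n : nat) (a : nat -> G),
    mu [set w | forall i, (i < n)%N -> w i = a i] = (\prod_(i < n) tau (a i))%:E.

Definition walk (G : groupType) (w : nat -> G) (n : nat) : G :=
  (\big[*%g/1]_(0 <= i < n) w i)%g.

Section Compact.
Context (R : realType) (G : groupType).

Definition borel (M : pseudoPMetricType R) := g_sigma_algebraType (@open M).

(* [l] is the weak* limit of the measures (gam n) eta; the integral of f against
   the translate g eta is that of x |-> f (g x) against eta. *)
Definition weak_limit_translates (M : pseudoPMetricType R) (act : G -> M -> M)
    (eta : probability (borel M) R) (gam : nat -> G)
    (l : probability (borel M) R) : Prop :=
  forall f : M -> R, continuous f ->
    \int[eta]_x f (act (gam n) x) @[n --> \oo] --> \int[l]_x f x.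

Definition compact_stationary_space (tau : G -> R) (M : pseudoPMetricType R)
    (act : G -> M -> M) (eta : probability (borel M) R) : Prop :=
  [/\ hausdorff_space M /\ compact [set: M],
      is_group_action act,
      (forall g, continuous (act g))
    & stationary tau (act : G -> borel M -> borel M) eta].

Definition proximal (tau : G -> R) (M : pseudoPMetricType R)
    (act : G -> M -> M) (eta : probability (borel M) R) : Prop :=
  exists2 mu : probability (path_space G) R, is_product_measure tau mu &
    {ae mu, forall w : path_space G, exists m : borel M,
      weak_limit_translates act eta (walk w) (\d_m)}.

Definition compact_model (tau : G -> R) (X : gspace R G)
    (M : pseudoPMetricType R) (act : G -> M -> M)
    (eta : probability (borel M) R) : Prop :=
  compact_stationary_space tau act eta /\
  isomorphic X (GSpace (act : G -> borel M -> borel M) eta).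

(* Every Borel (G, tau)-space has compact models, and proximality does not depend
   on the choice of one. *)
Definition boundary (tau : G -> R) (X : gspace R G) : Prop :=
  stationary_space tau X /\
  forall (M : pseudoPMetricType R) (act : G -> M -> M)
         (eta : probability (borel M) R),
    compact_model tau X act eta -> proximal tau act eta.

End Compact.

(* Main.v *)
(** The free group on [u] and [h] acts on the Cantor space [X] of binary sequences
    with its uniform measure [nu]: [u] is the odometer, and [h] replaces the prefixes
    [0], [10], [11] by [00], [01], [1] after flipping bits at a sparse set of positions,
    the bit at the [k]-th position being flipped when the [k]-th finite word, in an
    enumeration with infinite repetitions, is a prefix of the sequence. The uniform
    measure [tau] on the ten elements [u], [u^-1], [u^i h u^i], [u^i h^-1 u^i]
    ([i < 4]) makes [nu] stationary.

    Boundary: [tau] contracts a suitable metric on average, so the random walk sends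
    a base point to a random limit point [b], and Levy's zero-one law shows that the
    translates of [nu] converge to the point mass at [b].

    Freeness: a fixed point at which an element shifts the tail of the sequence lies
    in a set which that element scales by a power of 2 other than 1, hence in a null
    set. If the tail is not shifted, a shortest reduced word with a fixed point has
    distinct intermediate points, and a flip separating one of them from the others
    changes exactly one far bit of the sequence.

    Primeness: the sigma-algebra of a factor is invariant. As [u^2] is ergodic on each
    half of [X], a Hahn decomposition shows that either half of [X] belongs to it, and
    then so do all cylinders, or all its sets meet both halves in equal measure; in the
    latter case the action of [h] makes them independent of all cylinders, so that
    the factor is trivial. *)

From HB Require Import structures.
Require Import Defs.
From mathcomp Require Import all_boot all_order all_algebra.
From mathcomp Require Import all_classical all_reals all_analysis.
From mathcomp Require Import measurable_realfun.
From mathcomp Require Import zify ring lra.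

Set Implicit Arguments.
Unset Strict Implicit.
Unset Printing Implicit Defensive.

Import Order.TTheory GRing.Theory Num.Theory.
Import numFieldNormedType.Exports.

Local Open Scope classical_set_scope.
Local Open Scope ring_scope.

(** * Free groups *)

(** On the cylinder of prefix [10] the bare prefix replacement coincides with the odometer: both
    send [10z] to [01z]. Without flips [u^-1 h] would thus fix an open set; the flips serve freeness
    alone. A flip depends only on earlier bits and spares the first four, so [scat] is an isometry
    preserving [nu], and for the metric, the measure and the quarters [h] behaves like the prefix
    replacement.

    A metric in which the size of a cylinder is its measure would not be contracted. If sizes decay
    by a factor [c] per bit, the four quarters contribute [1/c + 1 + 2c] in all to an average over
    [h], which is below 4 exactly for [1/2 < c < 1]; the choice is [c = 2/3].

    Contraction alone controls continuous functions on the Cantor space, whereas a compact model is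
    linked to it by a merely measurable map. The convergence of translates is therefore proved on
    arbitrary measurable sets, which is where Lévy's law enters. *)

Section FreeGroup.
Variable I : choiceType.

(* [(i, false)] stands for the generator [i] and [(i, true)] for its inverse. *)
Definition letter := (I * bool)%type.

Definition linv (l : letter) : letter := (l.1, ~~ l.2).

Lemma linvK : involutive linv.
Proof. by case=> i e; rewrite /linv /= negbK. Qed.

Definition reduced (w : seq letter) : bool :=
  sorted (fun a b => b != linv a) w.

Definition push (l : letter) (w : seq letter) : seq letter :=
  if w is m :: w' then (if m == linv l then w' else l :: w) else [:: l].

Lemma reduced_behead l w : reduced (l :: w) -> reduced w.
Proof. by case: w => //= m w /andP[]. Qed.

Lemma push_reduced l w : reduced w -> reduced (push l w).
Proof.
case: w => [//|m w] /= rw; case: eqP => [_|/eqP ml]; first exact: reduced_behead rw.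
by rewrite /reduced /= ml.
Qed.

Lemma push_cons l w : reduced (l :: w) -> push l w = l :: w.
Proof. by case: w => //= m w /andP[/negbTE->]. Qed.

Lemma pushK l w : reduced w -> push l (push (linv l) w) = w.
Proof.
case: w => [|m w] /=; first by rewrite eqxx.
rewrite linvK; case: eqP => [->|_ _] ; first by move=> /push_cons.
by rewrite /= eqxx.
Qed.

Lemma pushKV l w : reduced w -> push (linv l) (push l w) = w.
Proof. by move=> rw; rewrite -{2}(linvK l) pushK. Qed.

Record fgroup := FGroup { fword :> seq letter; _ : reduced fword }.
HB.instance Definition _ := [isSub for fword].
HB.instance Definition _ := [Choice of fgroup by <:].

Lemma fword_reduced (g : fgroup) : reduced g.
Proof. by case: g. Qed.

Lemma foldr_push_reduced w v : reduced v -> reduced (foldr push v w).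
Proof. by move=> rv; elim: w => //= l w IH; apply: push_reduced. Qed.

Definition fgroup_one : fgroup := @FGroup [::] isT.

Definition fgroup_mul (a b : fgroup) : fgroup :=
  FGroup (foldr_push_reduced a (fword_reduced b)).

Lemma reduced_inv w : reduced w -> reduced (rev (map linv w)).
Proof.
rewrite /reduced rev_sorted sorted_map.
by apply: sub_sorted => a b /=; rewrite linvK eq_sym.
Qed.

Definition fgroup_inv (a : fgroup) : fgroup :=
  FGroup (reduced_inv (fword_reduced a)).

(** This is associativity for a single letter: when [l] cancels the head of [w], [pushK] restores
    what the cancelled pair would have done to [v]. *)
Lemma foldr_push_push l w v : reduced w -> reduced v ->
  foldr push v (push l w) = push l (foldr push v w).
Proof.
case: w => [//|m w] rw rv /=; case: eqP => [->|//].
by rewrite pushK // foldr_push_reduced.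
Qed.

Lemma fgroup_mulA : associative fgroup_mul.
Proof.
move=> a b c; apply: val_inj => /=.
elim: (fword a) (fword_reduced a) => //= l w IH rw.
rewrite foldr_push_push ?IH ?(reduced_behead rw) ?foldr_push_reduced//;
  exact: fword_reduced.
Qed.

Lemma fgroup_mul1 : left_id fgroup_one fgroup_mul.
Proof. by move=> a; apply: val_inj. Qed.

Lemma fgroup_mulr1 : right_id fgroup_one fgroup_mul.
Proof.
move=> a; apply: val_inj => /=.
elim: (fword a) (fword_reduced a) => //= l w IH rw.
by rewrite IH ?(reduced_behead rw)// push_cons.
Qed.

Lemma foldr_push_inv w v : reduced v ->
  foldr push (foldr push v w) (rev (map linv w)) = v.
Proof.
elim: w v => //= l w IH v rv.
rewrite rev_cons -cats1 foldr_cat /= pushKV ?IH//.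
exact: foldr_push_reduced.
Qed.

Lemma fgroup_mulVg : left_inverse fgroup_one fgroup_inv fgroup_mul.
Proof.
move=> a; apply: val_inj => /=.
have := @foldr_push_inv a [::] isT.
suff -> : foldr push [::] a = a by [].
by have /(congr1 fword) := fgroup_mulr1 a.
Qed.

Lemma fgroup_mulgV : right_inverse fgroup_one fgroup_inv fgroup_mul.
Proof.
have invK : involutive fgroup_inv.
  move=> b; apply: val_inj; rewrite /= map_rev revK -map_comp map_id_in//.
  by move=> l _ /=; rewrite linvK.
by move=> a; rewrite -{1}(invK a) fgroup_mulVg.
Qed.

HB.instance Definition _ := isGroup.Build fgroup
  fgroup_mulA fgroup_mul1 fgroup_mulr1 fgroup_mulVg fgroup_mulgV.

Definition fgen (i : I) : fgroup := @FGroup [:: (i, false)] isT.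

Lemma fgenV (i : I) : (fgen i)^-1%g = @FGroup [:: (i, true)] isT.
Proof. exact: val_inj. Qed.

Section Universal.
Variables (H : groupType) (h : I -> H).

Definition letter_image (l : letter) : H := if l.2 then (h l.1)^-1%g else h l.1.

Definition fgroup_lift (g : fgroup) : H :=
  foldr (fun l x => letter_image l * x)%g 1%g g.

Lemma letter_imageV l : letter_image (linv l) = (letter_image l)^-1%g.
Proof. by case: l => i []; rewrite /letter_image //= invgK. Qed.

Lemma foldr_image_push l w :
  foldr (fun l x => letter_image l * x)%g 1%g (push l w) =
  (letter_image l * foldr (fun l x => letter_image l * x) 1 w)%g.
Proof.
case: w => //= m w; case: eqP => [->|//].
by rewrite letter_imageV mulgA mulgV mul1g.
Qed.

Lemma fgroup_liftM : {morph fgroup_lift : x y / (x * y)%g}.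
Proof.
move=> a b; rewrite /fgroup_lift /=.
elim: (fword a) => [|l w IH] /=; first by rewrite mul1g.
by rewrite foldr_image_push IH mulgA.
Qed.

Lemma fgroup_lift_gen i : fgroup_lift (fgen i) = h i.
Proof. by rewrite /fgroup_lift /= mulg1. Qed.

End Universal.

Lemma fgroup_consE l w (r : reduced (l :: w)) :
  FGroup r = ((if l.2 then (fgen l.1)^-1 else fgen l.1) *
             FGroup (reduced_behead r))%g.
Proof.
apply: val_inj => /=; case: l r => i [] r /=; rewrite ?fgenV /=.
  by rewrite push_cons.
by rewrite push_cons.
Qed.

Lemma fgroup_hom_unique (H : groupType) (phi psi : fgroup -> H) :
  {morph phi : x y / (x * y)%g} -> {morph psi : x y / (x * y)%g} ->
  (forall i, phi (fgen i) = psi (fgen i)) -> phi =1 psi.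
Proof.
move=> phiM psiM eqg.
have one (f : fgroup -> H) : {morph f : x y / (x * y)%g} -> f 1%g = 1%g.
  by move=> fM; apply: (mulgI (f 1%g)); rewrite -fM !mulg1.
have inv (f : fgroup -> H) x : {morph f : x y / (x * y)%g} ->
    f x^-1%g = (f x)^-1%g.
  by move=> fM; apply: (mulgI (f x)); rewrite -fM !mulgV one.
case; elim=> [|l w IH] r.
  have -> : FGroup r = 1%g by apply: val_inj.
  by rewrite !one.
rewrite fgroup_consE phiM psiM IH; congr (_ * _)%g.
by case: ifP => _; rewrite ?inv// eqg.
Qed.

End FreeGroup.

Lemma free_fgroup (r : nat) : free_of_rank (fgroup 'I_r) r.
Proof.
exists (@fgen 'I_r) => H h; exists (fgroup_lift h); split.
  by split; [exact: fgroup_liftM|exact: fgroup_lift_gen].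
move=> psi [psiM psig]; apply/funext => x.
apply: fgroup_hom_unique => //; first exact: fgroup_liftM.
by move=> i; rewrite psig fgroup_lift_gen.
Qed.

(** * Sequence spaces *)

(* The point [t0] only serves to make the type pointed. *)
Definition seqs (T : finType) (t0 : T) : Type := nat -> T.

HB.instance Definition _ (T : finType) (t0 : T) :=
  Choice.copy (seqs t0) (nat -> T).
HB.instance Definition _ (T : finType) (t0 : T) :=
  isPointed.Build (seqs t0) (fun=> t0).

Definition agree (T : Type) (n : nat) (x y : nat -> T) : Prop :=
  forall i, (i < n)%N -> x i = y i.

Section Agree.
Variable T : Type.
Implicit Types x y z : nat -> T.

Lemma agree_refl n x : agree n x x. Proof. by []. Qed.

Lemma agree_sym n x y : agree n x y -> agree n y x.
Proof. by move=> xy i /xy. Qed.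

Lemma agree_trans n x y z : agree n x y -> agree n y z -> agree n x z.
Proof. by move=> xy yz i ni; rewrite xy// yz. Qed.

Lemma agree_le m n x y : (m <= n)%N -> agree n x y -> agree m x y.
Proof. by move=> mn xy i im; apply: xy; apply: leq_trans mn. Qed.

Lemma agreeS n x y : agree n.+1 x y <-> agree n x y /\ x n = y n.
Proof.
split=> [xy|[xy xyn] i]; first by split; [exact: agree_le xy|exact: xy].
by rewrite ltnS leq_eqVlt => /predU1P[->|/xy].
Qed.

Lemma agree_all x y : (forall n, agree n x y) -> x = y.
Proof. by move=> xy; apply/funext => n; apply: (xy n.+1). Qed.

Lemma agree_mkseq n x y : agree n x y <-> mkseq x n = mkseq y n.
Proof.
split=> [xy|xy i ni].
  by apply/eq_in_map => i; rewrite mem_iota => /andP[_] /xy.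
by rewrite -[LHS](nth_mkseq (x 0) x ni) xy nth_mkseq.
Qed.

End Agree.

Lemma agree0 T (x y : nat -> T) : agree 0 x y. Proof. by []. Qed.
#[global] Hint Resolve agree_refl agree0 : core.

(** * Triangular maps of the binary Cantor space *)

Definition bits := @seqs bool false.

Section Triangular.
Variable phi : nat -> bits -> bool.

Definition tri (x : bits) : bits := fun n => x n (+) phi n x.

(** The preimage under [tri] is solved for one bit at a time: the correction at place [m] reads only
    the [m] bits already recovered. *)
Fixpoint tri_prefix (x : bits) (n : nat) : seq bool :=
  if n is m.+1 then
    rcons (tri_prefix x m) (x m (+) phi m (nth false (tri_prefix x m)))
  else [::].

Definition triV (x : bits) : bits := fun n => nth false (tri_prefix x n.+1) n.

Hypothesis phi_dep : forall n x y, agree n x y -> phi n x = phi n y.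

Lemma size_tri_prefix x n : size (tri_prefix x n) = n.
Proof. by elim: n => //= n IH; rewrite size_rcons IH. Qed.

Lemma tri_prefixE x n : agree n (nth false (tri_prefix x n)) (triV x).
Proof.
elim: n => // n IH; apply/agreeS; split=> //.
move=> i ni; rewrite -IH//= nth_rcons size_tri_prefix.
by rewrite ni.
Qed.

Lemma triVE x n : triV x n = x n (+) phi n (triV x).
Proof.
rewrite {1}/triV /= nth_rcons size_tri_prefix ltnn eqxx.
by congr (_ (+) _); apply: phi_dep; exact: tri_prefixE.
Qed.

(** Triangular maps therefore permute the cylinders of each length, and are isometries for any
    metric that depends only on the first difference. *)
Lemma agree_tri n x y : agree n (tri x) (tri y) <-> agree n x y.
Proof.
elim: n => // n IH; rewrite !agreeS IH /tri.
split=> -[xy]; last by move=> ->; split; rewrite ?(phi_dep xy).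
by rewrite (phi_dep xy) => /addIb.
Qed.

Lemma triK : cancel tri triV.
Proof.
move=> x; apply: agree_all; elim=> // n IH; apply/agreeS; split=> //.
by rewrite triVE /tri (phi_dep IH) addbK.
Qed.

Lemma triVK : cancel triV tri.
Proof.
by move=> x; apply/funext => n; rewrite /tri triVE addbK.
Qed.

Lemma agree_triV n x y : agree n (triV x) (triV y) <-> agree n x y.
Proof. by rewrite -agree_tri !triVK. Qed.

End Triangular.

(** * The odometer *)

Definition carry (n : nat) (x : bits) : bool := all x (iota 0 n).

Lemma carry_dep n x y : agree n x y -> carry n x = carry n y.
Proof.
by move=> xy; apply: eq_in_all => i; rewrite mem_iota => /andP[_ /xy].
Qed.

Definition odo := tri carry.
Definition odoV := triV carry.

Lemma odoK : cancel odo odoV. Proof. exact/triK/carry_dep. Qed.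
Lemma odoVK : cancel odoV odo. Proof. exact/triVK/carry_dep. Qed.
Lemma agree_odo n x y : agree n (odo x) (odo y) <-> agree n x y.
Proof. exact/agree_tri/carry_dep. Qed.
Lemma agree_odoV n x y : agree n (odoV x) (odoV y) <-> agree n x y.
Proof. exact/agree_triV/carry_dep. Qed.

(** The residue modulo [2 ^ n] of a 2-adic integer, least significant bit first. On residues the
    odometer is addition of 1. *)
Definition bval (n : nat) (x : bits) : nat := (\sum_(i < n) x i * 2 ^ i)%N.

Lemma bvalS n x : bval n.+1 x = (bval n x + x n * 2 ^ n)%N.
Proof. by rewrite /bval big_ord_recr. Qed.

Lemma bval_lt n x : (bval n x < 2 ^ n)%N.
Proof.
elim: n => [|n IH]; first by rewrite /bval big_ord0.
by rewrite bvalS expnS; case: (x n); lia.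
Qed.

Lemma bval_inj n x y : bval n x = bval n y -> agree n x y.
Proof.
elim: n => // n IH; rewrite !bvalS => e.
have := bval_lt n x; have := bval_lt n y => ly lx.
apply/agreeS; case ex: (x n) e; case ey: (y n) => e; split=> //;
  try apply: IH; lia.
Qed.

Lemma carryE n x : carry n x = (bval n x == 2 ^ n - 1)%N.
Proof.
elim: n => [|n IH]; first by rewrite /carry /bval big_ord0.
rewrite /carry -addn1 iotaD all_cat /= add0n andbT -/(carry n x) IH addn1.
rewrite bvalS expnS; have := bval_lt n x; case: (x n); lia.
Qed.

Lemma bval_odo n x : bval n (odo x) = ((bval n x + 1) %% 2 ^ n)%N.
Proof.
elim: n => [|n IH]; first by rewrite /bval !big_ord0 modn1.
rewrite !bvalS IH {1}/odo /tri carryE.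
have := bval_lt n x; set b := bval n x; set q := (2 ^ n)%N => bq.
rewrite expnS -/q.
have [->|bn] := eqVneq b (q - 1)%N.
  have -> : (q - 1 + 1)%N = q by lia.
  rewrite modnn; case: (x n); rewrite /= ?mul1n ?mul0n.
    by rewrite (_ : q - 1 + q + 1 = 2 * q)%N ?modnn//; lia.
  by rewrite modn_small; lia.
case: (x n); rewrite /= ?mul1n ?mul0n !modn_small; lia.
Qed.

Lemma bval_iter_odo n k x : bval n (iter k odo x) = ((bval n x + k) %% 2 ^ n)%N.
Proof.
elim: k => [|k IH]; first by rewrite addn0 modn_small// bval_lt.
by rewrite iterS bval_odo IH modnDml -addnA addn1.
Qed.

Lemma agree_iter_odo n k x y :
  agree n (iter k odo x) (iter k odo y) <-> agree n x y.
Proof. by elim: k => //= k IH; rewrite agree_odo. Qed.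

Lemma odo_transitive n x y : exists k, agree n (iter k odo x) y.
Proof.
(* Adding [2 ^ n] avoids truncation in the difference of the two residues and does not change it
   modulo [2 ^ n]. *)
exists (bval n y + (2 ^ n - bval n x))%N; apply: bval_inj.
rewrite bval_iter_odo.
have := bval_lt n x; have := bval_lt n y => ly lx.
rewrite (_ : _ + _ = bval n y + 2 ^ n)%N; last by lia.
by rewrite modnDr modn_small.
Qed.

(** It is enough to look modulo [2 ^ k], because [k < 2 ^ k]. *)
Lemma iter_odo_free k x : iter k odo x = x -> k = 0%N.
Proof.
move=> xx; have := bval_iter_odo k k x; rewrite xx => /esym.
rewrite -[RHS](modn_small (bval_lt k x)) => /eqP.
rewrite -{2}[bval k x]addn0 eqn_modDl mod0n => /eqP.
by rewrite modn_small// ltn_expl.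
Qed.

(** * Scattered flips *)

(** Reading the word off the exponent of 2 in [k] repeats it at all odd multiples of one power of 2,
    hence infinitely often. *)
Definition decode (k : nat) : seq bool :=
  odflt [::] (unpickle (logn 2 k)).

Lemma decode_inf (p : seq bool) (N : nat) : exists2 k, (N <= k)%N & decode k = p.
Proof.
exists (2 ^ pickle p * (2 * N + 1))%N.
  by have := expn_gt0 2 (pickle p); nia.
rewrite /decode lognM ?expn_gt0//; last by lia.
rewrite lognX logn_prime// eqxx muln1.
rewrite [logn 2 (2 * N + 1)]logn_coprime ?addn0 ?pickleK//.
by rewrite coprime2n oddD mul2n odd_double.
Qed.

(* The positions [2 ^ (k + 2)] are so sparse that shifting them by a bounded
   amount produces no coincidences. *)
Definition flip (n : nat) (x : bits) : bool :=
  let k := (trunc_log 2 n - 2)%N in let p := decode k in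
  [&& n == (2 ^ (k + 2))%N, (size p <= n)%N & mkseq x (size p) == p].

Lemma flip_dep n x y : agree n x y -> flip n x = flip n y.
Proof.
move=> xy; rewrite /flip; case: eqP => //= _.
case: leqP => //= pn; congr (_ == _).
by apply/agree_mkseq; exact: agree_le xy.
Qed.

Lemma flip_pow k x : let p := decode k in
  (size p <= 2 ^ (k + 2))%N -> flip (2 ^ (k + 2)) x = (mkseq x (size p) == p).
Proof. by move=> p sp; rewrite /flip trunc_expnK// addnK eqxx sp. Qed.

Lemma flip_small n x : (n < 4)%N -> flip n x = false.
Proof.
move=> n4; apply/negP => /andP[/eqP e _]; move: n4; rewrite e.
have := expn_gt0 2 (trunc_log 2 n - 2); rewrite expnD.
by move: (2 ^ (_ - 2))%N => q; lia.
Qed.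

(** The special positions adjacent to [2 ^ (k + 2)] are at distance at least [2 ^ (k + 1)] from it,
    which exceeds [c]. *)
Lemma flip_near k n c x : (n != 2 ^ (k + 2))%N ->
  (n <= 2 ^ (k + 2) + c)%N -> (2 ^ (k + 2) <= n + c)%N -> (c < 2 ^ k)%N ->
  flip n x = false.
Proof.
move=> nk n1 n2 ck; apply/negP => /andP[/eqP e _].
move: nk n1 n2; rewrite e; set m := (_ - 2)%N => nk n1 n2.
have [mk|mk|mk] := ltngtP m k; last by rewrite mk eqxx in nk.
  have : (2 ^ m.+1 <= 2 ^ k)%N by rewrite leq_pexp2l.
  by rewrite !expnD !expnS expn0 in n1 n2 *; lia.
have : (2 ^ k.+1 <= 2 ^ m)%N by rewrite leq_pexp2l.
by rewrite !expnD !expnS expn0 in n1 n2 *; lia.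
Qed.

Definition scat := tri flip.
Definition scatV := triV flip.

Lemma scatK : cancel scat scatV. Proof. exact/triK/flip_dep. Qed.
Lemma scatVK : cancel scatV scat. Proof. exact/triVK/flip_dep. Qed.
Lemma agree_scat n x y : agree n (scat x) (scat y) <-> agree n x y.
Proof. exact/agree_tri/flip_dep. Qed.
Lemma agree_scatV n x y : agree n (scatV x) (scatV y) <-> agree n x y.
Proof. exact/agree_triV/flip_dep. Qed.

Lemma scat_small n x : (n < 4)%N -> scat x n = x n.
Proof. by move=> n4; rewrite /scat /tri flip_small// addbF. Qed.

Lemma scatV_small n x : (n < 4)%N -> scatV x n = x n.
Proof. by move=> n4; rewrite -[in RHS](scatVK x) scat_small. Qed.

(** * The hyperbolic map *)

(* The prefix replacement [0 -> 00], [10 -> 01], [11 -> 1]. *)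
Definition stretch (x : bits) : bits :=
  if ~~ x 0 then fun n => if n is n'.+1 then x n' else false
  else if ~~ x 1%N then fun n => if n is n'.+2 then x n else (n == 1)%N
  else fun n => x n.+1.

Definition stretchV (y : bits) : bits :=
  if y 0 then fun n => if n is n'.+1 then y n' else true
  else if y 1%N then fun n => if n is n'.+2 then y n else (n == 0)%N
  else fun n => y n.+1.

Lemma stretchK : cancel stretch stretchV.
Proof.
move=> x; apply/funext => n; rewrite /stretchV /stretch.
case x0: (x 0) => /=; last by rewrite x0.
case x1: (x 1%N) => /=; first by rewrite x1; case: n => //=; rewrite ?x0.
by case: n => [|[|n]] /=; rewrite ?x0 ?x1.
Qed.

Lemma stretchVK : cancel stretchV stretch.
Proof.
move=> x; apply/funext => n; rewrite /stretchV /stretch.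
case x0: (x 0) => /=; first by rewrite x0.
case x1: (x 1%N) => /=; first by case: n => [|[|n]] /=; rewrite ?x0 ?x1.
by rewrite x1 /=; case: n => //=; rewrite x0.
Qed.

Definition hyp (x : bits) : bits := stretch (scat x).
Definition hypV (y : bits) : bits := scatV (stretchV y).

Lemma hypK : cancel hyp hypV.
Proof. by move=> x; rewrite /hyp /hypV stretchK scatK. Qed.

Lemma hypVK : cancel hypV hyp.
Proof. by move=> x; rewrite /hyp /hypV scatVK stretchVK. Qed.

(** * Real-valued probabilities *)

Section FiniteUnions.
Context d (T : measurableType d) (R : realType) (I : finType).
Variables (F : I -> set T) (A : set T).
Hypotheses (mF : forall i, measurable (F i))
  (dF : forall i j, i != j -> F i `&` F j = set0)
  (AF : forall x, A x <-> exists i, F i x).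

Let AE : A = \bigcup_(i in [set: I]) F i.
Proof.
by apply/seteqP; split=> x; [move=> /AF[i]; exists i|move=> [i _ Fi]; apply/AF; exists i].
Qed.

Lemma measurable_finU : measurable A.
Proof.
by rewrite AE; apply: fin_bigcup_measurable => // ; exact: finite_finset.
Qed.

Lemma measure_finType (M : {measure set T -> \bar R}) :
  M A = (\sum_i M (F i))%E.
Proof.
rewrite AE measure_fin_bigcup//.
- rewrite (_ : [set: I] = [set` index_enum I]) -?fsbig_seq ?index_enum_uniq//.
  by apply/seteqP; split=> // i _ /=; rewrite mem_index_enum.
- exact: finite_finset.
- by apply/trivIsetP => i j _ _; exact: dF.
Qed.

End FiniteUnions.

Section RealValued.
Context d (T : measurableType d) (R : realType).

(** Real values turn the scaling identities for the generators into linear arithmetic. *)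
Definition pr (P : probability T R) (A : set T) : R := fine (P A).

Section Pr.
Variable P : probability T R.
Implicit Types A B : set T.

Lemma prE A : measurable A -> P A = (pr P A)%:E.
Proof. by move=> mA; rewrite /pr fineK// fin_num_measure. Qed.

Lemma pr_ge0 A : 0 <= pr P A.
Proof. by rewrite /pr fine_ge0. Qed.

Lemma prT : pr P setT = 1.
Proof. by rewrite /pr probability_setT. Qed.

Lemma pr0 : pr P set0 = 0.
Proof. by rewrite /pr measure0. Qed.

Lemma le_pr A B : measurable A -> measurable B -> A `<=` B -> pr P A <= pr P B.
Proof.
by move=> mA mB AB; rewrite -lee_fin -!prE//; apply: le_measure; rewrite ?inE.
Qed.

Lemma pr_le1 A : measurable A -> pr P A <= 1.
Proof. by move=> mA; rewrite -prT; apply: le_pr. Qed.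

Lemma pr_setU A B : measurable A -> measurable B -> A `&` B = set0 ->
  pr P (A `|` B) = pr P A + pr P B.
Proof.
move=> mA mB AB; apply: EFin_inj; rewrite EFinD -!prE//; last exact: measurableU.
by rewrite measureU.
Qed.

Lemma pr_split B A : measurable A -> measurable B ->
  pr P A = pr P (A `&` B) + pr P (A `&` ~` B).
Proof.
move=> mA mB; rewrite -pr_setU.
- by rewrite -setIUr setUv setIT.
- exact: measurableI.
- by apply: measurableI => //; exact: measurableC.
- by rewrite setIACA setICr setI0.
Qed.

Lemma pr_setC A : measurable A -> pr P (~` A) = 1 - pr P A.
Proof.
move=> mA; rewrite -prT (pr_split measurableT mA) !setTI; lra.
Qed.

Lemma pr_setU_le A B : measurable A -> measurable B ->
  pr P (A `|` B) <= pr P A + pr P B.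
Proof.
move=> mA mB; have mAB := measurableU _ _ mA mB.
rewrite (pr_split mAB mA) (_ : (A `|` B) `&` A = A).
  rewrite lerD2l; apply: le_pr => //; last by move=> x [[]].
  by apply: measurableI => //; exact: measurableC.
by apply/seteqP; split=> [x []|x Ax] //; split=> //; left.
Qed.

Lemma pr_eq0_sub A B : measurable A -> measurable B -> A `<=` B ->
  pr P B = 0 -> pr P A = 0.
Proof.
by move=> mA mB AB B0; apply/le_anti; rewrite pr_ge0 -{1}B0 le_pr.
Qed.

Lemma pr_setI0 A N : measurable A -> measurable N -> pr P N = 0 ->
  pr P (A `&` N) = 0.
Proof.
move=> mA mN N0; apply: (pr_eq0_sub _ mN _ N0); first exact: measurableI.
by move=> x [].
Qed.

Lemma pr_setIC0 A N : measurable A -> measurable N -> pr P N = 0 ->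
  pr P (A `&` ~` N) = pr P A.
Proof. by move=> mA mN N0; rewrite [RHS](pr_split mA mN) (pr_setI0 mA mN N0) add0r. Qed.

Lemma pr_ae_eq A B N : measurable A -> measurable B -> measurable N ->
  pr P N = 0 -> A `&` ~` N = B `&` ~` N -> pr P A = pr P B.
Proof.
by move=> mA mB mN N0 AB; rewrite -(pr_setIC0 mA mN N0) AB pr_setIC0.
Qed.

Lemma pr_bigcup0 (F : nat -> set T) : (forall n, measurable (F n)) ->
  (forall n, pr P (F n) = 0) -> pr P (\bigcup_n F n) = 0.
Proof.
move=> mF F0; rewrite /pr.
suff -> : P (\bigcup_n F n) = 0%E by [].
apply/eqP; rewrite eq_le measure_ge0 andbT.
apply: le_trans (measure_sigma_subadditive _ _ _ _) _ => //.
- exact: bigcupT_measurable.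
- by rewrite eseries0// => n _ _; rewrite /= (prE (mF n)) F0.
Qed.

Lemma pr_sum (I : finType) (F : I -> set T) A :
  (forall i, measurable (F i)) -> (forall i j, i != j -> F i `&` F j = set0) ->
  (forall x, A x <-> exists i, F i x) -> pr P A = \sum_i pr P (F i).
Proof.
move=> mF dF AF; have mA : measurable A by exact: measurable_finU mF AF.
apply: EFin_inj; rewrite -prE// (measure_finType mF dF AF) -sumEFin.
by apply: eq_bigr => i _; exact: prE.
Qed.

End Pr.

(** Only values on measurable sets matter, so a combination such as the right-hand side of [nu_hyp]
    qualifies and can be identified by its values on cylinders. *)
Definition real_measure (m : set T -> R) : Prop :=
  exists M : {measure set T -> \bar R}, forall E, measurable E -> M E = (m E)%:E.

Lemma real_measureD m1 m2 : real_measure m1 -> real_measure m2 ->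
  real_measure (fun E => m1 E + m2 E).
Proof.
move=> [M1 h1] [M2 h2]; exists (measure_add M1 M2) => E mE.
by rewrite EFinD -h1// -h2//; exact: measure_addE.
Qed.

Lemma real_measureZ (c : R) m : 0 <= c -> real_measure m ->
  real_measure (fun E => c * m E).
Proof.
move=> c0 [M h]; exists (mscale (NngNum c0) M) => E mE.
by rewrite EFinM -h.
Qed.

Lemma real_measure_sum (n : nat) (m : 'I_n -> set T -> R) :
  (forall i, real_measure (m i)) -> real_measure (fun E => \sum_(i < n) m i E).
Proof.
elim: n m => [|n IH] m h.
  by exists mzero => E _; rewrite big_ord0.
have [M hM] := real_measureD (h ord0) (IH _ (fun i => h (lift ord0 i))).
by exists M => E mE; rewrite big_ord_recl hM.
Qed.

Lemma real_measure_sum_fin (I : finType) (m : I -> set T -> R) :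
  (forall i, real_measure (m i)) -> real_measure (fun E => \sum_i m i E).
Proof.
move=> h; have [M hM] := real_measure_sum (fun i : 'I_#|I| => h (enum_val i)).
exists M => E mE; rewrite hM// [in RHS](reindex (@enum_val I predT))//.
by exists enum_rank => i _; rewrite ?enum_rankK ?enum_valK.
Qed.

End RealValued.

Lemma pushforward_measure d d' (T : measurableType d) (T' : measurableType d')
    (R : realType) (mu : {measure set T -> \bar R}) (f : T -> T') :
  measurable_fun setT f ->
  exists M : {measure set T' -> \bar R}, forall E, M E = mu (f @^-1` E).
Proof.
move=> mf; pose X : {mfun T >-> T'} := mfun_Sub (mem_set mf).
by exists (pushforward mu X). Unshelve. exact: mf.
Qed.

Lemma real_measure_pre d d' (T : measurableType d) (T' : measurableType d')
    (R : realType) (P : probability T R) (f : T -> T') (A : set T) :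
  measurable_fun setT f -> measurable A ->
  real_measure (fun E : set T' => pr P (A `&` f @^-1` E)).
Proof.
move=> mf mA; have [M ME] := pushforward_measure (mrestr P mA) mf.
exists M => E mE; rewrite ME setIC; apply: prE.
by apply: measurableI => //; rewrite -[X in measurable X]setTI; exact: mf.
Qed.

Lemma real_measure_restr d (T : measurableType d) (R : realType)
    (P : probability T R) (A : set T) :
  measurable A -> real_measure (fun E : set T => pr P (A `&` E)).
Proof. by move=> mA; apply: (@real_measure_pre _ _ _ _ _ P id). Qed.

Lemma real_measure_pr d (T : measurableType d) (R : realType)
    (P : probability T R) : real_measure (pr P).
Proof.
have [M h] := real_measure_restr P measurableT.
by exists M => E mE; rewrite h// setTI.
Qed.

Lemma pushforward_probability d d' (T : measurableType d) (T' : measurableType d')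
    (R : realType) (P : probability T R) (f : T -> T') :
  measurable_fun setT f ->
  exists Q : probability T' R, forall E, Q E = P (f @^-1` E).
Proof.
by move=> mf; exists (distribution P (mfun_Sub (mem_set mf))).
Qed.

(** * Cylinders and product measures *)

Section Cylinders.
Variables (T : finType) (t0 : T).
Local Notation X := (@seqs T t0).

Definition cyl (n : nat) (x : X) : set X := [set y | agree n x y].

Definition cyls : set (set X) := [set C | exists n x, C = cyl n x].

HB.instance Definition _ := Measurable.copy X (g_sigma_algebraType cyls).

Definition upd (x : X) (n : nat) (t : T) : X := fun i => if i == n then t else x i.

Definition scons (t : T) (x : X) : X := fun i => if i is j.+1 then x j else t.

Lemma measurable_cyl n x : measurable (cyl n x : set X).
Proof. by apply: sub_sigma_algebra; exists n, x. Qed.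

Lemma cylP n x y : cyl n x y -> cyl n x = cyl n y.
Proof.
move=> xy; apply/seteqP; split=> z /= h; last exact: agree_trans h.
exact: agree_trans (agree_sym xy) h.
Qed.

Lemma cyl0 x : cyl 0 x = setT.
Proof. by apply/seteqP; split. Qed.

Lemma cyl_upd n x y : cyl n x y <-> exists t, cyl n.+1 (upd x n t) y.
Proof.
split=> [xy|[t /agreeS[xy _]] i ni].
  exists (y n); apply/agreeS; split; last by rewrite /upd eqxx.
  by move=> i ni; rewrite /upd ltn_eqF// xy.
by rewrite -xy// /upd ltn_eqF.
Qed.

Lemma cyl_upd_disjoint n x (s t : T) : s != t ->
  cyl n.+1 (upd x n s) `&` cyl n.+1 (upd x n t) = set0.
Proof.
move=> st; apply/seteqP; split=> // y [/agreeS[_ ys] /agreeS[_ yt]].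
by move/eqP: st; apply; move: ys yt; rewrite /upd eqxx => -> ->.
Qed.

Lemma setI_closed_cyl : setI_closed (set0 |` cyls).
Proof.
move=> A B [->|[n [x ->]]] [->|[m [y ->]]]; rewrite ?set0I ?setI0; try by left.
have [[z [xz yz]]|h] := pselect (exists z, cyl n x z /\ cyl m y z); last first.
  by left; apply/seteqP; split=> // z hz; apply: h; exists z.
right; exists (maxn n m), z; apply/seteqP; split=> w /=.
  move=> [xw yw] i; rewrite leq_max => /orP[] hi.
    by rewrite -xz// xw.
  by rewrite -yz// yw.
move=> zw; split=> i hi.
  by rewrite xz// zw// leq_max hi.
by rewrite yz// zw// leq_max hi orbT.
Qed.

Lemma measurable_dep d (U : measurableType d) (n : nat) (g : X -> U) :
  (forall x y, agree n x y -> g x = g y) ->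
  measurable_fun [set: X] g.
Proof.
move=> gn _ B _; rewrite setTI.
pose w (s : n.-tuple T) : X := fun i => nth t0 s i.
pose F (s : n.-tuple T) : set X :=
  if `[< B (g (w s)) >] then cyl n (w s) else set0.
rewrite (_ : g @^-1` B = \bigcup_(s in [set: n.-tuple T]) F s).
  apply: fin_bigcup_measurable; first exact: finite_finset.
  by move=> s _; rewrite /F; case: ifP => _; [exact: measurable_cyl|].
apply/seteqP; split=> x /=.
  move=> Bx; exists [tuple x i | i < n] => //.
  have ag : agree n (w [tuple x i | i < n]) x.
    move=> i ni; rewrite /w.
    by rewrite -[i]/(nat_of_ord (Ordinal ni)) -tnth_nth tnth_mktuple.
  by rewrite /F (gn _ _ ag) (asboolT Bx).
by move=> [s _]; rewrite /F; case: asboolP => //= Bw /gn <-.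
Qed.

Lemma measurable_dep_set n (A : set X) :
  (forall x y, agree n x y -> A x <-> A y) -> measurable (A : set X).
Proof.
move=> An.
have -> : A = (fun x : X => `[< A x >]) @^-1` [set true].
  by apply/seteqP; split=> x /= /asboolP.
rewrite -[X in measurable X]setTI; apply: (measurable_dep (n := n)) => //.
by move=> x y /An h; apply: asbool_equiv_eq.
Qed.

Lemma measurable_seqs d (U : measurableType d) (g : U -> X) :
  (forall n x, measurable (g @^-1` cyl n x)) -> measurable_fun setT g.
Proof.
move=> h; apply: (@measurability _ _ U X setT g cyls) => //.
by move=> _ [_ [n [x ->]] <-]; rewrite setTI.
Qed.

Lemma measurable_scons t : measurable_fun setT (scons t : X -> X).
Proof.
apply: measurable_seqs => n x; apply: (measurable_dep_set (n := n)) => y z yz.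
split=> h i ni; rewrite (h i ni); case: i ni => //= i ni; rewrite ?yz//;
  try exact: ltnW; by rewrite -yz// ltnW.
Qed.

Section Uniqueness.
Variable R : realType.
Implicit Types m : set X -> R.

Lemma real_measure_cylS m n x : real_measure m ->
  m (cyl n x) = \sum_t m (cyl n.+1 (upd x n t)).
Proof.
move=> [M h]; apply: EFin_inj; rewrite -h; last exact: measurable_cyl.
rewrite (measure_finType (F := fun t => cyl n.+1 (upd x n t))).
- by rewrite -sumEFin; apply: eq_bigr => t _; rewrite h//; exact: measurable_cyl.
- by move=> t; exact: measurable_cyl.
- by move=> s t; exact: cyl_upd_disjoint.
- by move=> y; exact: cyl_upd.
Qed.

(** A cylinder is the disjoint union of its one-letter extensions, so long cylinders determine short
    ones. The bound [N] matters for prefix replacements, which act uniformly only on cylinders long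
    enough to show the prefix. *)
Lemma real_measure_unique m1 m2 (N : nat) :
  real_measure m1 -> real_measure m2 ->
  (forall n x, (N <= n)%N -> m1 (cyl n x) = m2 (cyl n x)) ->
  forall E, measurable E -> m1 E = m2 E.
Proof.
move=> rm1 rm2 h E mE.
have {}h n x : m1 (cyl n x) = m2 (cyl n x).
  have [k] : exists k, (N <= n + k)%N by exists N; lia.
  elim: k n x => [|k IH] n x; first by rewrite addn0; exact: h.
  rewrite addnS -addSn => /IH {}IH.
  by rewrite !real_measure_cylS//; apply: eq_bigr => t _; rewrite IH.
have [M1 h1] := rm1; have [M2 h2] := rm2.
apply: EFin_inj; rewrite -h1// -h2//.
apply: (@g_sigma_algebra_measure_unique _ R X (set0 |` cyls) _ (fun=> setT)).
- by move=> _ [->|[n [x ->]]]; [exact: measurable0|exact: measurable_cyl].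
- by move=> _; right; exists 0%N, (fun=> t0); rewrite cyl0.
- by rewrite bigcup_const//; exists 0%N.
- exact: setI_closed_cyl.
- move=> _ [->|[n [x ->]]]; first by rewrite !measure0.
  by rewrite h1 ?h2 ?h//; exact: measurable_cyl.
- by move=> _; rewrite h1// ltry.
- by apply: sub_sigma_algebra2 mE; exact: subsetUr.
Qed.

End Uniqueness.
End Cylinders.

Lemma geometric_borel_cantelli d (T : measurableType d) (R : realType)
    (P : probability T R) (F : (set T)^nat) (K c : R) :
  (forall n, measurable (F n)) -> 0 <= K -> 0 < c < 1 ->
  (forall n, pr P (F n) <= K * c ^+ n) -> pr P (lim_sup_set F) = 0.
Proof.
move=> mF K0 /andP[c0 c1] h.
rewrite /pr lim_sup_set_cvg0//.
apply: (@le_lt_trans _ _ (K * (1 - c)^-1)%:E); last exact: ltry.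
apply: lime_le; first exact: is_cvg_nneseries.
apply: nearW => n; rewrite /= (eq_bigr (fun i => (pr P (F i))%:E)); last first.
  by move=> i _; exact: prE.
rewrite sumEFin lee_fin.
apply: le_trans (geometric_le_lim n K0 c0 _); last by rewrite gtr0_norm.
by apply: ler_sum => i _; exact: h.
Qed.

(** * The uniform product measure, from the base-[q] digits of Lebesgue measure *)

Section CoinMeasure.
Variables (T : finType) (t0 : T) (R : realType).
Local Notation X := (@seqs T t0).
Local Notation q := #|T|.

Let q_gt0 : (0 < q)%N. Proof. by apply/card_gt0P; exists t0. Qed.

Let qR_gt0 : 0 < q%:R :> R. Proof. by rewrite ltr0n. Qed.

(* The base-[q] expansion; the junk value outside [0, 1) has measure zero. *)
Definition digits (t : R) : X := fun n =>
  if 0 <= t < 1 then nth t0 (enum T) (Num.truncn (q%:R ^+ n.+1 * t) %% q) else t0.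

Fixpoint code (x : X) (n : nat) : nat :=
  if n is m.+1 then (code x m * q + index (x m) (enum T))%N else 0%N.

Lemma index_enum_lt (t : T) : (index t (enum T) < q)%N.
Proof. by rewrite cardE index_mem mem_enum. Qed.

Lemma truncn_mulr_div (y : R) : 0 <= y ->
  (Num.truncn (q%:R * y) %/ q = Num.truncn y)%N.
Proof.
move=> y0; have /andP[] := truncn_itv y0; set n := Num.truncn y => n1 n2.
have qy0 : 0 <= q%:R * y by rewrite mulr_ge0// ltW.
have h1 : (q * n <= Num.truncn (q%:R * y))%N.
  by rewrite truncn_ge_nat// natrM ler_wpM2l// ltW.
have h2 : (Num.truncn (q%:R * y) < q * n.+1)%N.
  by rewrite truncn_lt_nat// natrM ltr_pM2l.
apply/eqP; rewrite eqn_leq; apply/andP; split.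
  by rewrite -ltnS ltn_divLR// mulnC.
by rewrite leq_divRL// mulnC.
Qed.

Lemma digits_cyl n x t : 0 <= t < 1 ->
  cyl n x (digits t) <-> Num.truncn (q%:R ^+ n * t) = code x n.
Proof.
move=> t01; have /andP[t_ge0 t_lt1] := t01.
elim: n => [|n IH]; first split=> // _.
  by apply: truncn_def; rewrite expr0 mul1r t_ge0 t_lt1.
rewrite /cyl /= in IH *; rewrite agreeS IH.
have y0 : 0 <= q%:R ^+ n * t by rewrite mulr_ge0// exprn_ge0// ltW.
have := truncn_mulr_div y0; rewrite mulrA -exprS /digits t01.
set N := Num.truncn (q%:R ^+ n.+1 * t); set M := Num.truncn _ => NM.
split=> [[<- xn]|e].
  rewrite -NM xn index_uniq ?enum_uniq -?divn_eq//.
  by rewrite -cardE ltn_mod.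
split.
  by rewrite -NM e divnMDl// divn_small ?addn0// index_enum_lt.
rewrite e modnMDl modn_small ?index_enum_lt// nth_index// mem_enum//.
Qed.

Lemma digits_cyl_itv n x :
  `[0, 1[ `&` digits @^-1` (cyl n x) =
  `[(code x n)%:R / q%:R ^+ n, (code x n).+1%:R / q%:R ^+ n[%classic.
Proof.
have qn0 : 0 < q%:R ^+ n :> R by rewrite exprn_gt0.
have codeS : (code x n < q ^ n)%N.
  elim: n {qn0} => //= n IH; rewrite expnSr.
  apply: (@leq_trans ((code x n).+1 * q)); last by rewrite leq_mul2r IH orbT.
  by rewrite mulSn addnC ltn_add2r index_enum_lt.
apply/seteqP; split=> t /=; rewrite !in_itv /=.
  move=> [t01 /(digits_cyl _ _ t01) e].
  have /andP[t0_ t1_] := t01.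
  rewrite ler_pdivrMr// ltr_pdivlMr// mulrC.
  have := truncn_itv (mulr_ge0 (ltW qn0) t0_).
  by rewrite e.
rewrite ler_pdivrMr// ltr_pdivlMr// mulrC => ht.
have t01 : 0 <= t < 1.
  have /andP[h1 h2] := ht; rewrite -(pmulr_rge0 _ qn0) -(ltr_pM2l qn0) mulr1.
  rewrite (le_trans _ h1) ?ler0n//= (lt_le_trans h2)// -natrX ler_nat.
  exact: codeS.
split=> //; apply/digits_cyl => //; exact: truncn_def.
Qed.

Lemma measurable_digits : measurable_fun [set: R] digits.
Proof.
apply: measurable_seqs => n x.
rewrite -[X in measurable X]setIT -(setUv `[0, 1[%classic) setIUr.
apply: measurableU; first by rewrite setIC digits_cyl_itv; exact: measurable_itv.
have mC : measurable (~` `[(0:R), 1[%classic) by apply: measurableC; exact: measurable_itv.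
have [h|h] := pselect (cyl n x (fun=> t0)).
  rewrite (_ : _ `&` _ = ~` `[0, 1[%classic)//.
  apply/seteqP; split=> [t []//|t ht]; split=> // i ni.
  by rewrite h// /digits; case: ifP => // h'; case: ht; rewrite /= in_itv.
rewrite (_ : _ `&` _ = set0)//; apply/seteqP; split=> // t [ct ht]; apply: h.
by move=> i ni; rewrite ct// /digits; case: ifP => // h'; case: ht; rewrite /= in_itv.
Qed.

Lemma coin_measure_exists : exists P : probability X R,
  forall n x, P (cyl n x) = ((q%:R ^- n)%:E)%E.
Proof.
pose D : set R := `[0, 1[%classic.
have mD : measurable D by exact: measurable_itv.
have [M ME] := pushforward_measure (mrestr (@lebesgue_measure R) mD)
  measurable_digits.
have Mcyl n (x : X) : M (cyl n x) = ((q%:R ^- n)%:E)%E.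
  rewrite ME /= /mrestr setIC digits_cyl_itv lebesgue_measure_itv/=.
  have qn0 : 0 < (q%:R ^+ n)^-1 :> R by rewrite invr_gt0 exprn_gt0.
  rewrite lte_fin ltr_pM2r// ltr_nat ltnS leqnn -EFinB -mulrBl.
  by rewrite -natr1 addrAC subrr add0r mul1r.
have MT : M setT = 1%E by rewrite -(cyl0 (fun=> t0)) Mcyl expr0 invr1.
(* [M] already has mass 1; normalising it leaves its values alone and supplies the structure of a
   probability. *)
exists (mnormalize M (dirac (point : X))) => n x.
by rewrite -(Mcyl n x) /= /mnormalize MT /= onee_eq0 /= invr1 mule1.
Qed.

Definition coin : probability X R := projT1 (cid coin_measure_exists).

Lemma coin_cyl n x : pr coin (cyl n x) = q%:R ^- n.
Proof. by rewrite /pr /coin (projT2 (cid coin_measure_exists)). Qed.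

Lemma coin_unique (m : set X -> R) (N : nat) : real_measure m ->
  (forall n x, (N <= n)%N -> m (cyl n x) = q%:R ^- n) ->
  forall E, measurable E -> m E = pr coin E.
Proof.
move=> rm h; apply: (@real_measure_unique _ _ _ _ _ N) => //.
  exact: real_measure_pr.
by move=> n x /h ->; rewrite coin_cyl.
Qed.

(** This is conditioning on the first coordinate. It drives the inductions on the length of the
    walk, whose first step is the outermost factor. *)
Lemma coin_self_similar E : measurable E ->
  pr coin E = q%:R^-1 * \sum_(t : T) pr coin (scons t @^-1` E).
Proof.
move=> mE; apply/esym; move: E mE; apply: (@coin_unique _ 1).
  apply: real_measureZ; first by rewrite invr_ge0 ltW.
  apply: real_measure_sum_fin => t.
  under eq_fun do rewrite -[X in pr coin X]setTI.
  by apply: real_measure_pre => //; exact: measurable_scons.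
move=> [//|n] x _; rewrite (bigD1 (x 0))//= big1 ?addr0.
  rewrite (_ : _ @^-1` _ = cyl n (fun i => x i.+1)).
    by rewrite coin_cyl exprS invfM.
  apply/seteqP; split=> y /= h.
    by move=> i ni; rewrite (h i.+1).
  by move=> [|i] //= ni; exact: h.
move=> t tx; rewrite (_ : _ @^-1` _ = set0) ?pr0//.
apply/seteqP; split=> // y /= /(_ 0 isT) /= /esym/eqP.
by rewrite (negbTE tx).
Qed.


(** * A zero-one law of Lévy *)

Definition sdiff (A B : set X) : set X := (A `&` ~` B) `|` (B `&` ~` A).

Lemma measurable_sdiff A B : measurable A -> measurable B -> measurable (sdiff A B).
Proof.
by move=> mA mB; apply: measurableU; apply: measurableI => //; exact: measurableC.
Qed.

Definition finitary (A : set X) : Prop :=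
  exists n, forall x y, agree n x y -> A x <-> A y.

Lemma finitary_measurable A : finitary A -> measurable A.
Proof. by case=> n; exact: measurable_dep_set. Qed.

Lemma finitaryU A B : finitary A -> finitary B -> finitary (A `|` B).
Proof.
move=> [n hA] [m hB]; exists (maxn n m) => x y xy /=.
by rewrite (hA x y) ?(hB x y)//; apply: agree_le xy; lia.
Qed.

Definition approximable (A : set X) : Prop := measurable A /\
  forall e : R, 0 < e -> exists B, finitary B /\ pr coin (sdiff A B) < e.

Lemma approximableU A B : approximable A -> approximable B ->
  approximable (A `|` B).
Proof.
move=> [mA hA] [mB hB]; split; first exact: measurableU.
move=> e e0; have e20 : 0 < e / 2 by lra.
have [A' [fA' dA]] := hA _ e20; have [B' [fB' dB]] := hB _ e20.
exists (A' `|` B'); split; first exact: finitaryU.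
have mA' := finitary_measurable fA'; have mB' := finitary_measurable fB'.
have := pr_setU_le coin (measurable_sdiff mA mA') (measurable_sdiff mB mB').
suff : pr coin (sdiff (A `|` B) (A' `|` B')) <=
       pr coin (sdiff A A' `|` sdiff B B') by lra.
apply: le_pr.
- by apply: measurable_sdiff; exact: measurableU.
- by apply: measurableU; exact: measurable_sdiff.
- by move=> x; rewrite /sdiff /=; tauto.
Qed.

(** Approximable sets form a sigma-algebra containing the cylinders. For a countable union, half of
    the error pays for stopping at a finite stage and half for approximating that stage. *)
Lemma measurable_approximable A : measurable A -> approximable A.
Proof.
move: A; change ((measurable : set (set X)) `<=` approximable).
apply: smallest_sub; last first.
  move=> _ [n [x ->]]; split; first exact: measurable_cyl.
  move=> e e0; exists (cyl n x); split.
    exists n => y z yz; split=> h; first exact: agree_trans yz.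
    exact: agree_trans (agree_sym yz).
  by rewrite /sdiff setICr setU0 pr0.
split.
- split=> // e e0; exists set0; split; first by exists 0%N.
  by rewrite /sdiff setICr setU0 pr0.
- move=> A [mA hA]; rewrite setTD; split; first exact: measurableC.
  move=> e /hA[B [[n fB] dB]]; exists (~` B); split.
    by exists n => x y /fB h /=; rewrite h.
  rewrite (_ : sdiff _ _ = sdiff A B)//.
  by rewrite /sdiff !setCK setUC; congr (_ `|` _); rewrite setIC.
- move=> F hF; have mF k : measurable (F k) by case: (hF k).
  have mU : measurable (\bigcup_n F n) by exact: bigcupT_measurable.
  split=> // e e0.
  pose G n := \big[setU/set0]_(i < n.+1) F i.
  have aG n : approximable (G n).
    rewrite /G; elim: n.+1 => [|{}n IH].
      rewrite big_ord0; split=> // d d0; exists set0; split; first by exists 0%N.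
      by rewrite /sdiff setICr setU0 pr0.
    by rewrite big_ord_recr; exact: approximableU.
  have GU : \bigcup_n G n = \bigcup_n F n by exact: bigcup_bigsetU_bigcup.
  have : coin (G n) @[n --> \oo] --> coin (\bigcup_n G n).
    apply: nondecreasing_cvg_mu.
    - by move=> k; case: (aG k).
    - by rewrite GU.
    - by apply/nondecreasing_seqP => n; rewrite subsetEset /G [X in _ `<=` X]big_ord_recr; exact: subsetUl.
  rewrite GU prE// => /fine_cvgP[_].
  move=> /cvgrPdist_lt/(_ (e / 2)) []; first by lra.
  move=> n _ /(_ n (leqnn n)) /=; rewrite -/(pr coin (G n)) => dn.
  have [mG hG] := aG n.
  have [B [fB dB]] := hG (e / 2) ltac:(lra).
  exists B; split=> //; have mB := finitary_measurable fB.
  have GsubU : G n `<=` \bigcup_k F k by rewrite -GU; exact: bigcup_sup.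
  have : pr coin (\bigcup_k F k) =
      pr coin (G n) + pr coin (\bigcup_k F k `&` ~` G n).
    by rewrite [LHS](pr_split _ mU mG) setIC (setIidl GsubU).
  have mUG : measurable (\bigcup_k F k `&` ~` G n).
    by apply: measurableI => //; exact: measurableC.
  have := pr_setU_le coin mUG (measurable_sdiff mG mB).
  suff : pr coin (sdiff (\bigcup_k F k) B) <=
       pr coin ((\bigcup_k F k `&` ~` G n) `|` sdiff (G n) B).
    have := ler_norm (pr coin (\bigcup_k F k) - pr coin (G n)); lra.
  apply: le_pr.
  + exact: measurable_sdiff.
  + by apply: measurableU => //; exact: measurable_sdiff.
  + by move=> x; have := GsubU x; rewrite /sdiff /=; case: (pselect (G n x)); tauto.
Qed.

(** The conditional probability of [A] given the first [n] coordinates, a cylinder of length [n]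
    having mass [q ^- n]; in [n] it is the martingale of Lévy's theorem. *)
Definition density (A : set X) (n : nat) (w : X) : R :=
  q%:R ^+ n * pr coin (A `&` cyl n w).

Lemma density_agree A n w w' : agree n w w' -> density A n w = density A n w'.
Proof. by move=> /cylP h; rewrite /density h. Qed.

Lemma density_le A B n w : measurable A -> measurable B -> A `<=` B ->
  density A n w <= density B n w.
Proof.
move=> mA mB AB; apply: ler_wpM2l; first by rewrite exprn_ge0// ltW.
have mc := measurable_cyl n w.
by apply: le_pr; [exact: measurableI|exact: measurableI|exact: setSI].
Qed.

Lemma densityU A B n w : measurable A -> measurable B ->
  density (A `|` B) n w <= density A n w + density B n w.
Proof.
move=> mA mB; rewrite /density -mulrDr; apply: ler_wpM2l.
  by rewrite exprn_ge0// ltW.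
have mc := measurable_cyl n w.
by rewrite setIUl; apply: pr_setU_le; exact: measurableI.
Qed.

Lemma density_finitary A : finitary A ->
  exists n0, forall n w, (n0 <= n)%N -> density A n w = \1_A w.
Proof.
move=> [n0 hA]; exists n0 => n w n0n.
have qn0 : q%:R ^+ n != 0 :> R by rewrite expf_neq0// gt_eqF.
rewrite /density indicE; case: (boolP (w \in A)) => /=; rewrite ?notin_setE ?inE => wA.
  rewrite (_ : _ `&` _ = cyl n w) ?coin_cyl ?mulfV//.
  apply/seteqP; split=> [y []//|y wy]; split=> //.
  by apply/(hA w) => //; exact: agree_le wy.
rewrite (_ : _ `&` _ = set0) ?pr0 ?mulr0//.
apply/seteqP; split=> // y [Ay wy]; apply: wA.
by apply/(hA w y) => //; exact: agree_le wy.
Qed.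

(** [F] is a union of cylinders of length [n], in each of which [A] occupies a proportion above
    [e]. *)
Lemma density_markov A n (F : set X) (e : R) : measurable A ->
  (forall x y, agree n x y -> F x <-> F y) ->
  (forall x, F x -> e < density A n x) -> e * pr coin F <= pr coin (A `&` F).
Proof.
move=> mA hF he.
pose w (s : n.-tuple T) : X := fun i => nth t0 s i.
have wP (x : X) : cyl n (w [tuple x i | i < n]) x.
  move=> i ni; rewrite /w.
  by rewrite -[i]/(nat_of_ord (Ordinal ni)) -tnth_nth tnth_mktuple.
have mF : measurable F by exact: measurable_dep_set hF.
have part E : measurable E -> pr coin E = \sum_(s : n.-tuple T) pr coin (E `&` cyl n (w s)).
  move=> mE; apply: pr_sum.
  - by move=> s; apply: measurableI => //; exact: measurable_cyl.
  - move=> s t st; apply/seteqP; split=> // x [[_ sx] [_ tx]].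
    move/eqP: st; apply; apply: eq_from_tnth => i.
    by rewrite !(tnth_nth t0); apply: (agree_trans sx (agree_sym tx)).
  - by move=> x; split=> [Ex|[s []]//]; exists [tuple x i | i < n].
rewrite (part F)// (part (A `&` F)); last exact: measurableI.
rewrite mulr_sumr; apply: ler_sum => s _.
have [Fs|Fs] := pselect (F (w s)); last first.
  rewrite (_ : F `&` _ = set0) ?pr0 ?mulr0 ?pr_ge0//.
  by apply/seteqP; split=> // y [Fy /hF h]; apply: Fs; apply/h.
have FE : F `&` cyl n (w s) = cyl n (w s).
  by apply/seteqP; split=> [y []//|y sy]; split=> //; apply/(hF (w s)).
rewrite -setIA FE coin_cyl ler_pdivrMr ?exprn_gt0// mulrC ltW//.
exact: he.
Qed.

Definition excursion (A : set X) (e : R) : set X :=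
  [set x | exists n, e < density A n x].

Let first_excursion A e n : set X :=
  [set x | e < density A n x /\ forall k, (k < n)%N -> density A k x <= e].

Let first_excursion_dep A e n x y : agree n x y ->
  first_excursion A e n x <-> first_excursion A e n y.
Proof.
move=> xy; rewrite /first_excursion /= (density_agree _ xy).
suff h : (forall k, (k < n)%N -> density A k x <= e) <->
         (forall k, (k < n)%N -> density A k y <= e) by tauto.
have d k : (k < n)%N -> density A k x = density A k y.
  by move=> kn; apply: density_agree; apply: agree_le xy; exact: ltnW.
by split=> h k kn; [rewrite -d ?h|rewrite d ?h].
Qed.

Let excursionE A e : excursion A e = \bigcup_n first_excursion A e n.
Proof.
apply/seteqP; split=> [x [n]|x [n _ []]]; last by exists n.
elim/ltn_ind: n => n IH en.
have [h|/existsNP[k /not_implyP[kn /negP]]] :=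
  pselect (forall k, (k < n)%N -> density A k x <= e); first by exists n.
by rewrite -ltNge => /(IH k kn).
Qed.

Lemma measurable_excursion A e : measurable (excursion A e).
Proof.
rewrite excursionE; apply: bigcupT_measurable => n.
exact: measurable_dep_set (@first_excursion_dep A e n).
Qed.

(** Doob's maximal inequality. Cutting the excursion set by the first time the density exceeds [e]
    gives disjoint pieces, each decided by finitely many coordinates, to which [density_markov]
    applies. *)
Lemma maximal_inequality A e : measurable A -> 0 <= e ->
  e * pr coin (excursion A e) <= pr coin A.
Proof.
move=> mA e0; set F := first_excursion A e.
have mF n : measurable (F n) by exact: measurable_dep_set (@first_excursion_dep A e n).
have tF : trivIset setT F.
  apply/trivIsetP => i j _ _; wlog ij : i j / (i < j)%N.
    move=> h ij; have [k|k|k] := ltngtP i j; [exact: h|by rewrite setIC; apply: h; rewrite // eq_sym|].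
    by rewrite k eqxx in ij.
  move=> _; apply/seteqP; split=> // x [[h _] [_ /(_ i ij)]].
  by rewrite leNgt h.
have mE := measurable_excursion A e.
apply: (@le_trans _ _ (pr coin (A `&` excursion A e))); last first.
  by apply: le_pr => //; exact: measurableI.
rewrite -lee_fin EFinM -!prE//; last exact: measurableI.
rewrite excursionE setI_bigcupr !measure_bigcup//; last 2 first.
- by move=> n _; exact: measurableI.
- exact: trivIset_setIl.
rewrite -nneseriesZl//; apply: lee_nneseries => n _.
  by rewrite mule_ge0.
suff : (e%:E * coin (F n) <= coin (A `&` F n))%E by [].
rewrite !prE//; last exact: measurableI.
rewrite -EFinM lee_fin; apply: (density_markov (n := n)) => //.
  exact: first_excursion_dep.
by move=> x [].
Qed.

(** The densities of a finitary set are eventually equal to its indicator. A general [A] differs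
    from a finitary [B k] by a set whose densities stay below [e k] with high probability, by the
    maximal inequality. *)
Theorem levy_zero_one A : measurable A -> exists N,
  [/\ measurable N, pr coin N = 0 &
    forall w, ~ N w -> density A n w @[n --> \oo] --> (\1_A w : R)].
Proof.
move=> mA; have [_ hA] := measurable_approximable mA.
pose e k : R := 2^-1 ^+ k.
have e_gt0 k : 0 < e k by rewrite exprn_gt0// invr_gt0.
have e_le1 k : e k <= 1 by apply: exprn_ile1; lra.
(* The maximal inequality divides by [e k], so an error of [e k ^+ 2] leaves [Bad k] with
   probability at most [2 * e k], which is summable. *)
have /choice[B hB] k : exists B, finitary B /\ pr coin (sdiff A B) < e k ^+ 2.
  by apply: hA; rewrite exprn_gt0.
have mB k : measurable (B k) by apply: finitary_measurable; case: (hB k).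
have mS k : measurable (sdiff A (B k)) by exact: measurable_sdiff.
pose Bad k := sdiff A (B k) `|` excursion (sdiff A (B k)) (e k).
have mBad k : measurable (Bad k) by apply: measurableU => //; exact: measurable_excursion.
exists (lim_sup_set Bad); split.
- by apply: bigcap_measurable => // n _; exact: bigcup_measurable.
- apply: (@geometric_borel_cantelli _ _ _ _ _ 2 2^-1) => //; first by lra.
  move=> k; have [_ hS] := hB k.
  have := maximal_inequality (mS k) (ltW (e_gt0 k)).
  have := pr_setU_le coin (mS k) (measurable_excursion (sdiff A (B k)) (e k)).
  rewrite -/(Bad k) -/(e k).
  have h2 : e k ^+ 2 <= e k by rewrite expr2 ler_piMl// ltW.
  move=> h3 h4.
  have : e k * pr coin (excursion (sdiff A (B k)) (e k)) <= e k * e k.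
    by rewrite -expr2; lra.
  by rewrite ler_pM2l// => h5; lra.
- move=> w /existsNP[n0 /not_implyP[_ hn0]]; apply/cvgrPdist_le => eps eps0.
  have [k [n0k ke]] : exists k, (n0 <= k)%N /\ e k < eps.
    have [N _ hN] := near_infty_natSinv_expn_lt (PosNum eps0).
    exists (maxn N n0); split; first exact: leq_maxr.
    by have := hN (maxn N n0) (leq_maxl _ _); rewrite /e exprVn div1r.
  have wBad : ~ Bad k w by move=> h; apply: hn0; exists k.
  have [fB _] := hB k; have [n1 hn1] := density_finitary fB.
  exists n1 => // n /= n1n.
  have wAB : \1_A w = \1_(B k) w :> R.
    rewrite !indicE; congr (_%:R); congr nat_of_bool; apply/idP/idP.
      rewrite !inE => Aw; apply: contrapT => Bw; apply: wBad; left; left; split=> //.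
    rewrite !inE => Bw; apply: contrapT => Aw; apply: wBad; left; right; split=> //.
  have dS : density (sdiff A (B k)) n w <= e k.
    by rewrite leNgt; apply/negP => h; apply: wBad; right; exists n.
  have mU X1 X2 : measurable X1 -> measurable X2 -> measurable (X1 `|` X2 : set X).
    exact: measurableU.
  have h1 : density A n w <= density (B k) n w + density (sdiff A (B k)) n w.
    apply: le_trans (densityU _ _ (mB k) (mS k)).
    apply: density_le => //; first exact: mU.
    by move=> y; rewrite /sdiff /=; case: (pselect (B k y)); tauto.
  have h2 : density (B k) n w <= density A n w + density (sdiff A (B k)) n w.
    apply: le_trans (densityU _ _ mA (mS k)).
    apply: density_le => //; first exact: mU.
    by move=> y; rewrite /sdiff /=; case: (pselect (A y)); tauto.
  rewrite wAB -(hn1 n w n1n) ler_norml; apply/andP; split; lra.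
Qed.

End CoinMeasure.

(** * The action of the free group *)

Local Notation F2 := (fgroup 'I_2).

Definition lact (l : letter 'I_2) : bits -> bits :=
  if l.1 == ord0 then (if l.2 then odoV else odo)
  else (if l.2 then hypV else hyp).

Lemma lactK l x : lact (linv l) (lact l x) = x.
Proof.
by case: l => i []; rewrite /lact /=; case: eqP => _;
  rewrite ?odoK ?odoVK ?hypK ?hypVK.
Qed.

Lemma lactKV l x : lact l (lact (linv l) x) = x.
Proof. by rewrite -{1}(linvK l) lactK. Qed.

Definition wact (w : seq (letter 'I_2)) (x : bits) : bits := foldr lact x w.

Definition gact (g : F2) (x : bits) : bits := wact g x.

Lemma wact_cat w v x : wact (w ++ v) x = wact w (wact v x).
Proof. by rewrite /wact foldr_cat. Qed.

Lemma wact_push l w x : wact (push l w) x = lact l (wact w x).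
Proof.
case: w => //= m w; case: eqP => [->|//]; by rewrite lactKV.
Qed.

Lemma gact_action : is_group_action gact.
Proof.
split=> // g h x; rewrite /gact /=.
by elim: (fword g) => //= l w IH; rewrite wact_push IH.
Qed.

Lemma gactM g h x : gact (g * h)%g x = gact g (gact h x).
Proof. by case: gact_action. Qed.

Lemma gactK g : cancel (gact g) (gact g^-1%g).
Proof. by move=> x; rewrite -gactM mulVg. Qed.

Definition gu : F2 := fgen ord0.
Definition gh : F2 := fgen ord_max.

Lemma gact_u : gact gu = odo. Proof. by []. Qed.
Lemma gact_h : gact gh = hyp. Proof. by []. Qed.
Lemma gact_uV : gact gu^-1%g = odoV. Proof. by rewrite fgenV. Qed.
Lemma gact_hV : gact gh^-1%g = hypV. Proof. by rewrite fgenV. Qed.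

Lemma gact_uX k : gact (gu ^+ k)%g =1 iter k odo.
Proof. by elim: k => // k IH x; rewrite expgS gactM IH. Qed.

(* The number of bits of [hypV y] determined by the first [n >= 2] bits of [y]. *)
Definition level (n : nat) (y : bits) : nat :=
  if y 0 then n.+1 else if y 1%N then n else n.-1.

(** Two bits show the prefix to be replaced, and already for [n = 2] the [level n y] bits on the
    right contain its replacement [11], [10] or [0]; this gives both directions. *)
Lemma agree_stretchV n y z : (2 <= n)%N ->
  agree n y z <-> agree (level n y) (stretchV y) (stretchV z).
Proof.
case: n => [//|[//|n]] _; rewrite /level /stretchV.
split=> [yz|].
  rewrite -(yz 0)// -(yz 1%N)//.
  case y0: (y 0); last case y1: (y 1%N) => /=.
  - by move=> [|i] //= ni; exact: yz.
  - by move=> [|[|i]] //= ni; exact: yz.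
  - by move=> i ni; exact: yz.
case y0: (y 0); last case y1: (y 1%N) => /=.
- case z0: (z 0) => h; first by move=> i ni; exact: (h i.+1).
  have := h 0 isT; have := h 1%N isT.
  by case z1: (z 1%N) => /=; rewrite ?z1 ?y0.
- have h0 := fun h : agree n.+2 _ _ => (h 0 isT, h 1%N isT).
  case z0: (z 0) => h; first by have := h 1%N isT; rewrite /= z0.
  case z1: (z 1%N) h => h; last by have := h 0 isT; rewrite /= z1.
  by move=> [|[|i]] ni; rewrite ?y0 ?z0 ?y1 ?z1//; exact: (h i.+2 ni).
- case z0: (z 0) => h; first by have := h 0 isT; rewrite /= y1.
  case z1: (z 1%N) h => h; first by have := h 0 isT; rewrite /= y1.
  by move=> [|i] ni; rewrite ?y0 ?z0//; exact: (h i ni).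
Qed.

Lemma agree_hypV n y z : (2 <= n)%N ->
  agree n y z <-> agree (level n y) (hypV y) (hypV z).
Proof. by move=> n2; rewrite /hypV agree_scatV -agree_stretchV. Qed.

Lemma lact_lip l n x y : agree n.+1 x y -> agree n (lact l x) (lact l y).
Proof.
have st a b m : agree m.+1 a b -> agree m (stretch a) (stretch b).
  rewrite /stretch => ab; rewrite -(ab 0)//; case: m ab => // m ab; rewrite -(ab 1%N)//.
  case a0: (a 0) => /=; last by move=> [|i] //= im; apply: ab; lia.
  case: (a 1%N) => /=; first by move=> i im; exact: ab.
  by move=> [|[|i]] //= im; apply: ab; lia.
have stV a b m : agree m.+1 a b -> agree m (stretchV a) (stretchV b).
  rewrite /stretchV => ab; rewrite -(ab 0)//; case: m ab => // m ab; rewrite -(ab 1%N)//.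
  case a0: (a 0) => /=; first by move=> [|i] //= im; apply: ab; lia.
  case: (a 1%N) => /=; last by move=> i im; exact: ab.
  by move=> [|[|i]] //= im; apply: ab; lia.
move=> xy; case: l => i e; rewrite /lact /=.
case: eqP => _; case: e.
- by apply/agree_odoV; exact: agree_le xy.
- by apply/agree_odo; exact: agree_le xy.
- by rewrite /hypV; apply/agree_scatV; exact: stV.
- by rewrite /hyp; apply: st; apply/agree_scat.
Qed.

Lemma wact_lip w n x y : agree (n + size w) x y ->
  agree n (wact w x) (wact w y).
Proof.
elim: w n => [|l w IH] n /=; first by rewrite addn0.
by rewrite addnS -addSn => /IH h; apply: lact_lip.
Qed.

Lemma measurable_wact w : measurable_fun setT (wact w).
Proof.
apply: measurable_seqs => n x.
apply: (measurable_dep_set (n := n + size w)) => y z yz.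
have h := wact_lip yz; rewrite /cyl /=.
split=> k; first exact: agree_trans h.
exact: agree_trans (agree_sym h).
Qed.

Lemma measurable_gact g : measurable_fun setT (gact g).
Proof. exact: measurable_wact. Qed.

Lemma measurable_gact_pre g (E : set bits) : measurable E ->
  measurable (gact g @^-1` E).
Proof. by move=> mE; rewrite -[X in measurable X]setTI; exact: measurable_gact. Qed.

(** * How the generators transform the uniform measure *)

Section Measure.
Variable R : realType.

Definition nu : probability bits R := coin false R.

Lemma nu_cyl n (x : bits) : pr nu (cyl n x) = 2%:R ^- n.
Proof. by rewrite coin_cyl card_bool. Qed.

Lemma nu_unique (m : set bits -> R) N : real_measure m ->
  (forall n x, (N <= n)%N -> m (cyl n x) = 2%:R ^- n) ->
  forall E, measurable E -> m E = pr nu E.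
Proof.
by move=> rm h; apply: (@coin_unique _ _ _ _ N) => // n x /h ->; rewrite card_bool.
Qed.

Lemma real_measure_nu_pre g : real_measure (fun E => pr nu (gact g @^-1` E)).
Proof.
have := real_measure_pre nu (measurable_gact g) measurableT.
by under [in X in X -> _]eq_fun do rewrite setTI.
Qed.

Lemma nu_odo E : measurable E -> pr nu (odo @^-1` E) = pr nu E.
Proof.
move: E; apply: (@nu_unique _ 0); first exact: (real_measure_nu_pre gu).
move=> n x _; rewrite -(nu_cyl n (odoV x)); congr (pr nu _).
apply/seteqP; split=> y; rewrite /cyl /= => h.
  by apply/agree_odo; rewrite odoVK.
by rewrite -(odoVK x); apply/agree_odo.
Qed.

Lemma nu_odoX k E : measurable E -> pr nu (gact (gu ^+ k)%g @^-1` E) = pr nu E.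
Proof.
move=> mE; elim: k => [//|k IH]; rewrite -[RHS]IH -[RHS]nu_odo.
  by congr (pr nu _); apply/funext => x; rewrite /= expgSr gactM.
exact: measurable_gact_pre.
Qed.

Definition quarter (a b : bool) : set bits := [set x | x 0 = a /\ x 1%N = b].

Lemma measurable_quarter a b : measurable (quarter a b).
Proof.
apply: (measurable_dep_set (n := 2)) => x y xy.
by rewrite /quarter /= (xy 0)// (xy 1%N).
Qed.

Lemma nu_quarter_cyl a b n x : (2 <= n)%N ->
  pr nu (quarter a b `&` cyl n x) =
  if (x 0 == a) && (x 1%N == b) then 2%:R ^- n else 0.
Proof.
move=> n2; case: ifP => [/andP[/eqP x0 /eqP x1]|h].
  rewrite -(nu_cyl n x); congr (pr nu _); apply/seteqP; split=> [y []//|y xy].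
  by split=> //; rewrite /quarter /= -(xy 0) ?(ltnW n2)// -(xy 1%N).
rewrite (_ : _ `&` _ = set0) ?pr0//; apply/seteqP; split=> // y [[y0 y1] xy].
by move: h; rewrite (xy 0) ?(ltnW n2)// (xy 1%N)// y0 y1 !eqxx.
Qed.

(** Both sides are measures in [E], and the preimage of a cylinder of length [n >= 2] is one
    cylinder of length [level n]. Lengths [n - 1], [n], [n + 1] account for the weights 2, 1,
    1/2. *)
Lemma nu_hyp E : measurable E ->
  pr nu (hyp @^-1` E) =
    2 * pr nu (quarter false false `&` E) + pr nu (quarter false true `&` E) +
    2^-1 * (pr nu (quarter true false `&` E) + pr nu (quarter true true `&` E)).
Proof.
move: E; apply: (@real_measure_unique _ _ _ _ _ 2).
- exact: (real_measure_nu_pre gh).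
- have q a b := real_measure_restr nu (measurable_quarter a b).
  apply: real_measureD; last by apply: real_measureZ; [lra|exact: real_measureD].
  by apply: real_measureD => //; apply: real_measureZ.
- move=> n x n2; rewrite !nu_quarter_cyl//.
  have -> : hyp @^-1` cyl n x = cyl (level n x) (hypV x).
    by apply/seteqP; split=> y; have := agree_hypV x (hyp y) n2; rewrite hypK => -[].
  rewrite nu_cyl /level; case: n n2 => // n _.
  have h2 : 2 ^+ n != 0 :> R by rewrite expf_neq0.
  by case: (x 0); case: (x 1%N); rewrite /= ?exprS; field.
Qed.

Lemma nu_hypV E : measurable E ->
  pr nu (hypV @^-1` E) =
    2^-1 * (pr nu (quarter false false `&` E) + pr nu (quarter false true `&` E)) +
    pr nu (quarter true false `&` E) + 2 * pr nu (quarter true true `&` E).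
Proof.
(* Here a cylinder in the quarter [11] pulls back to one of length [n - 1], and [agree_hypV]
   requires that length to be at least 2. *)
move: E; apply: (@real_measure_unique _ _ _ _ _ 3).
- by have := real_measure_nu_pre gh^-1%g; rewrite gact_hV.
- have q a b := real_measure_restr nu (measurable_quarter a b).
  apply: real_measureD; last by apply: real_measureZ.
  apply: real_measureD => //; apply: real_measureZ; first by lra.
  exact: real_measureD.
- move=> n x n3; rewrite !nu_quarter_cyl; try lia.
  have pre k : (2 <= k)%N -> level k (hyp x) = n ->
      pr nu (hypV @^-1` cyl n x) = 2 ^- k.
    move=> k2 kn; rewrite -(nu_cyl k (hyp x)); congr (pr nu _).
    apply/seteqP; split=> y; have := agree_hypV (hyp x) y k2;
      by rewrite hypK kn => -[].
  case: n n3 pre => // n n3 pre.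
  have h2 : 2 ^+ n != 0 :> R by rewrite expf_neq0.
  case x0: (x 0); last first.
    rewrite (pre n.+2) /level /hyp /stretch; try lia.
      by case: (x 1%N); rewrite /= ?exprS; field.
    by rewrite !scat_small// x0 /= scat_small// x0.
  case x1: (x 1%N).
    rewrite (pre n) /level /hyp /stretch; try lia.
      by rewrite /= exprS; field.
    by rewrite !scat_small// x0 x1 /= scat_small// x1.
  rewrite (pre n.+1) /level /hyp /stretch; try lia.
    by rewrite /= exprS; field.
  by rewrite !scat_small// x0 x1.
Qed.

Lemma nu_odoV E : measurable E -> pr nu (odoV @^-1` E) = pr nu E.
Proof.
move=> mE; have mV : measurable (odoV @^-1` E).
  by rewrite -gact_uV; exact: measurable_gact_pre.
rewrite -(nu_odo mV); congr (pr nu _).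
by apply/seteqP; split=> x /=; rewrite odoK.
Qed.

(** Quasi-invariance of [nu]: it allows an exceptional null set to be enlarged to the null union of
    its translates. *)
Lemma nu_wact0 w E : measurable E -> pr nu E = 0 -> pr nu (wact w @^-1` E) = 0.
Proof.
have letter0 l F : measurable F -> pr nu F = 0 -> pr nu (lact l @^-1` F) = 0.
  move=> mF F0; have q a b : pr nu (quarter a b `&` F) = 0.
    by apply: pr_setI0 => //; exact: measurable_quarter.
  rewrite /lact; case: eqP => _; case: l.2.
  - by rewrite nu_odoV.
  - by rewrite nu_odo.
  - by rewrite nu_hypV// !q; lra.
  - by rewrite nu_hyp// !q; lra.
elim: w E => // l w IH E mE E0 /=.
apply: (IH (lact l @^-1` E)); last exact: letter0.
by rewrite -[X in measurable X]setTI; apply: (@measurable_wact [:: l]).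
Qed.

Lemma nu_gact0 g E : measurable E -> pr nu E = 0 -> pr nu (gact g @^-1` E) = 0.
Proof. exact: nu_wact0. Qed.

Lemma quarter_odo a b x :
  quarter (~~ a) (b (+) a) (odo x) <-> quarter a b x.
Proof.
rewrite /quarter /= /odo /tri /carry /= andbT.
by case: (x 0); case: (x 1%N); case: a; case: b => /=; split=> -[].
Qed.

Lemma nu_quarter_odo a b E : measurable E ->
  pr nu (quarter a b `&` odo @^-1` E) = pr nu (quarter (~~ a) (b (+) a) `&` E).
Proof.
move=> mE; have mq := measurable_quarter (~~ a) (b (+) a).
rewrite -[RHS]nu_odo; last exact: measurableI.
congr (pr nu _); apply/seteqP.
by split=> x [] /quarter_odo.
Qed.

Lemma nu_quarters E : measurable E -> pr nu E =
  pr nu (quarter false false `&` E) + pr nu (quarter false true `&` E) +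
  pr nu (quarter true false `&` E) + pr nu (quarter true true `&` E).
Proof.
move=> mE; have mq := measurable_quarter.
rewrite (@pr_sum _ _ _ nu (bool * bool)%type (fun ab => quarter ab.1 ab.2 `&` E)).
- by rewrite -(pair_bigA _ (fun a b => pr nu (quarter a b `&` E))) /= !big_bool/=; lra.
- by move=> i; exact: measurableI.
- move=> [a b] [c e] ne; apply/seteqP; split=> // x [[[/= a0 b1] _] [[/= c0 e1] _]].
  by move: ne; rewrite -a0 -b1 c0 e1 eqxx.
- by move=> x; split=> [Ex|[? []//]]; exists (x 0, x 1%N).
Qed.

(** * The driving measure *)

Definition step_index := (bool + bool * 'I_4)%type.

(** In [u^i h u^i] the outer power rotates the quarters of a target set and yields stationarity, the
    inner one being absorbed by invariance under [u]. For contraction the roles are exchanged: the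
    outer power is an isometry and the inner one moves a pair of points through all quarters. *)
Definition step (t : step_index) : F2 :=
  match t with
  | inl e => if e then gu^-1 else gu
  | inr (e, i) => gu ^+ i * (if e then gh^-1 else gh) * gu ^+ i
  end%g.

Lemma card_step : #|{: step_index}| = 10.
Proof. by rewrite card_sum card_prod card_bool card_ord. Qed.

(* Conjugation by powers of the odometer permutes the four quarters cyclically,
   and the rates 2, 1, 1/2, 1/2 by which [hyp] scales the measure on them add up
   to 4, as do those of [hypV]. *)
Lemma step_stationary E : measurable E ->
  \sum_(t : step_index) pr nu (gact (step t) @^-1` E) = 10 * pr nu E.
Proof.
move=> mE; rewrite big_sumType /= big_bool /= gact_u gact_uV nu_odo// nu_odoV//.
pose e a b := pr nu (quarter a b `&` E).
have mo k : measurable (gact (gu ^+ k)%g @^-1` E) by exact: measurable_gact_pre.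
have rot k a b : pr nu (quarter a b `&` gact (gu ^+ k.+1)%g @^-1` E) =
    pr nu (quarter (~~ a) (b (+) a) `&` gact (gu ^+ k)%g @^-1` E).
  rewrite -nu_quarter_odo//; congr (pr nu (_ `&` _)).
  by apply/funext => x /=; rewrite expgSr gactM.
have conj k g : pr nu (gact (gu ^+ k * g * gu ^+ k)%g @^-1` E) =
    pr nu (gact g @^-1` (gact (gu ^+ k)%g @^-1` E)).
  rewrite -[RHS](nu_odoX k); last exact: measurable_gact_pre.
  by congr (pr nu _); apply/funext => x /=; rewrite !gactM.
pose F (e : bool) (i : 'I_4) := pr nu (gact (gu ^+ i *
  (if e then gh^-1 else gh) * gu ^+ i)%g @^-1` E).
rewrite [X in _ + X](_ : _ = \sum_p F p.1 p.2); last by apply: eq_bigr => -[].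
rewrite -(pair_bigA _ F) /= big_bool /F /=.
rewrite !big_ord_recl !big_ord0 /= !conj gact_h gact_hV.
rewrite !nu_hyp// !nu_hypV// /bump /= !addn0 !add1n !rot /= (nu_quarters mE).
rewrite (_ : gact (gu ^+ 0)%g @^-1` E = E)//.
lra.
Qed.

End Measure.

Lemma step_wordE e i : fword (step (inr (e, i))) =
  nseq i (ord0, false) ++ (ord_max, e) :: nseq i (ord0, false).
Proof.
have pw k : fword (gu ^+ k)%g = nseq k (ord0, false).
  elim: k => // k IH; rewrite expgS.
  transitivity (push (ord0, false) (fword (gu ^+ k)%g)) => //.
  by rewrite IH; case: k {IH}.
have hw k : fword ((if e then gh^-1 else gh) * gu ^+ k)%g =
    (ord_max, e) :: nseq k (ord0, false).
  transitivity (push (ord_max, e) (fword (gu ^+ k)%g)).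
    by rewrite /gh fgenV; case: e.
  by rewrite pw; case: k.
have uw k w : fword (gu ^+ k * w)%g = foldr (@push _) w (nseq k (ord0, false)).
  by rewrite -pw.
rewrite /step -mulgA uw hw.
suff h k m : foldr (@push 'I_2) ((ord_max, e) :: nseq k (ord0, false))
    (nseq m (ord0, false)) = nseq m (ord0, false) ++ (ord_max, e) :: nseq k (ord0, false).
  exact: h.
by elim: m => //= m ->; case: m.
Qed.

(** The words of [step_wordE] are reduced, hence told apart by length and middle letter. So [tau]
    gives mass exactly 1/10 to ten distinct elements. *)
Lemma step_inj : injective step.
Proof.
have uw e : fword (if e then gu^-1 else gu)%g = [:: (ord0, e)].
  by case: e; rewrite /gu ?fgenV.
have one e k j : [:: (ord0, e)] <>
    nseq k (ord0 : 'I_2, false) ++ (ord_max, j) :: nseq k (ord0, false).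
  move=> h; have := congr1 size h.
  rewrite size_cat /= !size_nseq /= => sz; have k0 : k = 0%N by lia.
  by move: h; rewrite k0.
case=> [e|[e i]] [e'|[e' i']] /(congr1 (@fword _)); rewrite ?step_wordE /= ?uw.
- by case=> ->.
- by move/one.
- by move/esym/one.
- move=> h; have := congr1 size h.
  rewrite !size_cat /= !size_nseq => sz.
  have ii : nat_of_ord i = i' by lia.
  move: h; rewrite ii => /eqP; rewrite eqseq_cat ?size_nseq// => /andP[_ /eqP[->]].
  by congr (inr (_, _)); exact: val_inj.
Qed.

Section Tau.
Variable R : realType.

Definition tau (g : F2) : R := 10^-1 * \sum_t (step t == g)%:R.

Lemma tau_step t : tau (step t) = 10^-1.
Proof.
rewrite /tau (bigD1 t)//= eqxx big1 ?addr0 ?mulr1// => t' tt'.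
by rewrite (inj_eq step_inj) (negbTE tt').
Qed.

Lemma tau_ge0 g : 0 <= tau g.
Proof. by rewrite mulr_ge0 ?invr_ge0// sumr_ge0. Qed.

Lemma esum_tau (f : F2 -> R) : (forall g, 0 <= f g) ->
  (\esum_(g in [set: F2]) ((tau g)%:E * (f g)%:E) =
   (10^-1 * \sum_t f (step t))%:E)%E.
Proof.
move=> f0.
pose a g t : \bar R := if g \in [set step t] then (10^-1 * f (step t))%:E else 0%E.
have a0 g t : (0 <= a g t)%E.
  by rewrite /a; case: ifP => // _; rewrite lee_fin mulr_ge0// invr_ge0.
rewrite (eq_esum (b := fun g => \sum_t a g t)%E); last first.
  move=> g _; rewrite -EFinM /tau -mulrA mulr_suml mulr_sumr -sumEFin.
  apply: eq_bigr => t _; rewrite /a; case: ifPn.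
    by rewrite inE => ->; rewrite eqxx mul1r.
  by rewrite notin_setE /= => /eqP; rewrite eq_sym => /negbTE ->; rewrite mul0r mulr0.
rewrite esum_sum//; rewrite mulr_sumr -sumEFin; apply: eq_bigr => t _.
rewrite -(esum_set1 (t := step t) (a := fun=> (10^-1 * f (step t))%:E)); last first.
  by rewrite lee_fin mulr_ge0// invr_ge0.
by rewrite [RHS]esum_mkcond.
Qed.

Lemma tau_mass_function : mass_function tau.
Proof.
split; first exact: tau_ge0.
rewrite (eq_esum (b := fun g => ((tau g)%:E * (1:R)%:E)%E)); last first.
  by move=> g _; rewrite mule1.
rewrite esum_tau// sumr_const card_step; congr (_%:E).
by rewrite mulVf.
Qed.

Lemma tau_support : mass_support tau = range step.
Proof.
apply/seteqP; split=> g /=.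
  rewrite /mass_support /= /tau mulf_eq0 negb_or => /andP[_ h].
  apply: contrapT => ng; move/eqP: h; apply; apply: big1 => t _.
  by case: eqP => // tg; exfalso; apply: ng; exists t.
by move=> [t _ <-]; rewrite /mass_support /= tau_step invr_neq0.
Qed.

Lemma tau_finite_support : finite_set (mass_support tau).
Proof. by rewrite tau_support; apply: finite_image; exact: finite_finset. Qed.

Lemma tau_spread_out : spread_out tau.
Proof.
have S t : semigroup_generated (mass_support tau) (step t).
  by apply: sg_gen; rewrite tau_support; exists t.
have L (l : letter 'I_2) : semigroup_generated (mass_support tau)
    (if l.2 then (fgen l.1)^-1 else fgen l.1)%g.
  have h e : step (inr (e, ord0)) = (if e then gh^-1 else gh)%g.
    by rewrite /step /= mul1g mulg1.
  case: l => i e /=; have [->|->] : i = ord0 \/ i = ord_max.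
    case: i => [[|[|//]] hi]; [left|right]; exact: val_inj.
  - exact: (S (inl e)).
  - by have := S (inr (e, ord0)); rewrite h.
apply/seteqP; split=> // g _; case: g; elim=> [|l w IH] r.
  have -> : FGroup r = (gu * gu^-1)%g by rewrite mulgV; exact: val_inj.
  exact: sg_mul (S (inl false)) (S (inl true)).
by rewrite fgroup_consE; apply: sg_mul => //; exact: L.
Qed.

Lemma tau_measured_group : measured_group tau.
Proof.
split; [|exact: tau_mass_function|exact: tau_spread_out].
apply/countable_injP; exists (fun g : F2 => pickle (fword g)) => g h _ _.
by move=> /(pcan_inj (@pickleK _)) /val_inj.
Qed.

Lemma stationary_nu : stationary tau gact (nu R).
Proof.
move=> A mA.
rewrite (eq_esum (b := fun g => ((tau g)%:E * (pr (nu R) (gact g @^-1` A))%:E)%E)).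
  rewrite esum_tau; last by move=> g; exact: pr_ge0.
  by rewrite step_stationary// mulrA mulVf// mul1r prE.
by move=> g _; rewrite /pushforward -prE//; exact: measurable_gact_pre.
Qed.

End Tau.

(** * Average contraction *)

Definition first_diff (k : nat) (x y : bits) : Prop :=
  agree k x y /\ ~ agree k.+1 x y.

Lemma first_diffP k x y : first_diff k x y <-> agree k x y /\ x k <> y k.
Proof. by rewrite /first_diff agreeS; split=> -[? ?]; split; tauto. Qed.

Lemma first_diff_unique k l x y : first_diff k x y -> first_diff l x y -> k = l.
Proof.
move=> [k1 k2] [l1 l2]; have [kl|kl|//] := ltngtP k l.
  by case: k2; exact: agree_le l1.
by case: l2; exact: agree_le k1.
Qed.

Lemma first_diff_ex m x y : ~ agree m x y -> exists2 k, (k < m)%N & first_diff k x y.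
Proof.
elim: m => // m IH h; have [a|a] := pselect (agree m x y); first by exists m.
by have [k km hk] := IH a; exists k => //; exact: ltnW.
Qed.

Section Contraction.
Variable R : realType.

(* With the plain ultrametric [(2/3) ^ k] the two level-1 cylinders would not be
   contracted on average: the value at [0] has to be lowered from [3/2]. *)
Definition gap_weight (k : nat) : R := if k is j.+1 then (2/3) ^+ j else 5/4.

Definition gap (x y : bits) : R :=
  if pselect (exists k, first_diff k x y) is left e
  then gap_weight (projT1 (cid e)) else 0.

Lemma gapE k x y : first_diff k x y -> gap x y = gap_weight k.
Proof.
move=> h; rewrite /gap; case: pselect => [e|]; last by case; exists k.
by rewrite (first_diff_unique h (projT2 (cid e))).
Qed.

Lemma gap_diag x : gap x x = 0.
Proof. by rewrite /gap; case: pselect => // e; have [k [_ []]] := e. Qed.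

Lemma gap_agree x y x' y' : (forall n, agree n x y <-> agree n x' y') ->
  gap x y = gap x' y'.
Proof.
move=> h; have [[k hk]|nk] := pselect (exists k, first_diff k x y).
  have hk' : first_diff k x' y'.
    by case: hk => a b; split; [exact/h|move=> /h].
  by rewrite (gapE hk) (gapE hk').
rewrite /gap; case: pselect => // _; case: pselect => // e.
by case: nk; case: e => k [a b]; exists k; split; [exact/h|move=> /h].
Qed.

Lemma gap_weight_gt0 k : 0 < gap_weight k.
Proof. by case: k => [|k] /=; [lra|apply: exprn_gt0; lra]. Qed.

Lemma gap_weight_le k : gap_weight k <= 5/4.
Proof.
case: k => [|k] //=; apply: (@le_trans _ _ 1); last by lra.
by apply: exprn_ile1; lra.
Qed.

Lemma gap_ge0 x y : 0 <= gap x y.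
Proof. by rewrite /gap; case: pselect => // e; exact: ltW (gap_weight_gt0 _). Qed.

Lemma gap_le x y : gap x y <= 5/4.
Proof. by rewrite /gap; case: pselect => [e|_]; [exact: gap_weight_le|lra]. Qed.

Lemma gap_nagree m x y : ~ agree m x y -> (2/3) ^+ m <= gap x y.
Proof.
move=> /first_diff_ex[k km /gapE ->].
apply: (@le_trans _ _ ((2/3) ^+ k)); first by apply: ler_wiXn2l; [lra|lra|exact: ltnW].
case: k {km} => [|k] /=; first by rewrite expr0; lra.
rewrite exprS; apply: ler_piMl; last by lra.
by apply: exprn_ge0; lra.
Qed.

Definition stretch_ratio (a b : bool) : R := if a then (if b then 3/2 else 1) else 2/3.

(** The gap between the images of two points of different quarters: the replaced prefixes already
    differ within three bits, so no further bits enter. *)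
Definition stretch_table (a b c e : bool) : R :=
  if a == c then (if a then 5/4 else 2/3)
  else if (if a then b else e) then 5/4 else 1.

Lemma gap_stretch x y : gap (stretch x) (stretch y) =
  if (x 0 == y 0) && (x 1%N == y 1%N) then stretch_ratio (x 0) (x 1%N) * gap x y
  else stretch_table (x 0) (x 1%N) (y 0) (y 1%N).
Proof.
case: ifPn => [/andP[/eqP e0 /eqP e1]|].
  have [->|xy] := pselect (x = y); first by rewrite !gap_diag mulr0.
  have [k hk] : exists k, first_diff k x y.
    apply: contrapT => nk; apply: xy; apply: agree_all => n.
    by apply: contrapT => /first_diff_ex[k _ hk]; apply: nk; exists k.
  have k2 : (2 <= k)%N.
    have [_ ne] := (first_diffP k x y).1 hk.
    by case: k hk ne => [|[|k]].
  rewrite (gapE hk); case: k k2 hk => [//|[//|k]] _ /first_diffP[hk ne].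
  rewrite /stretch -e0 -e1 /stretch_ratio.
  case: (x 0); last first.
    rewrite (@gapE k.+3) /=; first by rewrite exprS; field.
    by apply/first_diffP; split=> // -[|i] //= ik; exact: hk.
  case: (x 1%N) => /=.
    rewrite (@gapE k.+1) /=; first by rewrite exprS; field.
    by apply/first_diffP; split=> // i ik; exact: hk.
  rewrite (@gapE k.+2) /=; first by rewrite mul1r.
  by apply/first_diffP; split=> // -[|[|i]] //= ik; exact: hk.
have gE k z z' : first_diff k z z' -> gap z z' = gap_weight k by exact: gapE.
rewrite /stretch /stretch_table.
have d0 z z' : z 0 <> z' 0 -> gap z z' = 5/4 by move=> h; rewrite (@gapE 0) //; apply/first_diffP.
have d1 z z' : z 0 = z' 0 -> z 1%N <> z' 1%N -> gap z z' = 1.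
  move=> h h'; rewrite (@gapE 1) //=; apply/first_diffP; split=> // -[|i]//.
have d2 z z' : z 0 = z' 0 -> z 1%N = z' 1%N -> z 2%N <> z' 2%N -> gap z z' = 2/3.
  move=> h h' h''; rewrite (@gapE 2) /= ?expr1//; apply/first_diffP; split=> // -[|[|i]]//.
case x0: (x 0); case x1: (x 1%N); case y0: (y 0); case y1: (y 1%N) => //= _;
  by [apply: d0; rewrite /= ?x0 ?x1 ?y0 ?y1|apply: d1; rewrite /= ?x0 ?x1 ?y0 ?y1
     |apply: d2; rewrite /= ?x0 ?x1 ?y0 ?y1].
Qed.

Definition stretchV_ratio (a b : bool) : R := if a then 2/3 else (if b then 1 else 3/2).

Definition stretchV_table (a b c e : bool) : R :=
  if a == c then (if a then 2/3 else 5/4)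
  else if (if a then e else b) then 1 else 5/4.

Lemma gap_stretchV x y : gap (stretchV x) (stretchV y) =
  if (x 0 == y 0) && (x 1%N == y 1%N) then stretchV_ratio (x 0) (x 1%N) * gap x y
  else stretchV_table (x 0) (x 1%N) (y 0) (y 1%N).
Proof.
case: ifPn => [/andP[/eqP e0 /eqP e1]|].
  have [->|xy] := pselect (x = y); first by rewrite !gap_diag mulr0.
  have [k hk] : exists k, first_diff k x y.
    apply: contrapT => nk; apply: xy; apply: agree_all => n.
    by apply: contrapT => /first_diff_ex[k _ hk]; apply: nk; exists k.
  have k2 : (2 <= k)%N.
    have [_ ne] := (first_diffP k x y).1 hk.
    by case: k hk ne => [|[|k]].
  rewrite (gapE hk); case: k k2 hk => [//|[//|k]] _ /first_diffP[hk ne].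
  rewrite /stretchV -e0 -e1 /stretchV_ratio.
  case: (x 0).
    rewrite (@gapE k.+3) /=; first by rewrite exprS; field.
    by apply/first_diffP; split=> // -[|i] //= ik; exact: hk.
  case: (x 1%N) => /=; last first.
    rewrite (@gapE k.+1) /=; first by rewrite exprS; field.
    by apply/first_diffP; split=> // i ik; exact: hk.
  rewrite (@gapE k.+2) /=; first by rewrite mul1r.
  by apply/first_diffP; split=> // -[|[|i]] //= ik; exact: hk.
rewrite /stretchV /stretchV_table.
have d0 z z' : z 0 <> z' 0 -> gap z z' = 5/4 by move=> h; rewrite (@gapE 0) //; apply/first_diffP.
have d1 z z' : z 0 = z' 0 -> z 1%N <> z' 1%N -> gap z z' = 1.
  move=> h h'; rewrite (@gapE 1) //=; apply/first_diffP; split=> // -[|i]//.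
have d2 z z' : z 0 = z' 0 -> z 1%N = z' 1%N -> z 2%N <> z' 2%N -> gap z z' = 2/3.
  move=> h h' h''; rewrite (@gapE 2) /= ?expr1//; apply/first_diffP; split=> // -[|[|i]]//.
case x0: (x 0); case x1: (x 1%N); case y0: (y 0); case y1: (y 1%N) => //= _;
  by [apply: d0; rewrite /= ?x0 ?x1 ?y0 ?y1|apply: d1; rewrite /= ?x0 ?x1 ?y0 ?y1
     |apply: d2; rewrite /= ?x0 ?x1 ?y0 ?y1].
Qed.

Lemma gap_odo x y : gap (odo x) (odo y) = gap x y.
Proof. by apply: gap_agree => n; exact: agree_odo. Qed.

Lemma gap_odoV x y : gap (odoV x) (odoV y) = gap x y.
Proof. by apply: gap_agree => n; exact: agree_odoV. Qed.

Lemma gap_hyp x y : gap (hyp x) (hyp y) =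
  if (x 0 == y 0) && (x 1%N == y 1%N) then stretch_ratio (x 0) (x 1%N) * gap x y
  else stretch_table (x 0) (x 1%N) (y 0) (y 1%N).
Proof.
rewrite /hyp gap_stretch !scat_small//; congr (if _ then _ * _ else _).
by apply: gap_agree => n; exact: agree_scat.
Qed.

Lemma gap_hypV x y : gap (hypV x) (hypV y) =
  if (x 0 == y 0) && (x 1%N == y 1%N) then stretchV_ratio (x 0) (x 1%N) * gap x y
  else stretchV_table (x 0) (x 1%N) (y 0) (y 1%N).
Proof.
rewrite -gap_stretchV; apply: gap_agree => n; exact: agree_scatV.
Qed.

Lemma gap_iter k x y : gap (iter k odo x) (iter k odo y) = gap x y.
Proof. by elim: k => //= k IH; rewrite gap_odo. Qed.

(** The exact average for two points of one quarter: [(2 + 2 * (3/2 + 1 + 2/3 + 2/3)) / 10], the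
    first 2 coming from [u] and [u^-1]. *)
Definition rate : R := 29/30.

(** Once the outer isometries are dropped, every term depends only on the first two bits of [x] and
    [y] and on [gap x y], which leaves sixteen linear inequalities. *)
Lemma gap_contraction x y :
  10^-1 * \sum_(t : step_index) gap (gact (step t) x) (gact (step t) y) <=
  rate * gap x y.
Proof.
rewrite big_sumType /= big_bool /= gact_u gact_uV gap_odo gap_odoV.
pose F (e : bool) (i : 'I_4) := if e
  then gap (hypV (iter i odo x)) (hypV (iter i odo y))
  else gap (hyp (iter i odo x)) (hyp (iter i odo y)).
rewrite [X in _ + X](_ : _ = \sum_p F p.1 p.2); last first.
  apply: eq_bigr => -[e i] _ /=; rewrite /F !gactM !gact_uX gap_iter.
  by case: e; rewrite ?gact_h ?gact_hV.
rewrite -(pair_bigA _ F) /= big_bool /F /= !big_ord_recl !big_ord0 /=.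
rewrite !gap_hyp !gap_hypV !gap_odo.
have g0 : x 0 <> y 0 -> gap x y = 5/4 by move=> h; rewrite (@gapE 0) //; apply/first_diffP.
have g1 : x 0 = y 0 -> x 1%N <> y 1%N -> gap x y = 1.
  move=> h h'; rewrite (@gapE 1) //=; apply/first_diffP; split=> // -[|i]//.
have gx := gap_ge0 x y.
have o0 z : odo z 0 = ~~ z 0 by rewrite /odo /tri /carry /= addbT.
have o1 z : odo z 1%N = z 1%N (+) z 0 by rewrite /odo /tri /carry /= andbT.
rewrite !o1 !o0 /rate /stretch_ratio /stretch_table /stretchV_ratio /stretchV_table.
case: (x 0) g0 g1; case: (y 0); case: (x 1%N); case: (y 1%N) => /= g0 g1;
  first [rewrite g0//; lra | rewrite g1//; lra | lra].
Qed.

End Contraction.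

(** * Convergence of the walk *)


Local Notation steps := (@seqs step_index (inl false)).

Definition gprod (s : seq step_index) : F2 := foldr (fun t g => step t * g)%g 1%g s.

Definition prefix_walk (n : nat) (w : steps) : F2 := gprod (mkseq w n).

Lemma mkseq_scons n t (w : steps) :
  mkseq ((@scons _ (inl false) t w)) n.+1 = t :: mkseq w n.
Proof.
apply: (@eq_from_nth _ (inl false)); first by rewrite size_mkseq /= size_mkseq.
rewrite size_mkseq => -[|i] ni; first by rewrite nth_mkseq.
by rewrite nth_mkseq//= nth_mkseq.
Qed.

Lemma prefix_walk_scons n t (w : steps) :
  prefix_walk n.+1 ((@scons _ (inl false) t w)) = (step t * prefix_walk n w)%g.
Proof. by rewrite /prefix_walk mkseq_scons. Qed.

Lemma prefix_walk_agree n (w w' : steps) : agree n w w' ->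
  prefix_walk n w = prefix_walk n w'.
Proof. by move=> /agree_mkseq; rewrite /prefix_walk => ->. Qed.

Lemma gact_gprod_cons t s x : gact (gprod (t :: s)) x = gact (step t) (gact (gprod s) x).
Proof. exact: gactM. Qed.

Section Walk.
Variable R : realType.

Local Notation coin := (@coin step_index (inl false) R).
Local Notation nu := (nu R).

(** Expectation over [n] independent uniform steps as an iterated finite average, suited to
    induction; [coin_prefix] connects it with [coin]. *)
Fixpoint expect (n : nat) (F : seq step_index -> R) : R :=
  if n is m.+1 then 10^-1 * \sum_t expect m (fun s => F (t :: s)) else F [::].

Lemma expect_le n F F' : (forall s, size s = n -> F s <= F' s) ->
  expect n F <= expect n F'.
Proof.
elim: n F F' => [|n IH] F F' h /=; first exact: h.
rewrite ler_pM2l//; apply: ler_sum => t _; apply: IH => s sn.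
by apply: h; rewrite /= sn.
Qed.

Lemma eq_expect n F F' : (forall s, size s = n -> F s = F' s) ->
  expect n F = expect n F'.
Proof.
by move=> h; apply/le_anti; rewrite !expect_le// => s /h ->.
Qed.

Lemma expectZ n c F : expect n (fun s => c * F s) = c * expect n F.
Proof.
elim: n F => //= n IH F; rewrite [RHS]mulrCA [X in _ = _ * X]mulr_sumr; congr (_ * _).
by apply: eq_bigr => t _; exact: IH.
Qed.

Lemma expectD n F F' : expect n (fun s => F s + F' s) = expect n F + expect n F'.
Proof.
elim: n F F' => //= n IH F F'; rewrite -mulrDr -big_split; congr (_ * _).
by apply: eq_bigr => t _; exact: IH.
Qed.

Lemma expect_const n c : expect n (fun=> c) = c.
Proof.
elim: n => //= n ->; rewrite sumr_const card_step -[c *+ 10]mulr_natl mulrA.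
by rewrite mulVf ?mul1r.
Qed.

Lemma expect_sum n (F : step_index -> seq step_index -> R) :
  expect n (fun s => \sum_t F t s) = \sum_t expect n (F t).
Proof.
elim: n F => //= n IH F; rewrite -mulr_sumr exchange_big /=; congr (_ * _).
by apply: eq_bigr => t _; exact: IH.
Qed.

Lemma coin_prefix n (P : pred (seq step_index)) :
  pr coin [set w | P (mkseq w n)] = expect n (fun s => (P s)%:R).
Proof.
elim: n P => [|n IH] P /=.
  case: (P [::]); last by rewrite (_ : [set _ | _] = set0) ?pr0//; apply/seteqP; split.
  by rewrite (_ : [set _ | _] = setT) ?prT//; apply/seteqP; split.
rewrite coin_self_similar; last first.
  apply: (measurable_dep_set (n := n.+1)) => w w' /agree_mkseq.
  by rewrite /= => ->.
rewrite card_step; congr (_ * _); apply: eq_bigr => t _; rewrite -IH.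
by congr (pr coin _); apply/funext => w /=; rewrite -mkseq_scons.
Qed.

Lemma coin_prefix_markov n (F : seq step_index -> R) (e : R) : 0 < e ->
  (forall s, 0 <= F s) ->
  pr coin [set w : steps | e <= F (mkseq w n)] <= expect n F / e.
Proof.
move=> e0 F0; rewrite (coin_prefix n (fun s => e <= F s)) ler_pdivlMr// mulrC -expectZ.
by apply: expect_le => s _; case: (leP e (F s)) => h; rewrite ?mulr1 ?mulr0.
Qed.

Lemma rate_ge0 : 0 <= rate R. Proof. by rewrite /rate; lra. Qed.

(** The first step acts last. With the other steps fixed, averaging over it is [gap_contraction]. *)
Lemma expect_contraction n (P Q : seq step_index -> bits) :
  expect n.+1 (fun s => if s is t :: s' then
      gap R (gact (step t) (P s')) (gact (step t) (Q s')) else 0) <=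
  rate R * expect n (fun s => gap R (P s) (Q s)).
Proof.
rewrite /= -expect_sum -!expectZ; apply: expect_le => s _.
exact: gap_contraction.
Qed.

Lemma expect_gap n x y :
  expect n (fun s => gap R (gact (gprod s) x) (gact (gprod s) y)) <=
  5/4 * rate R ^+ n.
Proof.
elim: n => [|n IH]; first by rewrite /= expr0 mulr1 gap_le.
rewrite exprS mulrCA.
apply: le_trans (ler_wpM2l rate_ge0 IH); apply: le_trans (expect_contraction _ _ _).
apply: expect_le => -[|t s] // _; by rewrite !gact_gprod_cons.
Qed.

(** The walk at times [n] and [n + 1] shares its [n] outer factors, and these contract the pair
    formed by [x] and its image under the last step. *)
Lemma expect_gap_step n x :
  expect n.+1 (fun s => gap R (gact (gprod (take n s)) x) (gact (gprod s) x)) <=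
  5/4 * rate R ^+ n.
Proof.
elim: n => [|n IH].
  rewrite expr0 mulr1 -[leRHS](expect_const 1).
  by apply: expect_le => s _; exact: gap_le.
rewrite exprS mulrCA.
apply: le_trans (ler_wpM2l rate_ge0 IH).
apply: le_trans (expect_contraction _ _ _).
apply: expect_le => -[|t s] // _; rewrite take_cons !gact_gprod_cons; exact: lexx.
Qed.

Definition x0 : bits := fun=> false.

Definition unsettled (m n : nat) : set steps :=
  [set w | ~ agree m (gact (prefix_walk n w) x0) (gact (prefix_walk n.+1 w) x0)].

Lemma measurable_unsettled m n : measurable (unsettled m n).
Proof.
apply: (measurable_dep_set (n := n.+1)) => w w' ww'; rewrite /unsettled /=.
by rewrite (prefix_walk_agree ww') (prefix_walk_agree (agree_le (leqnSn n) ww')).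
Qed.

Lemma take_mkseq T (f : nat -> T) n : take n (mkseq f n.+1) = mkseq f n.
Proof. by rewrite /mkseq -map_take take_iota (minn_idPl (leqnSn n)). Qed.

Lemma pr_unsettled m n :
  pr coin (unsettled m n) <= 5/4 / (2/3) ^+ m * rate R ^+ n.
Proof.
pose F s := gap R (gact (gprod (take n s)) x0) (gact (gprod s) x0).
have e0 : 0 < (2/3) ^+ m :> R by apply: exprn_gt0; lra.
have mF : measurable [set w : steps | (2/3) ^+ m <= F (mkseq w n.+1)].
  apply: (measurable_dep_set (n := n.+1)) => w w' /agree_mkseq.
  by rewrite /= => ->.
apply: (@le_trans _ _ (pr coin [set w : steps | (2/3) ^+ m <= F (mkseq w n.+1)])).
  apply: le_pr => //; first exact: measurable_unsettled.
  move=> w /= /(gap_nagree R); rewrite /F take_mkseq; exact.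
apply: (le_trans (@coin_prefix_markov n.+1 F _ e0 _)) => [s|]; first exact: gap_ge0.
rewrite -[leRHS]mulrA [X in _ <= _ * X]mulrC mulrA ler_pM2r ?invr_gt0//.
exact: expect_gap_step.
Qed.

Definition unsettled_io : set steps := \bigcup_m lim_sup_set (unsettled m).

Lemma measurable_unsettled_io : measurable unsettled_io.
Proof.
apply: bigcupT_measurable => m; apply: bigcap_measurable => // n _.
by apply: bigcup_measurable => k _; exact: measurable_unsettled.
Qed.

Lemma pr_unsettled_io : pr coin unsettled_io = 0.
Proof.
apply: pr_bigcup0 => m.
  apply: bigcap_measurable => // n _.
  by apply: bigcup_measurable => k _; exact: measurable_unsettled.
apply: (geometric_borel_cantelli (K := 5/4 / (2/3) ^+ m) (c := rate R)).
- by move=> n; exact: measurable_unsettled.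
- by apply: divr_ge0; [lra|apply: exprn_ge0; lra].
- by rewrite /rate; lra.
- exact: pr_unsettled.
Qed.

(** The limit of the walk read bit by bit. A bit that never settles gets the default [false], which
    keeps the map total and measurable; this can happen only inside [unsettled_io]. *)
Definition limit_point (w : steps) : bits := fun k =>
  `[< exists N, forall n, (N <= n)%N -> gact (prefix_walk n w) x0 k >].

Lemma limit_pointP w m : ~ unsettled_io w ->
  exists N, forall n, (N <= n)%N -> agree m (gact (prefix_walk n w) x0) (limit_point w).
Proof.
move=> nw.
have stab j : exists N, forall n, (N <= n)%N ->
    agree j (gact (prefix_walk n w) x0) (gact (prefix_walk N w) x0).
  apply: contrapT => /forallNP h; apply: nw; exists j => // N _.
  apply: contrapT => hN; apply: (h N) => n Nn.
  rewrite -(subnKC Nn); elim: (n - N)%N => [|i IH]; first by rewrite addn0.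
  apply: agree_trans IH; rewrite addnS.
  apply: agree_sym; apply: contrapT => na; apply: hN; exists (N + i)%N => //=.
  exact: leq_addr.
have [N hN] := stab m; exists N => n Nn i im.
have [v|v] := boolP (gact (prefix_walk n w) x0 i).
  apply/esym/asboolP; exists n => k nk.
  by rewrite (hN k (leq_trans Nn nk))// -(hN n Nn).
apply/esym/asboolPn => -[N' hN'].
have := hN' (maxn N' n) (leq_maxl _ _).
rewrite (hN _ (leq_trans Nn (leq_maxr _ _)))// -(hN n Nn)//.
exact/negP.
Qed.

Lemma measurable_limit_point : measurable_fun setT limit_point.
Proof.
have mk k : measurable [set w | limit_point w k].
  rewrite (_ : [set _ | _] = \bigcup_N \bigcap_(n in [set n | (N <= n)%N])
      [set w : steps | gact (prefix_walk n w) x0 k]).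
    apply: bigcupT_measurable => N; apply: bigcap_measurable => [|n _].
      by exists N => /=.
    apply: (measurable_dep_set (n := n)) => w w' /prefix_walk_agree /= ->//.
  apply/seteqP; split=> w /=.
    by move=> /asboolP[N hN]; exists N => // n /hN.
  by move=> [N _ hN]; apply/asboolP; exists N => n /hN.
apply: measurable_seqs => n x.
have mki k : measurable [set w | x k = limit_point w k].
  case: (x k).
    rewrite (_ : [set _ | _] = [set w | limit_point w k])//.
    by apply/seteqP; split=> w /=; [move=> <-|move=> ->].
  rewrite (_ : [set _ | _] = ~` [set w | limit_point w k]); first exact: measurableC.
  by apply/seteqP; split=> w /=; [move=> <-|case: limit_point].
elim: n => [|n IH]; first by rewrite cyl0 preimage_setT; exact: measurableT.
rewrite (_ : _ @^-1` _ = limit_point @^-1` cyl n x `&` [set w | x n = limit_point w n]).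
  exact: measurableI.
by apply/seteqP; split=> w; rewrite /cyl /= agreeS.
Qed.

Lemma integral_expect n (A : seq step_index -> set bits) :
  (forall s, measurable (A s)) ->
  measurable_fun setT (fun x => expect n (fun s => \1_(A s) x)) /\
  (\int[nu]_x (expect n (fun s => \1_(A s) x))%:E =
   (expect n (fun s => pr nu (A s)))%:E)%E.
Proof.
elim: n A => [|n IH] A mA /=.
  split; first exact: measurable_indic.
  by rewrite integral_indic// setIT; exact: prE.
have mt t : measurable_fun setT (fun x => expect n (fun s => \1_(A (t :: s)) x)).
  by have [] := IH (fun s => A (t :: s)) (fun s => mA (t :: s)).
have msum : measurable_fun setT
    (fun x => \sum_t expect n (fun s => \1_(A (t :: s)) x)).
  exact: measurable_sum.
split; first exact: measurable_funM.
under eq_integral do rewrite EFinM.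
rewrite ge0_integralZl//; last 2 first.
- exact/measurable_EFinP.
- move=> x _; rewrite lee_fin; apply: sumr_ge0 => t _.
  rewrite -[leLHS](expect_const n); apply: expect_le => s _; by rewrite indicE.
rewrite EFinM; congr (_ * _)%E.
under eq_integral do rewrite -sumEFin.
rewrite ge0_integral_sum//; last 2 first.
- by move=> t; exact/measurable_EFinP.
- move=> t x _; rewrite lee_fin.
  rewrite -[leLHS](expect_const n); apply: expect_le => s _; by rewrite indicE.
rewrite -sumEFin; apply: eq_bigr => t _.
by have [_] := IH (fun s => A (t :: s)) (fun s => mA (t :: s)).
Qed.

Lemma expect_pr_le n (A : seq step_index -> set bits) (K : R) :
  (forall s, measurable (A s)) ->
  (forall x, expect n (fun s => \1_(A s) x) <= K) ->
  expect n (fun s => pr nu (A s)) <= K.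
Proof.
move=> mA hK; have [mf eI] := integral_expect n mA.
rewrite -lee_fin -eI.
apply: (@le_trans _ _ (\int[nu]_x (cst K%:E x))%E).
  apply: ge0_le_integral => //.
  - move=> x _; rewrite lee_fin.
    rewrite -[leLHS](expect_const n); apply: expect_le => s _; by rewrite indicE.
  - exact/measurable_EFinP.
  - by move=> x _; rewrite lee_fin.
rewrite integral_cst//; apply: (@le_trans _ _ (K%:E * nu setT)%E) => //.
by rewrite probability_setT mule1.
Qed.

Lemma expect_stationary n E : measurable E ->
  expect n (fun s => pr nu (gact (gprod s) @^-1` E)) = pr nu E.
Proof.
elim: n E => [//|n IH] E mE /=.
transitivity (10^-1 * \sum_t pr nu (gact (step t) @^-1` E)); last first.
  by rewrite step_stationary// mulrA mulVf// mul1r.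
congr (_ * _); apply: eq_bigr => t _; rewrite -IH; last exact: measurable_gact_pre.
by apply: eq_expect => s _; congr (pr nu _); apply/funext => x /=; rewrite gact_gprod_cons.
Qed.

Lemma expect_nagree n m x :
  expect n (fun s => `[< ~ agree m (gact (gprod s) x) (gact (gprod s) x0) >]%:R) <=
  5/4 / (2/3) ^+ m * rate R ^+ n.
Proof.
have e0 : 0 < (2/3) ^+ m :> R by apply: exprn_gt0; lra.
rewrite -[leRHS]mulrA [X in _ <= _ * X]mulrC mulrA ler_pdivlMr// mulrC -expectZ.
apply: le_trans (expect_gap n x x0); apply: expect_le => s _.
case: asboolP => [h|_]; first by rewrite mulr1; exact: gap_nagree.
by rewrite mulr0 gap_ge0.
Qed.

(** By stationarity [nu] is the average of its translates after [n] steps, that is, the law of the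
    walk started at a [nu]-random point. Starting at [x0] instead changes the first [m] bits with
    exponentially small probability. *)
Lemma pr_walk_cyl n m y :
  `|pr nu (cyl m y) - pr coin [set w : steps | cyl m y (gact (prefix_walk n w) x0)]| <=
  5/4 / (2/3) ^+ m * rate R ^+ n.
Proof.
have mC := measurable_cyl m y.
have mpre s : measurable (gact (gprod s) @^-1` cyl m y) by exact: measurable_gact_pre.
rewrite (_ : [set _ | _] =
    [set w : steps | (fun s => `[< cyl m y (gact (gprod s) x0) >]) (mkseq w n)]); last first.
  by apply/seteqP; split=> w /= /asboolP.
rewrite (coin_prefix n (fun s => `[< cyl m y (gact (gprod s) x0) >])).
rewrite -(expect_stationary n mC).
set p := expect n (fun s => `[< _ >]%:R); set K := 5/4 / _ * _.
(* The bit [b] treats the cylinder and its complement at once; the two cases give the upper and the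
   lower bound. *)
have key (b : bool) x : expect n (fun s => (b (+) `[< cyl m y (gact (gprod s) x) >])%:R) <=
    expect n (fun s => (b (+) `[< cyl m y (gact (gprod s) x0) >])%:R) + K.
  apply: le_trans (lerD (lexx _) (expect_nagree n m x)).
  rewrite -expectD; apply: expect_le => s _.
  have [a|na] := pselect (agree m (gact (gprod s) x) (gact (gprod s) x0)).
    rewrite (asboolF (_ : ~ ~ _))// addr0.
    rewrite (_ : `[< cyl m y (gact (gprod s) x) >] = `[< cyl m y (gact (gprod s) x0) >])//.
    apply: asbool_equiv_eq; split=> h; first exact: agree_trans a.
    exact: agree_trans (agree_sym a).
  by rewrite (asboolT na) /=; case: (_ (+) _); case: (_ (+) _) => /=; lra.
rewrite ler_norml; apply/andP; split; last first.
  rewrite lerBlDl; apply: expect_pr_le => // x.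
  apply: (le_trans _ (key false x)); apply: expect_le => s _.
  by rewrite indicE /=; case: asboolP => h; [rewrite mem_set|rewrite memNset].
have : expect n (fun s => pr nu (~` (gact (gprod s) @^-1` cyl m y))) <= 1 - p + K.
  apply: expect_pr_le => [s|x]; first exact: measurableC.
  apply: (@le_trans _ _ (expect n (fun s => (true (+) `[< cyl m y (gact (gprod s) x) >])%:R))).
    apply: expect_le => s _; rewrite indicE /=.
    by case: asboolP => h; [rewrite memNset|rewrite mem_set].
  apply: le_trans (key true x) _; rewrite lerD2r.
  have -> : 1 - p = expect n (fun s => 1 + (-1) * `[< cyl m y (gact (gprod s) x0) >]%:R).
    by rewrite expectD expect_const expectZ mulN1r.
  by apply: expect_le => s _; case: asboolP => /= _; lra.
rewrite (eq_expect (F' := fun s => 1 + (-1) * pr nu (gact (gprod s) @^-1` cyl m y))).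
  by rewrite expectD expect_const expectZ; lra.
by move=> s _; rewrite pr_setC//; lra.
Qed.

End Walk.

(** * The boundary map *)


Section BoundaryMap.
Variable R : realType.

Local Notation coin := (@coin step_index (inl false) R).
Local Notation nu := (nu R).

Lemma settled_agree m n w : ~ unsettled_io w ->
  (forall k, (n <= k)%N -> ~ unsettled m k w) ->
  agree m (gact (prefix_walk n w) x0) (limit_point w).
Proof.
move=> /(limit_pointP m)[N hN] hn.
apply: agree_trans (hN (n + N)%N (leq_addl _ _)).
elim: (N) => [|k IH]; first by rewrite addn0.
apply: agree_trans IH _; rewrite addnS; apply: contrapT.
exact: hn (leq_addr _ _).
Qed.

Lemma pr_unsettled_tail m (e : R) : 0 < e ->
  exists N, forall n, (N <= n)%N ->
    pr coin (\bigcup_(k in [set k | (n <= k)%N]) unsettled m k) < e.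
Proof.
move=> e0; pose U n := \bigcup_(k in [set k | (n <= k)%N]) unsettled m k.
have mU n : measurable (U n) by apply: bigcup_measurable => k _; exact: measurable_unsettled.
have : coin (U n) @[n --> \oo] --> coin (\bigcap_n U n).
  apply: nonincreasing_cvg_mu => //.
  - apply: le_lt_trans (ltry 1); exact: probability_le1.
  - exact: bigcapT_measurable.
  - apply/nonincreasing_seqP => n; rewrite subsetEset => w [k /= nk h].
    by exists k => //=; exact: ltnW.
have -> : coin (\bigcap_n U n) = 0%:E.
  rewrite prE; last exact: bigcapT_measurable.
  congr (_%:E); apply: (pr_eq0_sub _ _ _ (pr_unsettled_io R)).
  - exact: bigcapT_measurable.
  - exact: measurable_unsettled_io.
  - by move=> w h; exists m.
move=> /fine_cvgP[_] /cvgrPdist_lt/(_ e e0)[N _ hN]; exists N => n Nn.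
have := hN n Nn; rewrite /= sub0r normrN -/(pr coin (U n)).
by rewrite ger0_norm// pr_ge0.
Qed.

(** On a cylinder of length [m], the law of the walk at a late time is close to [nu] by
    [pr_walk_cyl], and the walk already shows the first [m] bits of its limit except on an event of
    small probability. *)
Lemma pr_limit_point E : measurable E -> pr coin (limit_point @^-1` E) = pr nu E.
Proof.
have mpre F : measurable F -> measurable (limit_point @^-1` F).
  by move=> mF; rewrite -[X in measurable X]setTI; exact: measurable_limit_point.
move: E; apply: (@nu_unique _ _ 0).
  have := real_measure_pre coin measurable_limit_point measurableT.
  by under [in X in X -> _]eq_fun do rewrite setTI.
move=> m y _; rewrite -(nu_cyl R m y).
apply/eqP; rewrite -subr_eq0 -normr_eq0 eq_le normr_ge0 andbT.
apply/ler_addgt0Pr => e e0; rewrite add0r; have e20 : 0 < e / 2 by lra.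
have [N hN] := pr_unsettled_tail m e20.
have /cvgrPdist_lt/(_ _ e20)[N' _ hN'] :
    geometric (5/4 / (2/3) ^+ m) (rate R) n @[n --> \oo] --> 0.
  by apply: cvg_geometric; rewrite ger0_norm /rate; lra.
pose n := maxn N N'.
have := hN n (leq_maxl _ _); set U := \bigcup_(k in _) _ => pU.
have mU : measurable U by apply: bigcup_measurable => k _; exact: measurable_unsettled.
have := pr_walk_cyl R n m y.
have := hN' n (leq_maxr _ _); rewrite /= sub0r normrN => /(le_lt_trans (ler_norm _)).
set W := [set w : steps | _].
have mC := measurable_cyl m y.
have mW : measurable W.
  apply: (measurable_dep_set (n := n)) => w w' /prefix_walk_agree h.
  by rewrite /W /= h.
have mL := mpre _ mC.
have mI := measurable_unsettled_io.
have cmp : forall A B : set steps, measurable A -> measurable B ->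
    (forall w, ~ unsettled_io w -> ~ U w -> A w -> B w) ->
    pr coin A <= pr coin B + pr coin U.
  move=> A B mA mB h.
  have := pr_setU_le coin mB mU.
  have -> : pr coin A = pr coin (A `&` ~` unsettled_io).
    by rewrite pr_setIC0// pr_unsettled_io.
  apply: le_trans; apply: le_pr.
  - by apply: measurableI => //; exact: measurableC.
  - exact: measurableU.
  - by move=> w [Aw nw]; have [Uw|Uw] := pselect (U w); [right|left; exact: h].
have agr w : ~ unsettled_io w -> ~ U w -> agree m (gact (prefix_walk n w) x0) (limit_point w).
  move=> nw nU; apply: settled_agree => // k nk uk; apply: nU; exists k => //.
have h1 := cmp _ _ mL mW (fun w nw nU h => agree_trans h (agree_sym (agr w nw nU))).
have h2 := cmp _ _ mW mL (fun w nw nU h => agree_trans h (agr w nw nU)).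
move=> g /ler_normlP[g1 g2]; apply/ler_normlP; split; lra.
Qed.

Lemma limit_point_scons t w : ~ unsettled_io w ->
  ~ unsettled_io (@scons _ (inl false) t w) ->
  limit_point (@scons _ (inl false) t w) = gact (step t) (limit_point w).
Proof.
move=> nw nt; apply: agree_all => m.
have [N1 h1] := limit_pointP m nt.
have [N2 h2] := limit_pointP (m + size (fword (step t))) nw.
pose n := maxn N1 N2.
apply: agree_trans (agree_sym (h1 n.+1 _)) _; first by rewrite ltnW// ltnS leq_maxl.
rewrite prefix_walk_scons gactM; apply: wact_lip; apply: h2; exact: leq_maxr.
Qed.

(** Given the first [n] steps, the limit point is their product applied to the limit point of the
    shifted sequence, whose law is [nu]. Hence the densities of events about the limit point are the
    translates of [nu]. *)
Lemma pr_limit_point_cyl n w A : measurable A ->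
  pr coin (limit_point @^-1` A `&` cyl n w) =
  10 ^- n * pr nu (gact (prefix_walk n w) @^-1` A).
Proof.
have mpre F : measurable F -> measurable (limit_point @^-1` F).
  by move=> mF; rewrite -[X in measurable X]setTI; exact: measurable_limit_point.
elim: n w A => [|n IH] w A mA.
  by rewrite cyl0 setIT expr0 invr1 mul1r pr_limit_point.
rewrite coin_self_similar; last by apply: measurableI; [exact: mpre|exact: measurable_cyl].
rewrite card_step exprS invfM -mulrA; congr (_ * _).
have -> : prefix_walk n.+1 w = (step (w 0) * prefix_walk n (fun i => w i.+1))%g.
  rewrite -prefix_walk_scons; apply: prefix_walk_agree => i _; by case: i.
have mS (t : step_index) F : measurable F -> measurable (@scons _ (inl false) t @^-1` F).
  by move=> mF; rewrite -[X in measurable X]setTI; exact: measurable_scons.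
rewrite (bigD1 (w 0))//= big1 ?addr0; last first.
  move=> t tw; rewrite (_ : _ @^-1` _ = set0) ?pr0//.
  apply/seteqP; split=> // v [_ /= /(_ 0 isT) /= h].
  by rewrite h eqxx in tw.
have mA' : measurable (gact (step (w 0)) @^-1` A) by exact: measurable_gact_pre.
have := IH (fun i => w i.+1) _ mA'.
have -> : gact (prefix_walk n (fun i => w i.+1)) @^-1` (gact (step (w 0)) @^-1` A) =
    gact (step (w 0) * prefix_walk n (fun i => w i.+1))%g @^-1` A.
  by apply/funext => x /=; rewrite gactM.
move=> <-.
have mI := measurable_unsettled_io.
pose N := unsettled_io `|` @scons _ (inl false) (w 0) @^-1` unsettled_io.
have mN : measurable N by apply: measurableU => //; exact: mS.
apply: (pr_ae_eq (N := N)) => //.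
- by apply: mS; apply: measurableI; [exact: mpre|exact: measurable_cyl].
- by apply: measurableI; [exact: mpre|exact: measurable_cyl].
- apply/le_anti; rewrite pr_ge0 andbT.
  apply: (le_trans (pr_setU_le coin mI (mS (w 0) _ mI))).
  rewrite pr_unsettled_io add0r.
  (* Self-similarity writes 0 as a sum of nonnegative terms, so prefixing the null set by any one
     step keeps it null. *)
  have := pr_unsettled_io R; rewrite coin_self_similar// card_step => /eqP.
  rewrite mulf_eq0 invr_eq0 pnatr_eq0 /= psumr_eq0; last by move=> t _; exact: pr_ge0.
  by move=> /allP/(_ (w 0))/=; rewrite mem_index_enum => /(_ isT)/eqP ->.
- apply/seteqP; split=> v [[h1 h2] /not_orP[n1 n2]]; split=> //; try by apply/not_orP.
    split; first by rewrite /= -limit_point_scons.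
    by move=> i ni; rewrite /= (h2 i.+1).
  split; first by rewrite /= limit_point_scons.
  by move=> [|i] ni //=; exact: h2.
Qed.

Theorem walk_converges A : measurable A -> exists N : set steps,
  [/\ measurable N, pr coin N = 0 &
    forall w, ~ N w ->
      pr nu (gact (prefix_walk n w) @^-1` A) @[n --> \oo] --> (\1_A (limit_point w) : R)].
Proof.
move=> mA.
have mL : measurable (limit_point @^-1` A).
  by rewrite -[X in measurable X]setTI; exact: measurable_limit_point.
have [N [mN N0 hN]] := levy_zero_one R mL; exists N; split=> // w /hN.
have -> : density R (limit_point @^-1` A) ^~ w =
    fun n => pr nu (gact (prefix_walk n w) @^-1` A).
  apply/funext => n; rewrite /density card_step pr_limit_point_cyl//.
  by rewrite mulVKf// expf_neq0 ?pnatr_eq0.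
by rewrite !indicE.
Qed.

End BoundaryMap.

(** * The Cantor space is standard Borel *)

Section CantorMetric.
Variable R : realType.

Lemma gap_eq0 x y : gap R x y = 0 -> x = y.
Proof.
move=> g0; apply: agree_all => m; apply: contrapT => /(gap_nagree R).
by rewrite g0 leNgt exprn_gt0//; lra.
Qed.

Lemma gap_sym x y : gap R x y = gap R y x.
Proof.
have [[k hk]|nk] := pselect (exists k, first_diff k x y).
  rewrite (gapE R hk) (@gapE R k)//; apply/first_diffP.
  by move/first_diffP : hk => [a b]; split; [exact: agree_sym|exact: nesym].
suff -> : x = y by [].
apply: agree_all => m; apply: contrapT => /first_diff_ex[k _ hk].
by apply: nk; exists k.
Qed.

Lemma gap_weightS k : gap_weight R k.+1 <= gap_weight R k.
Proof.
case: k => [|k] /=; first by rewrite expr0; lra.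
rewrite exprS; apply: ler_piMl; last by lra.
by apply: exprn_ge0; lra.
Qed.

Lemma gap_weight_homo k l : (k <= l)%N -> gap_weight R l <= gap_weight R k.
Proof.
move=> /subnKC <-; elim: (l - k)%N => [|j IH]; first by rewrite addn0.
by rewrite addnS; apply: le_trans IH; exact: gap_weightS.
Qed.

Lemma gap_agree_le k x y : agree k x y -> gap R x y <= gap_weight R k.
Proof.
move=> xy; have [->|ne] := pselect (x = y).
  by rewrite gap_diag ltW// gap_weight_gt0.
have [l hl] : exists l, first_diff l x y.
  apply: contrapT => nl; apply: ne; apply: agree_all => m.
  by apply: contrapT => /first_diff_ex[l _ hl]; apply: nl; exists l.
rewrite (gapE R hl); apply: gap_weight_homo; rewrite leqNgt; apply/negP => lk.
by case: hl => _; apply; exact: agree_le xy.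
Qed.

Lemma gap_triangle y x z : gap R x z <= gap R x y + gap R y z.
Proof.
have [->|xz] := pselect (x = z); first by rewrite gap_diag addr_ge0// gap_ge0.
have [->|yz] := pselect (y = z); first by rewrite gap_diag addr0.
have fd a b : a <> b -> exists k, first_diff k a b.
  move=> ab; apply: contrapT => nl; apply: ab; apply: agree_all => m.
  by apply: contrapT => /first_diff_ex[l _ hl]; apply: nl; exists l.
have [k hk] := fd _ _ xz.
have [xy|nxy] := pselect (agree k.+1 x y).
  apply: (@le_trans _ _ (gap R y z)); last by rewrite lerDr gap_ge0.
  have [l hl] := fd _ _ yz; rewrite (gapE R hk) (gapE R hl).
  apply: gap_weight_homo; rewrite leqNgt; apply/negP => kl.
  case: hk => _; apply; apply: agree_trans xy _.
  by case: hl => + _; exact: agree_le.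
apply: (@le_trans _ _ (gap R x y)); last by rewrite lerDl gap_ge0.
have [l lk hl] := first_diff_ex nxy; rewrite (gapE R hk) (gapE R hl).
exact: gap_weight_homo.
Qed.

(* The field is a parameter only because the metric takes its values there. *)
Definition cantor_space_over (_ : realType) : Type := bits.
Local Notation cantor := (cantor_space_over R).
HB.instance Definition _ := Choice.copy cantor bits.
HB.instance Definition _ := isPointed.Build cantor (fun=> false).
HB.instance Definition _ := @isMetric.Build R cantor (gap R)
  (@gap_diag R) gap_eq0 gap_sym gap_triangle.

Lemma cantor_ball (x : cantor) (e : R) y : ball x e y <-> gap R x y < e.
Proof. by rewrite ballEmdist. Qed.

Lemma gap_weight_small (e : R) : 0 < e -> exists k, gap_weight R k < e.
Proof.
move=> e0; have c : (2/3 : R) ^+ n @[n --> \oo] --> 0.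
  by apply: cvg_expr; rewrite ger0_norm; lra.
have /cvgrPdist_lt/(_ e e0)[N _ hN] := c.
exists N.+1; have := hN N (leqnn N); rewrite /= sub0r normrN.
exact: le_lt_trans (ler_norm _).
Qed.

Lemma cantor_complete (F : set_system cantor) : ProperFilter F -> cauchy F -> cvg F.
Proof.
move=> FF /cauchy_ballP cF.
have /choice[x hx] (m : nat) : exists x : cantor, F [set z | agree m x z].
  have e0 : 0 < (2/3) ^+ m :> R by apply: exprn_gt0; lra.
  have [[A B] /= [FA FB] AB] := cF _ e0.
  have [x Ax] := filter_ex FA; exists x.
  apply: filterS FB => z Bz; apply: contrapT => /(gap_nagree R).
  by have /cantor_ball := AB (x, z) (conj Ax Bz); rewrite ltNge => /negP.
(* Bit [k] is read off an approximation valid to [k + 1] bits. *)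
pose y : cantor := fun k => x k.+1 k.
have hy m : F [set z | agree m y z].
  elim: m => [|m IH].
    by apply: filterS filterT => z _.
  apply: filterS2 IH (hx m.+1) => z yz xz; apply/agreeS; split=> //.
  exact: xz.
apply/cvg_ex; exists y; apply/fcvg_ballP => e /gap_weight_small[k ke].
apply: filterS (hy k) => z /gap_agree_le h; apply/cantor_ball.
exact: le_lt_trans ke.
Qed.

HB.instance Definition _ := Uniform_isComplete.Build cantor cantor_complete.

Lemma cyl_ball (x : cantor) (e : R) : 0 < e -> exists k, @cyl _ false k x `<=` ball x e.
Proof.
move=> /gap_weight_small[k ke]; exists k => y /gap_agree_le h; apply/cantor_ball.
exact: le_lt_trans ke.
Qed.

Lemma open_cyl n (x : cantor) : open (@cyl _ false n x : set cantor).
Proof.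
rewrite openE => y xy; apply/nbhs_ballP.
exists ((2/3) ^+ n) => /=; first by apply: exprn_gt0; lra.
move=> z /cantor_ball yz; apply: agree_trans xy _; apply: contrapT.
by move/(gap_nagree R); rewrite leNgt yz.
Qed.

Definition listed (s : seq bool) : bits := nth false s.

Lemma listed_mkseq n (x : bits) : agree n (listed (mkseq x n)) x.
Proof. by move=> i ni; rewrite /listed nth_mkseq. Qed.

(** [decode] reaches every finite word, so an open set is a countable union of cylinders; hence the
    Borel sets are those generated by cylinders. *)
Lemma open_bigcup_cyl (U : set cantor) : open U ->
  U = \bigcup_k (if `[< @cyl _ false (size (decode k)) (listed (decode k)) `<=` U >]
    then @cyl _ false (size (decode k)) (listed (decode k)) else set0).
Proof.
rewrite openE => oU; apply/seteqP; split=> x.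
  move=> /oU /nbhs_ballP[e /= e0 eU]; have [k kx] := cyl_ball x e0.
  have [j _ dj] := decode_inf (mkseq (x : bits) k) 0.
  exists j => //; rewrite dj size_mkseq.
  rewrite (cylP (@listed_mkseq k x)) asboolT//.
  exact: subset_trans eU.
by move=> [k _]; case: asboolP => // h /h.
Qed.

Lemma standard_borel_bits : standard_borel R bits.
Proof.
exists cantor, id; split.
- exact: metric_hausdorff.
- exists (range listed).
    apply/countable_injP.
    exists (fun x : cantor => if pselect (exists s, listed s = x) is left e
        then pickle (projT1 (cid e)) else 0%N) => x y.
    rewrite !inE => -[s _ sx] [s' _ sy].
    case: pselect => [ex|]; last by case; exists s.
    case: pselect => [ey|]; last by case; exists s'.
    move=> /(pcan_inj pickleK) e; transitivity (listed (projT1 (cid ex))).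
      exact/esym/(projT2 (cid ex)).
    by rewrite e; exact: (projT2 (cid ey)).
  move=> U [x Ux]; rewrite openE => /(_ x Ux)/nbhs_ballP[e /= e0 eU].
  have [k kx] := cyl_ball x e0; exists (listed (mkseq x k)); split.
    by apply: eU; apply: kx; exact: agree_sym (@listed_mkseq k x).
  by exists (mkseq x k).
- by exists id.
- move=> A; rewrite image_id; split.
    apply: smallest_sub; first exact: smallest_sigma_algebra.
    by move=> _ [n [x ->]]; apply: sub_sigma_algebra; exact: open_cyl.
  move: A; apply: smallest_sub; first exact: sigma_algebra_measurable.
  move=> U /open_bigcup_cyl ->; apply: bigcupT_measurable => k.
  by case: asboolP => // _; exact: measurable_cyl.
Qed.

Definition bits_space : gspace R (fgroup 'I_2) := GSpace gact (nu R).

Lemma stationary_space_bits : stationary_space (tau R) bits_space.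
Proof.
split; first exact: standard_borel_bits.
- exact: gact_action.
- exact: measurable_gact.
- exact: stationary_nu.
Qed.

End CantorMetric.

(** * Proximality *)

Lemma integral_concentrated d (T : measurableType d) (R : realType)
    (P : probability T R) (g : T -> R) (c e K : R) (B : set T) :
  measurable_fun setT g -> measurable B -> 0 <= e ->
  (forall x, `|g x| <= K) -> `|c| <= K -> (forall x, ~ B x -> `|g x - c| <= e) ->
  `|Rintegral P setT g - c| <= e + 2 * K * pr P B.
Proof.
move=> mg mB e0 gK cK hB.
have bint (f : T -> R) M : measurable_fun setT f -> (forall x, `|f x| <= M) ->
    P.-integrable setT (EFin \o f).
  move=> mf fM; apply: measurable_bounded_integrable => //.
    by apply: le_lt_trans (ltry 1); exact: probability_le1.
  exists M; split; first exact: num_real.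
  by move=> x Mx y _ /=; apply: le_trans (fM y) (ltW Mx).
have K0 : 0 <= K by exact: le_trans cK.
have ig : P.-integrable setT (EFin \o g) by exact: bint gK.
have ic r : P.-integrable setT (EFin \o (fun _ : T => r)).
  by apply: (bint _ `|r|).
have iB : P.-integrable setT (EFin \o (\1_B : T -> R)).
  by apply: (bint _ 1); [exact: measurable_indic|move=> x; rewrite indicE ger0_norm ?lern1 ?leq_b1].
have iKB : P.-integrable setT (EFin \o (fun x => 2 * K * \1_B x)).
  apply: (bint _ (2 * K)); first by apply: measurable_funM => //; exact: measurable_indic.
  move=> x; rewrite indicE; case: (x \in B); rewrite ?mulr1 ?mulr0 ger0_norm//; lra.
have icst r : Rintegral P setT (fun=> r) = r.
  rewrite Rintegral_cst//; transitivity (r * pr P setT) => //.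
  by rewrite prT mulr1.
have igc : P.-integrable setT (EFin \o (fun x => g x - c)).
  apply: (bint _ (2 * K)); first exact: measurable_funB.
  by move=> x; apply: le_trans (ler_normB _ _) _; have := gK x; lra.
have -> : Rintegral P setT g - c = Rintegral P setT (fun x => g x - c).
  by rewrite RintegralB// icst.
apply: le_trans (le_normr_Rintegral _ _) _ => //.
apply: (@le_trans _ _ (Rintegral P setT (fun x => e + 2 * K * \1_B x))).
  apply: le_Rintegral => //.
  - apply: (bint _ (2 * K)).
      by apply: measurableT_comp => //; exact: measurable_funB.
    by move=> x; rewrite normr_id; apply: le_trans (ler_normB _ _) _; have := gK x; lra.
  - apply: (bint _ (e + 2 * K)).
      apply: measurable_funD => //; apply: measurable_funM => //; exact: measurable_indic.
    by move=> x; rewrite indicE; case: (x \in B); rewrite ?mulr1 ?mulr0 ger0_norm//; lra.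
  - move=> x _; rewrite indicE; case: (boolP (x \in B)) => /=.
      move=> _; rewrite mulr1; apply: le_trans (ler_normB _ _) _; have := gK x; lra.
    by rewrite notin_setE => /hB; lra.
rewrite RintegralD// icst RintegralZl// lerD2l.
suff -> : Rintegral P setT (\1_B : T -> R) = pr P B by [].
by rewrite /Rintegral integral_indic// setIT.
Qed.

Section BorelCompact.
Variables (R : realType) (M : pseudoPMetricType R).
Local Notation bM := (borel M).

Lemma open_measurable_borel (U : set M) : open U -> measurable (U : set bM).
Proof. exact: sub_sigma_algebra. Qed.

Lemma continuous_measurable_borel (h : M -> R) : continuous h ->
  measurable_fun setT (h : bM -> R).
Proof.
move=> ch; apply: (@measurability _ _ bM _ setT h (@RGenOpens.G R)).
  exact: RGenOpens.measurableE.
move=> _ [_ [a [b ->]] <-]; rewrite setTI; apply: open_measurable_borel.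
apply: open_comp; last exact: interval_open.
by move=> x _; exact: ch.
Qed.

Lemma continuous_measurable_map (g : M -> M) : continuous g ->
  measurable_fun setT (g : bM -> bM).
Proof.
move=> cg; apply: (@measurability _ _ bM bM setT g (@open M)) => //.
move=> _ [U oU <-]; rewrite setTI; apply: open_measurable_borel.
by apply: open_comp => // x _; exact: cg.
Qed.

Lemma compact_function_bounded (h : M -> R) : compact [set: M] -> continuous h ->
  exists K, forall x, `|h x| <= K.
Proof.
move=> cM ch.
have ci : compact (h @` [set: M]).
  by apply: continuous_compact => //; apply: continuous_subspaceT.
have [K [_ hK]] := compact_bounded ci.
exists (K + 1) => x; apply: (hK (K + 1)); first by rewrite ltrDl.
by exists x.
Qed.

End BorelCompact.

(** * The product measure on paths in the group *)

Definition step_path (w : steps) : path_space F2 := fun n => step (w n).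

Lemma walk_step_path (w : steps) n : walk (step_path w) n = prefix_walk n w.
Proof.
elim: n w => [|n IH] w; first by rewrite /walk big_geq.
rewrite /walk big_nat_recl//.
transitivity (step (w 0) * walk (step_path (fun i => w i.+1)) n)%g => //.
rewrite IH -prefix_walk_scons; apply: prefix_walk_agree => -[|i] //.
Qed.

Lemma measurable_cylinder (n : nat) (A : set F2) :
  measurable ([set w | A (w n)] : set (path_space F2)).
Proof. by apply: sub_sigma_algebra; exists n, A. Qed.

Lemma measurable_step_path : measurable_fun setT step_path.
Proof.
apply: (@measurability _ _ steps (path_space F2) setT step_path (@cylinders F2)) => //.
move=> _ [_ [n [A ->]] <-]; rewrite setTI.
apply: (measurable_dep_set (n := n.+1)) => v w vw.
by rewrite /= /step_path vw.
Qed.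

Definition path_step (p : path_space F2) : steps := fun n =>
  if [pick t | step t == p n] is Some t then t else inl false.

Lemma step_pathK : cancel step_path path_step.
Proof.
move=> w; apply/funext => n; rewrite /path_step /step_path.
by case: pickP => [t /eqP/step_inj//|/(_ (w n))]; rewrite eqxx.
Qed.

Lemma measurable_path_step : measurable_fun setT path_step.
Proof.
apply: measurable_seqs => n x; elim: n => [|n IH].
  by rewrite cyl0 preimage_setT; exact: measurableT.
rewrite (_ : _ @^-1` _ = path_step @^-1` cyl n x `&`
  [set p : path_space F2 | [set g : F2 | x n =
    (if [pick t | step t == g] is Some t then t else inl false)] (p n)]).
  by apply: measurableI => //; exact: measurable_cylinder.
by apply/seteqP; split=> w; rewrite /cyl /= agreeS.
Qed.

Section PathMeasure.
Variable R : realType.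
Local Notation coin := (@coin step_index (inl false) R).

Definition path_measure : probability (path_space F2) R :=
  projT1 (cid (pushforward_probability coin measurable_step_path)).

Lemma path_measureE E : path_measure E = coin (step_path @^-1` E).
Proof. exact: (projT2 (cid (pushforward_probability coin measurable_step_path))). Qed.

Lemma pr_path_prefix n (a : nat -> F2) :
  pr coin [set w : steps | forall i, (i < n)%N -> step (w i) = a i] =
  \prod_(i < n) tau R (a i).
Proof.
elim: n a => [|n IH] a.
  by rewrite big_ord0 (_ : [set _ | _] = setT) ?prT//; apply/seteqP; split.
rewrite coin_self_similar; last first.
  apply: (measurable_dep_set (n := n.+1)) => v w vw.
  by split=> h i ni; [rewrite -vw ?h|rewrite vw ?h].
rewrite card_step big_ord_recl /tau -mulrA; congr (_ * _).
rewrite mulr_suml; apply: eq_bigr => t _.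
case: eqP => ta; last first.
  rewrite mul0r (_ : _ @^-1` _ = set0) ?pr0//.
  by apply/seteqP; split=> // w /(_ 0 isT).
rewrite mul1r (_ : _ @^-1` _ =
  [set w : steps | forall i, (i < n)%N -> step (w i) = a i.+1]) ?IH//.
by apply/seteqP; split=> w h => [i ni|[|i] ni]; [exact: (h i.+1)|exact: ta|exact: h].
Qed.

Lemma path_measure_product : is_product_measure (tau R) path_measure.
Proof.
move=> n a; rewrite path_measureE -pr_path_prefix; apply: prE.
apply: (measurable_dep_set (n := n)) => v w vw.
by split=> h i ni; move: (h i ni); rewrite /= /step_path vw.
Qed.

(** Almost every path has all increments in the range of [step]. On such paths [path_step] inverts
    [step_path], and its measurability makes the transported exceptional set measurable. *)
Lemma path_measure_ae (Q : path_space F2 -> Prop) (N : set steps) :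
  measurable N -> pr coin N = 0 -> (forall w, ~ N w -> Q (step_path w)) ->
  {ae path_measure, forall p, Q p}.
Proof.
move=> mN N0 hN.
pose B := path_step @^-1` N `|` \bigcup_n [set p : path_space F2 | (~` range step) (p n)].
exists B; split.
- apply: measurableU; last by apply: bigcupT_measurable => n; exact: measurable_cylinder.
  by rewrite -[X in measurable X]setTI; exact: measurable_path_step.
- rewrite path_measureE (_ : _ @^-1` _ = N) ?prE ?N0//.
  apply/seteqP; split=> w /=; last by move=> Nw; left; rewrite /= step_pathK.
  rewrite /B /= step_pathK => -[//|[n _ /=]].
  by case; exists (w n).
- move=> p /= nQ; apply: contrapT => /not_orP[nN nr]; apply: nQ.
  have -> : p = step_path (path_step p).
    apply/funext => n; rewrite /step_path /path_step.
    case: pickP => [t /eqP//|none]; exfalso; apply: nr; exists n => //= -[t _ tp].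
    by have := none t; rewrite tp eqxx.
  exact: hN.
Qed.

End PathMeasure.

Section Boundary.
Variable R : realType.
Local Notation coin := (@coin step_index (inl false) R).
Local Notation nu := (nu R).

Lemma countable_null (I : Type) (S : set I) (Q : I -> steps -> Prop) : countable S ->
  (forall U, S U -> exists N : set steps, [/\ measurable N, pr coin N = 0 &
     forall w, ~ N w -> Q U w]) ->
  exists N : set steps, [/\ measurable N, pr coin N = 0 &
     forall w, ~ N w -> forall U, S U -> Q U w].
Proof.
move=> /countable_injP[g ginj] h.
have /choice[F hF] (k : nat) : exists N : set steps,
    [/\ measurable N, pr coin N = 0 & forall w, ~ N w -> forall U, S U -> g U = k -> Q U w].
  have [[U [SU gU]]|nU] := pselect (exists U, S U /\ g U = k).
    have [N [mN N0 hN]] := h U SU; exists N; split=> // w /hN QU V SV gV.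
    by rewrite (ginj V U) ?inE// gU gV.
  by exists set0; split=> //; [exact: pr0|move=> w _ U SU gU; case: nU; exists U].
exists (\bigcup_k F k); split.
- by apply: bigcupT_measurable => k; have [] := hF k.
- by apply: pr_bigcup0 => k; have [] := hF k.
- move=> w nw U SU; have [_ _] := hF (g U); apply=> //.
  by move=> FU; apply: nw; exists (g U).
Qed.

(** For [U] in a countable base of the model, [walk_converges] applies to the measurable set [D]
    intersected with the preimage of [U]. Almost surely the translates of [eta] then concentrate on
    every basic neighbourhood of the image of the limit point. *)
Theorem boundary_bits : boundary (tau R) (bits_space R).
Proof.
split; first exact: stationary_space_bits.
move=> M act eta [[[hM cM] aact cact _] [D [D' [f [[[cD cD'] mf fDD' feq flaw] _]]]]].
have [mD pD iD] := cD.
exists (path_measure R); first exact: path_measure_product.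
have [S cS [oS bS]] := compact_second_countable cM.
have mpre (U : set (borel M)) : measurable U -> measurable (D `&` f @^-1` U : set bits).
  by move=> mU; exact: mf.
have invD g x : D (gact g x) -> D x by move=> /(iD g^-1%g); rewrite /= gactK.
have etaE g (U : set (borel M)) : measurable U ->
    pr eta (act g @^-1` U) = pr nu (gact g @^-1` (D `&` f @^-1` U)).
  move=> mU; rewrite /pr; congr fine.
  rewrite flaw; last first.
    by rewrite -[X in measurable X]setTI; apply: continuous_measurable_map.
  congr (nu _); apply/seteqP; split=> x /=.
    by move=> [Dx]; rewrite -[act g (f x)]feq// => h; split=> //; exact: iD.
  by move=> [/invD Dx]; rewrite feq.
have [N1 [mN1 N10 hN1]] := countable_null cS (Q := fun U w =>
    pr nu (gact (prefix_walk n w) @^-1` (D `&` f @^-1` U)) @[n --> \oo] -->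
    (\1_(D `&` f @^-1` U) (limit_point w) : R))
  (fun U SU => walk_converges R (mpre U (open_measurable_borel (oS U SU)))).
pose N2 := limit_point @^-1` (~` D).
have mN2 : measurable N2.
  rewrite -[X in measurable X]setTI; apply: measurable_limit_point => //.
  exact: measurableC.
have N20 : pr coin N2 = 0.
  rewrite pr_limit_point; last exact: measurableC.
  by rewrite pr_setC// /pr pD subrr.
apply: (path_measure_ae (N := N1 `|` N2)).
- exact: measurableU.
- by apply/le_anti; rewrite pr_ge0 andbT (le_trans (pr_setU_le _ mN1 mN2))// N10 N20 addr0.
move=> w /not_orP[/hN1 hw /contrapT Db].
exists (f (limit_point w)) => h ch; set m := f (limit_point w).
have [K hK] := compact_function_bounded cM ch.
have K0 : 0 <= K by exact: le_trans (hK m).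
have mh := continuous_measurable_borel ch.
have -> : Rintegral (\d_m : probability (borel M) R) setT h = h m.
  rewrite /Rintegral integral_dirac//; last exact/measurable_EFinP.
  by rewrite diracT mul1e.
apply/cvgrPdist_le => e e0.
have [U [SU Um] hU] : exists2 U, S U /\ U m & U `<=` [set y | `|h y - h m| <= e / 2].
  have /bS : nbhs m [set y | `|h y - h m| <= e / 2].
    have /cvgrPdist_le/(_ (e / 2)) := ch m; move=> /(_ ltac:(lra)).
    by under eq_near do rewrite distrC.
  by move=> [U [SU Um] hU]; exists U.
have mU : measurable (U : set (borel M)) by apply: open_measurable_borel; exact: oS.
have := hw U SU; rewrite indicE mem_set//= => /cvgrPdist_le.
(* Chosen so that the complement of [U] contributes at most [e / 2] to the integral of a function
   bounded by [K]; the added 1 covers [K = 0]. *)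
have d0 : 0 < e / 2 / (2 * K + 1) by apply: divr_gt0; lra.
move=> /(_ _ d0)[n0 _ hn0]; exists n0 => // n /= nn0.
have := hn0 n nn0; rewrite /= -etaE// => hn.
set g := walk _ n; have gE : g = prefix_walk n w by exact: walk_step_path.
rewrite -gE in hn.
have mg : measurable_fun setT (act g : borel M -> borel M) by exact: continuous_measurable_map.
have mgU : measurable (act g @^-1` U : set (borel M)).
  by rewrite -[X in measurable X]setTI; exact: mg.
rewrite distrC.
have hb : forall x : borel M, ~ (~` (act g @^-1` U)) x -> `|h (act g x) - h m| <= e / 2.
  by move=> x /contrapT; exact: hU.
have mhg : measurable_fun setT (fun x : borel M => h (act g x)).
  by apply: (measurableT_comp (g := act g : borel M -> borel M)).
apply: (le_trans (integral_concentrated eta mhg (measurableC mgU) _ _ (hK m) hb)) => //.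
  lra.
rewrite pr_setC//.
have := le_trans (ler_norm _) hn; rewrite ler_pdivlMr; last by lra.
have := pr_le1 eta mgU; nra.
Qed.

End Boundary.

(** * Essential freeness *)

Local Notation L := (letter 'I_2).

Definition hyp_shift (x : bits) : int :=
  if ~~ x 0 then 1 else if ~~ x 1%N then 0 else -1.

Definition hypV_shift (y : bits) : int :=
  if y 0 then 1 else if y 1%N then 0 else -1.

(* The displacement of the tail of a sequence under the action of a letter. *)
Definition lshift (l : L) (x : bits) : int :=
  if l.1 == ord0 then 0 else if l.2 then hypV_shift x else hyp_shift x.

Fixpoint shift (w : seq L) (x : bits) : int :=
  if w is l :: w' then shift w' x + lshift l (wact w' x) else 0.

Definition winv (w : seq L) : seq L := rev (map (@linv _) w).

Lemma winvK w x : wact (winv w) (wact w x) = x.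
Proof.
elim: w x => //= l w IH x.
by rewrite /winv /= rev_cons -cats1 wact_cat /= lactK IH.
Qed.

Lemma wact_winv w x : wact w (wact (winv w) x) = x.
Proof.
elim: w x => //= l w IH x.
by rewrite /winv /= rev_cons -cats1 wact_cat /= IH lactKV.
Qed.

Lemma lshift_dep l x y : agree 2 x y -> lshift l x = lshift l y.
Proof.
by move=> xy; rewrite /lshift /hyp_shift /hypV_shift (xy 0)// (xy 1%N).
Qed.

Lemma shift_dep w x y : agree (2 + size w) x y -> shift w x = shift w y.
Proof.
elim: w => //= l w IH xy; rewrite IH; last by apply: agree_le xy; lia.
congr (_ + _); apply: lshift_dep; apply: wact_lip; apply: agree_le xy; lia.
Qed.

Lemma shift_le w x : `|shift w x| <= (size w)%:Z.
Proof.
elim: w => //= l w IH; have : `|lshift l (wact w x)| <= 1.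
  by rewrite /lshift /hyp_shift /hypV_shift; do !case: ifP.
lia.
Qed.

(** * Scaling of the measure by words *)

Section Scaling.
Variable R : realType.
Local Notation nu := (nu R).

Lemma measurable_wact_pre w (E : set bits) : measurable E ->
  measurable (wact w @^-1` E).
Proof. by move=> mE; rewrite -[X in measurable X]setTI; exact: measurable_wact. Qed.

Lemma lshift_scaling l (E : set bits) (j : int) : measurable E ->
  (forall x, E x -> lshift l x = j) ->
  pr nu (lact (linv l) @^-1` E) = 2 ^ (- j) * pr nu E.
Proof.
move=> mE hE.
have qE a b (s : int) : (forall x, quarter a b x -> lshift l x = s) ->
    2 ^ (- j) * pr nu (quarter a b `&` E) = 2 ^ (- s) * pr nu (quarter a b `&` E).
  move=> hs; have [->//|sj] := eqVneq s j.
  rewrite (_ : _ `&` _ = set0) ?pr0 ?mulr0//; apply/seteqP; split=> // x [qx Ex].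
  by move/eqP: sj; apply; rewrite -(hs _ qx) (hE _ Ex).
rewrite (nu_quarters R mE) !mulrDr.
case: l hE qE => i e hE qE; rewrite /lact /=; case: (eqVneq i ord0) => i0.
  rewrite !(qE _ _ 0); try by move=> x _; rewrite /lshift /= i0 eqxx.
  rewrite oppr0 expr0z !mul1r -nu_quarters//.
  by case: e {hE qE}; rewrite /= ?nu_odo ?nu_odoV.
case: e hE qE => hE qE /=.
  rewrite (qE false false (-1)) ?(qE false true 0) ?(qE true false 1) ?(qE true true 1);
    try by move=> x [x0 x1]; rewrite /lshift /= (negbTE i0) /hypV_shift x0 ?x1.
  by rewrite nu_hyp// opprK oppr0 expr0z expr1z exprN1; lra.
rewrite (qE false false 1) ?(qE false true 1) ?(qE true false 0) ?(qE true true (-1));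
  try by move=> x [x0 x1]; rewrite /lshift /= (negbTE i0) /hyp_shift x0 ?x1.
by rewrite nu_hypV// opprK oppr0 expr0z expr1z exprN1; lra.
Qed.

(** Preimage by [winv w] is image by [w], and moving tails [j] places to the right lengthens
    cylinders by [j]. The induction cuts [E] according to the displacement -1, 0 or 1 of the letter
    applied last. *)
Lemma shift_scaling w (E : set bits) (j : int) : measurable E ->
  (forall x, E x -> shift w x = j) ->
  pr nu (wact (winv w) @^-1` E) = 2 ^ (- j) * pr nu E.
Proof.
elim: w E j => [|l w IH] E j mE hE /=.
  have [[x Ex]|nE] := pselect (exists x, E x).
    by rewrite -(hE x Ex) /= oppr0 expr0z mul1r.
  rewrite (_ : E = set0) ?preimage_set0 ?pr0 ?mulr0//.
  by apply/seteqP; split=> // x Ex; apply: nE; exists x.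
pose s (i : 'I_3) : int := (i : nat)%:Z - 1.
pose F i : set bits := E `&` [set x | lshift l (wact w x) = s i].
have mF i : measurable (F i).
  apply: measurableI => //; apply: (measurable_dep_set (n := 2 + size w)) => x y xy.
  by rewrite /= (lshift_dep l (wact_lip xy)).
have sF x : E x <-> exists i, F i x.
  split=> [Ex|[i []]//].
  suff [i hi] : exists i, lshift l (wact w x) = s i by exists i.
  rewrite /s /lshift /hyp_shift /hypV_shift.
  have e0 : (0 : int) = (Ordinal (isT : (1 < 3)%N) : nat)%:Z - 1 by [].
  have e1 : (1 : int) = (Ordinal (isT : (2 < 3)%N) : nat)%:Z - 1 by [].
  have e2 : (-1 : int) = (Ordinal (isT : (0 < 3)%N) : nat)%:Z - 1 by [].
  by do !case: ifP => _; first [exists (Ordinal (isT : (1 < 3)%N)); exact: e0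
    |exists (Ordinal (isT : (2 < 3)%N)); exact: e1
    |exists (Ordinal (isT : (0 < 3)%N)); exact: e2].
have dF i i' : i != i' -> F i `&` F i' = set0.
  move=> ii; apply/seteqP; split=> // x [[_ /= h1] [_ /= h2]].
  by move/eqP: ii; apply; apply: val_inj; move: h1; rewrite h2 /s => /addIr[].
rewrite (pr_sum nu mF dF sF) mulr_sumr.
rewrite (@pr_sum _ _ _ nu 'I_3 (fun i => lact (linv l) @^-1` (wact (winv w) @^-1` F i))).
- apply: eq_bigr => i _.
  rewrite (@lshift_scaling l _ (s i)); last 2 first.
  + exact: measurable_wact_pre.
  + by move=> y [_ /=]; rewrite wact_winv.
  rewrite (IH _ (j - s i))//; last first.
    by move=> x [Ex /= h]; rewrite -(hE x Ex) /= h addrK.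
  by rewrite mulrA -expfzDr//; congr (_ ^ _ * _); lia.
- move=> i; exact: (@measurable_wact_pre [:: linv l] _ (measurable_wact_pre _ (mF i))).
- move=> i i' ii; have := dF _ _ ii.
  by move=> /seteqP[h _]; apply/seteqP; split=> // y hy; apply: (h _ hy).
- move=> y; rewrite /= /winv rev_cons -cats1 wact_cat /= sF.
  by split=> -[i Fi]; exists i.
Qed.

Lemma null_fixed_shift w (j : int) : j != 0 ->
  let F := [set x : bits | wact w x = x /\ shift w x = j] in
  measurable F /\ pr nu F = 0.
Proof.
move=> j0 F.
have mF : measurable F.
  apply: (@measurableI _ _ [set x : bits | wact w x = x] [set x | shift w x = j]).
    rewrite (_ : [set x | _] = \bigcap_n [set x : bits | agree n (wact w x) x]).
      apply: bigcapT_measurable => n.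
      apply: (measurable_dep_set (n := n + size w)) => x y xy.
      have h := wact_lip xy; have xy' : agree n x y by apply: agree_le xy; exact: leq_addr.
      split=> /= k.
        exact: agree_trans (agree_sym h) (agree_trans k xy').
      exact: agree_trans h (agree_trans k (agree_sym xy')).
    apply/seteqP; split=> x /=; first by move=> h n _; rewrite /= h.
    by move=> h; apply: agree_all => n; exact: h.
  by apply: (measurable_dep_set (n := 2 + size w)) => x y /shift_dep /= ->.
split=> //.
have hF x : F x -> shift w x = j by case.
have := shift_scaling mF hF.
have -> : wact (winv w) @^-1` F = F.
  apply/seteqP; split=> x /=.
    move=> h; suff e : wact (winv w) x = x by move: h; rewrite e.
    by case: h => + _; rewrite wact_winv.
  move=> h; suff e : wact (winv w) x = x by rewrite e.
  by case: h => h _; rewrite -[in LHS]h winvK.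
move=> /eqP; rewrite -subr_eq0 -[X in X - _]mul1r -mulrBl mulf_eq0 => /orP[|/eqP//].
rewrite subr_eq0 => /eqP h; exfalso; move/eqP: j0; apply.
have : (2 : R) ^ (- j) = 2 ^ (0 : int) by rewrite -h expr0z.
by move/(@ieexprIz R 2) => e; apply: oppr_inj; rewrite oppr0 e//; apply/eqP; lra.
Qed.

End Scaling.

(** [h] flips according to the point it is applied to, while [h^-1] undoes a flip dictated by its
    result. For an inverse letter, position and trigger are thus those after the move. *)
Definition lpos (l : L) (y : bits) : int := if l.2 then lshift l y else 0.
Definition lsrc (l : L) (y : bits) : bits := if l.2 then lact l y else y.

(* The scattered flips performed by a word: offset of the position to be
   flipped relative to the initial point, and the point which triggers it. *)
Fixpoint events (w : seq L) (x : bits) : seq (int * bits) :=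
  if w is l :: w' then
    let y := wact w' x in
    if l.1 == ord0 then events w' x
    else (shift w' x + lpos l y, lsrc l y) :: events w' x
  else [::].

Definition flips (w : seq L) (x : bits) (n : nat) : bool :=
  \big[addb/false]_(e <- events w x) flip (absz (n%:Z + e.1)) e.2.

Lemma odo_tail x : (exists i, x i = false) ->
  exists N, forall n, (N <= n)%N -> odo x n = x n.
Proof.
move=> [i xi]; exists i.+1 => n ni; rewrite /odo /tri.
suff -> : carry n x = false by rewrite addbF.
by apply/negP => /allP/(_ i); rewrite mem_iota xi => /(_ ni).
Qed.

Definition ones : bits := fun=> true.

Lemma not_ones x : x <> ones -> exists i, x i = false.
Proof.
move=> x1; apply: contrapT => h; apply: x1; apply/funext => i.
by apply/negPn/negP => xi; apply: h; exists i; apply/negbTE.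
Qed.

Lemma hyp_tail x n : (2 <= n)%N ->
  hyp x (absz (n%:Z + hyp_shift x)) = x n (+) flip n x.
Proof.
move=> n2; rewrite /hyp /stretch /hyp_shift !scat_small// -/(tri flip x n) -/scat.
case: (x 0) => /=; last first.
  by rewrite addn1.
case: (x 1%N) => /=; last by rewrite addn0; case: n n2 => [|[|n]].
by rewrite (_ : absz _ = n.-1); [rewrite prednK//; lia|lia].
Qed.

Lemma hypV_shiftE y : hypV_shift y = - hyp_shift (hypV y).
Proof.
rewrite /hypV_shift /hyp_shift /hypV !scatV_small// /stretchV.
by case y0: (y 0); case y1: (y 1%N); rewrite /= ?y0 ?y1.
Qed.

(** A carry that runs forever occurs only when [odo] is applied to [ones] or [odoV] produces it;
    both are excluded. *)
Lemma letter_tail l x : x <> ones -> lact l x <> ones ->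
  exists N, forall n, (N <= n)%N ->
  lact l x (absz (n%:Z + lshift l x)) =
    x n (+) (if l.1 == ord0 then false else flip (absz (n%:Z + lpos l x)) (lsrc l x)).
Proof.
case: l => i e; rewrite /lact /lshift /lpos /lsrc /=; case: eqP => i0 x1 y1.
  have [N hN] : exists N, forall n, (N <= n)%N -> (if e then odoV else odo) x n = x n.
    case: e y1 => y1; last exact/odo_tail/not_ones.
    have [N hN] := odo_tail (not_ones y1); exists N => n /hN.
    by rewrite odoVK.
  by exists N => n /hN; rewrite addr0 addbF.
case: e y1 => y1; exists 4%N => n n4; rewrite /lshift /lact /= ?(introF eqP i0).
  have [v1 v2] : hypV_shift x <= 1 /\ -1 <= hypV_shift x.
    by rewrite /hypV_shift; do !case: ifP.
  have := @hyp_tail (hypV x) (absz (n%:Z + hypV_shift x)) ltac:(lia).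
  rewrite hypVK (_ : (absz (_ + hyp_shift _)) = n); first by move=> ->; rewrite addbK.
  by have := hypV_shiftE x; lia.
by rewrite ?addr0 ?addn0 hyp_tail//; lia.
Qed.

(** Both conditions quantify over the whole orbit, since a minimal word may have to be examined from
    another point of the orbit. *)
Definition generic (x : bits) : Prop :=
  (forall w, wact w x <> ones) /\
  (forall v w, wact w (wact v x) = wact v x -> shift w (wact v x) = 0).

Lemma generic_wact v x : generic x -> generic (wact v x).
Proof.
move=> [h1 h2]; split=> [w|v' w]; first by rewrite -wact_cat.
by have := h2 (v' ++ v) w; rewrite wact_cat.
Qed.

Lemma word_tail w x : (forall v, wact v x <> ones) ->
  exists N, forall n, (N <= n)%N ->
  wact w x (absz (n%:Z + shift w x)) = x n (+) flips w x n.
Proof.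
move=> gx; elim: w => [|l w [N IH]].
  by exists 0%N => n _; rewrite /flips big_nil addbF addr0.
have [N' hN'] := letter_tail (gx w) (gx (l :: w)).
exists (N + N' + size w)%N => n nN /=.
have ws := shift_le w x.
have mN : (N' <= absz (n%:Z + shift w x)%R)%N by lia.
have := hN' _ mN; rewrite IH; last by lia.
have shE (s : int) : absz (Posz (absz (n%:Z + shift w x)) + s) =
    absz (n%:Z + (shift w x + s))%R by lia.
rewrite !shE.
move=> ->; rewrite /flips /=; case: eqP => _; first by rewrite addbF.
by rewrite big_cons /= -addbA [_ (+) flip _ _]addbC.
Qed.

(** The starting point is left out, so that for a word fixing [x] each vertex of the closed loop is
    listed once per visit. *)
Fixpoint orbit_path (w : seq L) (x : bits) : seq bits :=
  if w is _ :: w' then wact w x :: orbit_path w' x else [::].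

Lemma events_split w x e r : events w x = e :: r ->
  exists w1 l w2, [/\ w = w1 ++ l :: w2, l.1 != ord0, r = events w2 x,
    e.1 = shift w2 x + lpos l (wact w2 x) & e.2 = lsrc l (wact w2 x)].
Proof.
elim: w => //= l w IH; case: eqVneq => [_ /IH|l0 [<- <-]].
  by move=> [w1 [m [w2 [-> m0 -> e1 e2]]]]; exists (l :: w1), m, w2.
by exists [::], l, w.
Qed.

Lemma events_source w x e : e \in events w x -> e.2 \in rcons (orbit_path w x) x.
Proof.
have head v : wact v x \in rcons (orbit_path v x) x.
  by case: v => [|l v] /=; rewrite in_cons eqxx.
elim: w => //= l w IH; case: eqP => _; rewrite !in_cons; first by move=> /IH ->; rewrite orbT.
case/predU1P => [->|/IH ->]; last by rewrite orbT.
by rewrite /lsrc; case: l.2 => /=; rewrite ?eqxx// head orbT.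
Qed.

(** Since [h] is triggered by its source and [h^-1] by its target, only a leading [h^-1] lets the
    final position trigger a flip, and only a trailing [h] lets the initial one do so. The next
    lemma is the second half. *)
Lemma events_source_head l w x e : ~~ l.2 || (l.1 == ord0) ->
  e \in events (l :: w) x -> e.2 \in rcons (orbit_path w x) x.
Proof.
rewrite /=; case: eqP => l0; first by move=> _; exact: events_source.
rewrite orbF in_cons => l2 /predU1P[->|]; last exact: events_source.
by rewrite /lsrc (negbTE l2) /=; case: w => [|m w]; rewrite /= mem_head.
Qed.

Lemma events_source_last w l x e : (last l w).2 || ((last l w).1 == ord0) ->
  e \in events w x -> e.2 \in orbit_path w x.
Proof.
elim: w l => //= m w IH l hl; case: eqP => m0; rewrite !in_cons.
  by move=> /IH; move=> /(_ m hl) ->; rewrite orbT.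
case/predU1P => [->|/IH]; last by move=> /(_ m hl) ->; rewrite orbT.
rewrite /= /lsrc; case m2: m.2; first by rewrite eqxx.
case: w hl {IH} => [|l' w] /=; first by rewrite m2 => /eqP.
by rewrite in_cons eqxx orbT.
Qed.

Lemma events_bound w x e : e \in events w x -> `|e.1| <= (size w)%:Z.
Proof.
elim: w => //= l w IH; case: eqP => l0; first by move=> /IH; lia.
rewrite in_cons => /predU1P[->|/IH]; last by lia.
have := shift_le w x; rewrite /lpos /lshift /hyp_shift /hypV_shift /=.
by case: l.2; do ?case: ifP; lia.
Qed.

(* If the point triggering the last flip triggers no other one, then a special
   position is flipped only once, although the displacement is zero. *)
Lemma lone_event w x e r : generic x -> wact w x = x -> events w x = e :: r ->
  (forall e', e' \in r -> e'.2 <> e.2) -> False.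
Proof.
move=> gx wx ev sep.
have s0 : shift w x = 0 by have := gx.2 [::] w; exact.
have [N] := word_tail w gx.1; rewrite wx s0 => hN.
have [M hM] : exists M, forall e', e' \in r -> ~ agree M e'.2 e.2.
  elim: r {ev} sep => [|a r IH] sep; first by exists 0%N.
  have [e' he'|M hM] := IH; first by apply: sep; rewrite in_cons he' orbT.
  have /existsNP[K hK] : ~ forall K, agree K a.2 e.2.
    by move=> /agree_all; apply: sep; rewrite mem_head.
  exists (M + K)%N => e'; rewrite in_cons => /predU1P[-> h|/hM h h'].
    by apply: hK; apply: agree_le h; lia.
  by apply: h; apply: agree_le h'; lia.
(* The first [M] bits of [e.2] separate it from all other triggers, so at [2 ^ (k + 2)] only [e]
   flips. The lower bound on [k] takes [n] beyond [N] and keeps all offsets within the gaps between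
   special positions. *)
have [k kN dk] := decode_inf (mkseq e.2 M) (N + M + size w + size w).
have kk : (k < 2 ^ k)%N by exact: ltn_expl.
have k4 : (2 ^ (k + 2) = 4 * 2 ^ k)%N by rewrite expnD mulnC.
have eb e' : e' \in events w x -> `|e'.1| <= (size w)%:Z by exact: events_bound.
have e1 : `|e.1| <= (size w)%:Z by apply: eb; rewrite ev mem_head.
have [n nE] : exists n, n%:Z = (2 ^ (k + 2))%N%:Z - e.1.
  by exists (absz ((2 ^ (k + 2))%N%:Z - e.1)); lia.
have := hN n ltac:(lia); rewrite addr0 absz_nat.
suff -> : flips w x n = true by case: (x n).
rewrite /flips ev big_cons big1_seq => [|[p s] /= he'].
  rewrite addbF (_ : (absz (_)) = 2 ^ (k + 2))%N; last by lia.
  rewrite flip_pow dk size_mkseq ?eqxx//; lia.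
have ps : `|p| <= (size w)%:Z by apply: (eb (p, s)); rewrite ev in_cons he' orbT.
have [h|h] := eqVneq (absz (n%:Z + p)) (2 ^ (k + 2))%N.
  rewrite h flip_pow dk size_mkseq; last by lia.
  by apply/negP => /eqP/agree_mkseq; exact: hM he'.
by apply: (@flip_near k _ (size w + size w)) => //; move: {sep hM eb hN} ps e1; lia.
Qed.

Lemma orbit_path_cat w v x :
  orbit_path (w ++ v) x = orbit_path w (wact v x) ++ orbit_path v x.
Proof. by elim: w => //= l w ->; rewrite wact_cat. Qed.

Lemma orbit_path_not_uniq w x : ~~ uniq (orbit_path w x) ->
  exists w1 w2 w3, [/\ w = w1 ++ w2 ++ w3, w2 != [::], w1 ++ w3 != [::] &
    wact w2 (wact w3 x) = wact w3 x].
Proof.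
have mem v y : y \in orbit_path v x ->
    exists v1 l v2, v = v1 ++ l :: v2 /\ y = wact (l :: v2) x.
  elim: v => //= l v IH; rewrite in_cons => /predU1P[->|/IH]; first by exists [::], l, v.
  by move=> [v1 [m [v2 [-> ->]]]]; exists (l :: v1), m, v2.
elim: w => //= l w IH; rewrite negb_and negbK => /orP[|/IH].
  move=> /mem[v1 [m [v2 [-> e]]]]; exists [::], (l :: v1), (m :: v2); split=> //.
  by rewrite -wact_cat.
by move=> [w1 [w2 [w3 [-> w20 _ e]]]]; exists (l :: w1), w2, w3.
Qed.

Lemma letter_eq (l m : L) : l.1 != ord0 -> m.1 != ord0 -> l.2 = m.2 -> l = m.
Proof.
case: l m => [i e] [j f] /= i0 j0 ->; congr (_, _); apply: val_inj.
by case: i j i0 j0 => [[|[|//]] ?] [[|[|//]] ?].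
Qed.

Lemma reduced_catl (w v : seq L) : reduced (w ++ v) -> reduced w.
Proof. by rewrite /reduced => /cat_sorted2[]. Qed.

Lemma reduced_catr (w v : seq L) : reduced (w ++ v) -> reduced v.
Proof. by rewrite /reduced => /cat_sorted2[]. Qed.

(** Such a word uses only [u] and [u^-1]; being reduced it is a power of one of them, and the
    odometer has no periodic points. *)
Lemma no_events w x y : reduced w -> events w y = [::] -> wact w x = x -> w = [::].
Proof.
move=> rw ew.
have w0 : forall l, l \in w -> l.1 = ord0.
  elim: w ew {rw} => //= l w IH; case: eqP => // l0 /IH h m.
  by rewrite in_cons => /predU1P[->|/h].
have [e we] : exists e, w = nseq (size w) (ord0, e).
  elim: w rw w0 {ew} => [|l w IH] rw w0; first by exists false.
  have l0 : l.1 = ord0 by apply: w0; rewrite mem_head.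
  have [m mw|e we] := IH (reduced_behead rw); first by apply: w0; rewrite in_cons mw orbT.
  case: w rw we {IH w0} => [|m w] rw we.
    by exists l.2; rewrite /= -l0 -surjective_pairing.
  exists e; rewrite [LHS]/= {1}we /=; congr cons.
  move: rw we => /= /andP[ml _] [me _]; move: ml; rewrite me.
  by case: l l0 => i f /= ->; rewrite /linv /=; case: e f {me} => -[].
rewrite we; case: e {we} => [|h]; last first.
  by rewrite (@iter_odo_free (size w) x)// -[RHS]h; elim: (size w) => //= n ->.
move=> h; rewrite (@iter_odo_free (size w) x)// -{1}h.
by elim: (size w) => //= n IH; rewrite -iterS iterSr odoVK.
Qed.

Lemma generic_free w x : reduced w -> generic x -> wact w x = x -> w = [::].
Proof.
have [n] := ubnP (size w); elim: n => // n IH in w x *.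
rewrite ltnS => wn rw gx wx.
(* A repeated point yields a shorter nonempty subword with a fixed point, to which induction
   applies. *)
have [uw|/orbit_path_not_uniq] := boolP (uniq (orbit_path w x)); last first.
  move=> [w1 [w2 [w3 [we w20 w130 fx]]]]; move/eqP: w20; case.
  apply: (IH _ (wact w3 x)) => //; last exact: generic_wact.
    move: wn w130; rewrite we !size_cat; case: w1 {we}; case: w3 {fx} => //=; lia.
  by move: rw; rewrite we => /reduced_catr/reduced_catl.
case ev: (events w x) => [|e r]; first exact: no_events ev wx.
have [w1 [l [w2 [we l0 er e1 e2]]]] := events_split ev.
exfalso; apply: (lone_event gx wx ev) => e' er' ee.
have := er'; rewrite er => /events_source; rewrite ee e2 mem_rcons in_cons /lsrc.
move: uw; rewrite we orbit_path_cat cat_uniq => /and3P[_ w1w2 /= /andP[lw2 uw2]].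
have nx y : y \in wact (l :: w2) x :: orbit_path w2 x -> w1 != [::] -> y <> x.
  move=> yw w10 yx; move/negP: w1w2; apply; apply/hasP; exists y; first exact: yw.
  suff : wact (w1 ++ l :: w2) x \in orbit_path w1 (wact (l :: w2) x) by rewrite -we wx yx.
  by case: w1 w10 {we ev} => //= m w1 _; rewrite wact_cat mem_head.
(* For [l = h^-1] the trigger is the target of [l]. Another event can share it only if it is the
   base point [x], triggered by a trailing [h]; then [w] is conjugate by [l] to a shorter word with
   a fixed point. *)
case l2: l.2.
  move=> /orP[/eqP lx|]; last by rewrite (negbTE lw2).
  have w10 : w1 = [::].
    by apply/eqP/negPn/negP => /nx h; apply: h lx; rewrite mem_head.
  move: er'; rewrite er; case: (lastP w2) er ev we rw lw2 ee e2 => [//|v m].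
  move=> er ev we rw lw2 ee e2 er'.
  have [ml|ml] := boolP ((last m (rcons v m)).2 || ((last m (rcons v m)).1 == ord0)).
    by move/negP: lw2; apply; have := events_source_last ml er'; rewrite ee e2 /lsrc l2.
  rewrite last_rcons negb_or in ml; case/andP: ml => /negbTE m2 m0.
  have ml : m = linv l by apply: letter_eq; rewrite //= l2 m2.
  rewrite w10 /= ml in we.
  have vx : wact v (wact [:: linv l] x) = wact [:: linv l] x.
    by rewrite -{2}wx we /= -cats1 wact_cat /= lactK.
  have v0 : v = [::].
    apply: IH vx; last exact: generic_wact.
      by move: wn; rewrite we /= size_rcons; lia.
    by move: rw; rewrite we -cats1 -cat1s => /reduced_catr/reduced_catl.
  by move: rw; rewrite we v0 /= eqxx.
(* For [l = h] the trigger is the source of [l], and the preceding letter is not [h^-1] because [w]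
   is reduced. A shared trigger must again be [x], which repeats a point of the loop. *)
move=> _; rewrite er in er'; rewrite e2 /lsrc l2 in ee.
case: w2 {er e1 e2} er' ee we rw nx lw2 uw2 w1w2 {ev} => [//|m w2].
move=> er' ee we rw nx lw2 /= /andP[mw2 uw2] w1w2.
have hm : ~~ m.2 || (m.1 == ord0).
  apply/negPn; rewrite negb_or negbK; apply/negP => /andP[m2 m0].
  have := reduced_catr (w := w1) (v := [:: l, m & w2]); rewrite -we => /(_ rw) /= /andP[+ _].
  by rewrite (@letter_eq m (linv l)) ?eqxx//= l2.
have := events_source_head hm er'; rewrite ee mem_rcons in_cons => /orP[/eqP mx|].
  have [w10|] := eqVneq w1 [::]; last by move=> /nx; apply; last exact: mx; rewrite !in_cons eqxx orbT.
  move: lw2 => /negP; apply.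
  have -> : lact l (wact (m :: w2) x) = x by rewrite -[RHS]wx we w10.
  by rewrite -{1}mx /= mem_head.
by rewrite (negbTE mw2).
Qed.

(** * The exceptional null set *)

Section Free.
Variable R : realType.
Local Notation nu := (nu R).

Lemma pr_point (y : bits) : measurable [set y] /\ pr nu [set y] = 0.
Proof.
have m1 : measurable [set y].
  rewrite (_ : [set y] = \bigcap_n cyl n y).
    by apply: bigcapT_measurable => n; exact: measurable_cyl.
  apply/seteqP; split=> [_ -> n _|z h]; first by [].
  by apply/esym/agree_all => n; apply: h.
split=> //; apply/le_anti; rewrite pr_ge0 andbT.
apply/ler_addgt0Pr => e e0; rewrite add0r.
have [n hn] : exists n, (1 / 2 : R) ^+ n < e.
  have /cvgrPdist_lt/(_ e e0)[n _ hn] := @cvg_expr R (1 / 2) ltac:(rewrite ger0_norm; lra).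
  exists n; have := hn n (leqnn n); rewrite sub0r normrN ger0_norm// exprn_ge0//; lra.
rewrite (le_trans _ (ltW hn))//; apply: (@le_trans _ _ (pr nu (cyl n y))).
  by apply: le_pr => //; [exact: measurable_cyl|move=> _ ->].
by rewrite nu_cyl expr_div_n expr1n mul1r.
Qed.

Lemma pr_bigcup_count0 (I : countType) (F : I -> set bits) :
  (forall i, measurable (F i)) -> (forall i, pr nu (F i) = 0) ->
  measurable (\bigcup_i F i) /\ pr nu (\bigcup_i F i) = 0.
Proof.
move=> mF F0; pose H k := if unpickle k is Some i then F i else set0.
have -> : \bigcup_i F i = \bigcup_k H k.
  apply/seteqP; split=> x [i _ Fi]; first by exists (pickle i); rewrite /H ?pickleK.
  by move: Fi; rewrite /H; case: unpickle => // j Fj; exists j.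
have mH k : measurable (H k) by rewrite /H; case: unpickle.
split; first exact: bigcupT_measurable.
by apply: pr_bigcup0 => // k; rewrite /H; case: unpickle => [i|]; [exact: F0|exact: pr0].
Qed.

Theorem essentially_free_bits : essentially_free (bits_space R).
Proof.
pose B1 (w : seq L) : set bits := [set x | wact w x = ones].
(* The displacement runs over all integers; 0 is replaced by 1 so that every member of the countable
   family is null. *)
pose B2 (p : seq L * seq L * int) : set bits := wact p.1.1 @^-1`
  [set x | wact p.1.2 x = x /\ shift p.1.2 x = (if p.2 == 0 then 1 else p.2)].
have nz (j : int) : (if j == 0 then 1 else j) != 0 by case: ifP => // /negbT.
have b1 w : B1 w = wact w @^-1` [set ones] by [].
have [m1 z1] : measurable (\bigcup_w B1 w) /\ pr nu (\bigcup_w B1 w) = 0.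
  have [mo zo] := pr_point ones.
  apply: pr_bigcup_count0 => w; rewrite b1; first exact: measurable_wact_pre.
  exact: nu_wact0.
have [m2 z2] : measurable (\bigcup_p B2 p) /\ pr nu (\bigcup_p B2 p) = 0.
  apply: pr_bigcup_count0 => p; have [mf zf] := null_fixed_shift R p.1.2 (nz p.2).
    exact: measurable_wact_pre.
  exact: nu_wact0.
exists (\bigcup_w B1 w `|` \bigcup_p B2 p); split.
- exact: measurableU.
- rewrite -[LHS]fineK ?fin_num_measure//; last exact: measurableU.
  congr EFin; apply/le_anti; rewrite [X in _ && X]pr_ge0 andbT.
  by rewrite (le_trans (pr_setU_le _ m1 m2))// z1 z2 addr0.
- move=> x /= nf; apply: contrapT => /not_orP[n1 n2]; apply: nf => g gx.
  apply: val_inj; apply: (@generic_free _ x) gx; first exact: fword_reduced.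
  split=> [w wx|v w wv]; first by apply: n1; exists w.
  apply: contrapT => /eqP s0; apply: n2; exists (v, w, shift w (wact v x)) => //.
  by rewrite /B2 /= (negbTE s0).
Qed.

End Free.

(** * Primeness *)

(* The lower limit of the preimages of an arbitrary Hahn set is an invariant one. *)
Section InvariantHahn.
Context d (Y : measurableType d) (R : realType).
Variables (P Q : probability Y R) (S : Y -> Y).
Hypotheses (mS : measurable_fun setT S)
  (PS : forall F, measurable F -> pr P (S @^-1` F) = pr P F)
  (QS : forall F, measurable F -> pr Q (S @^-1` F) = pr Q F).

Lemma hahn_pr : exists A, [/\ measurable A,
  (forall F, measurable F -> F `<=` A -> pr Q F <= pr P F) &
  (forall F, measurable F -> F `&` A = set0 -> pr P F <= pr Q F)].
Proof.
pose ch := cadd (charge_of_finite_measure P) (copp (charge_of_finite_measure Q)).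
have chE F : measurable F -> ch F = (pr P F - pr Q F)%:E.
  by move=> mF; rewrite EFinB -!prE.
have [A [N [[mA pA] [mN nN] AN disj]]] := Hahn_decomposition ch.
exists A; split=> // F mF FA.
  by have : (0 <= ch F)%E := pA F mF FA; rewrite chE// lee_fin; lra.
have FN : F `<=` N.
  move=> x Fx; have : setT x by []; rewrite -AN => -[Ax|//].
  by have : (F `&` A) x by []; rewrite FA.
by have : (ch F <= 0)%E := nN F mF FN; rewrite chE// lee_fin; lra.
Qed.

Let balanced (A : set Y) := forall F, measurable F -> F `<=` A -> pr P F = pr Q F.

Let balanced_bigcup (A : nat -> set Y) : (forall n, measurable (A n)) ->
  (forall n, balanced (A n)) -> balanced (\bigcup_n A n).
Proof.
move=> mA bA F mF FA; pose D := seqDU (fun n => F `&` A n).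
have mD n : measurable (D n) by apply: seqDU_measurable => k; exact: measurableI.
have -> : F = \bigcup_n D n.
  rewrite -seqDU_bigcup_eq -setI_bigcupr; apply/esym/setIidPl; exact: FA.
rewrite /pr !measure_bigcup//; try exact: trivIset_seqDU.
congr fine; apply: eq_eseriesr => n _.
transitivity (pr Q (D n))%:E; last exact/esym/prE.
by rewrite -(bA n _ (mD n)); [exact: prE|move=> x [[]]].
Qed.

Lemma invariant_hahn : exists A, [/\ measurable A, S @^-1` A = A,
  (forall F, measurable F -> F `<=` A -> pr Q F <= pr P F) &
  (forall F, measurable F -> F `&` A = set0 -> pr P F <= pr Q F)].
Proof.
have [A0 [mA0 pA nA]] := hahn_pr.
pose B m := iter m S @^-1` A0.
have mB m : measurable (B m).
  elim: m => [|m IH]; first exact: mA0.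
  rewrite (_ : B _ = S @^-1` B m); first by rewrite -[X in measurable X]setTI; exact: mS.
  by apply/funext => x; rewrite /B /= -iterSr.
have PB m : pr P (B m) = pr P A0 /\ pr Q (B m) = pr Q A0.
  elim: m => [//|m [IHP IHQ]].
  rewrite (_ : B _ = S @^-1` B m); first by rewrite PS// QS.
  by apply/funext => x; rewrite /B /= -iterSr.
have mC (E : set Y) : measurable E -> measurable (~` E) by exact: measurableC.
(* [P - Q] is nonnegative on the first set and nonpositive on the second. As [A0] and [B m] have
   equal measures, both values vanish, and so do those on all measurable subsets. *)
have both m : balanced (A0 `&` ~` B m) /\ balanced (B m `&` ~` A0).
  have m1 : measurable (A0 `&` ~` B m) by apply: measurableI => //; exact: mC.
  have m2 : measurable (B m `&` ~` A0) by apply: measurableI => //; exact: mC.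
  have s1 : A0 `&` ~` B m `<=` A0 by move=> x [].
  have s2 (F : set Y) : F `<=` B m `&` ~` A0 -> F `&` A0 = set0.
    by move=> FB; apply/seteqP; split=> // x [/FB[_ nx] Ax].
  have := PB m; rewrite (pr_split P mA0 (mB m)) (pr_split Q mA0 (mB m)).
  rewrite (pr_split P (mB m) mA0) (pr_split Q (mB m) mA0) ![B m `&` A0]setIC.
  have := pA _ m1 s1; have := nA _ m2 (s2 _ (@subset_refl _ _)) => h2 h1 [e1 e2].
  split=> F mF FB.
    have mD : measurable ((A0 `&` ~` B m) `&` ~` F) by apply: measurableI => //; exact: mC.
    have := pA _ mF (subset_trans FB s1).
    have := pA _ mD (subset_trans (@subIsetl _ _ _) s1).
    have := pr_split P m1 mF; have := pr_split Q m1 mF.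
    by rewrite (setIidr FB); lra.
  have mD : measurable ((B m `&` ~` A0) `&` ~` F) by apply: measurableI => //; exact: mC.
  have := nA _ mF (s2 _ FB); have := nA _ mD (s2 _ (@subIsetl _ _ _)).
  have := pr_split P m2 mF; have := pr_split Q m2 mF.
  by rewrite (setIidr FB); lra.
exists (\bigcup_n \bigcap_k B (n + k)%N); split.
- by apply: bigcupT_measurable => n; exact: bigcapT_measurable.
- apply/seteqP; split=> x [n _ h].
    by exists n.+1 => // k _; have := h k Logic.I; rewrite /B /= -iterSr.
  by exists n => // k _; have := h k.+1 Logic.I; rewrite /B /= addnS iterSr.
- move=> F mF FA; have mF' : measurable (F `&` ~` A0) by apply: measurableI => //; exact: mC.
  rewrite (pr_split P mF mA0) (pr_split Q mF mA0).
  rewrite (balanced_bigcup (A := fun m => B m `&` ~` A0) _ _ mF').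
  + by rewrite lerD2r; apply: pA; [exact: measurableI|move=> x []].
  + by move=> m; apply: measurableI => //; exact: mC.
  + by move=> m; exact: (both m).2.
  + by move=> x [/FA[n _ h] nx]; exists (n + 0)%N => //; split=> //; exact: h.
- move=> F mF FA; have mF' : measurable (F `&` A0) by exact: measurableI.
  rewrite (pr_split P mF mA0) (pr_split Q mF mA0).
  rewrite (balanced_bigcup (A := fun m => A0 `&` ~` B m) _ _ mF').
  + rewrite lerD2l; apply: nA; first by apply: measurableI => //; exact: mC.
    by apply/seteqP; split=> // x [[]].
  + by move=> m; apply: measurableI => //; exact: mC.
  + by move=> m; exact: (both m).1.
  + move=> x [Fx Ax]; apply: contrapT => h.
    have : (F `&` \bigcup_n \bigcap_k B (n + k)%N) x; last by rewrite FA.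
    split=> //; exists 0%N => // k _; apply: contrapT => nB; apply: h.
    by exists k => //; split.
Qed.

End InvariantHahn.

(** * Ergodicity of the odometer *)

Section Ergodic.
Variable R : realType.
Local Notation nu := (nu R).

(** The odometer permutes the cylinders of each length transitively, so an invariant set fills them
    all in the same proportion. It is then independent of every measurable set, in particular of
    itself. *)
Lemma odo_ergodic (E : set bits) : measurable E ->
  (forall x, E (odo x) <-> E x) -> pr nu E = 0 \/ pr nu E = 1.
Proof.
move=> mE iE; have iEk k x : E (iter k odo x) <-> E x.
  by elim: k => //= k IH; rewrite iE.
have eqc n x y : pr nu (E `&` cyl n x) = pr nu (E `&` cyl n y).
  have [k kxy] := odo_transitive n x y.
  rewrite -[RHS](nu_odoX R k); last by apply: measurableI => //; exact: measurable_cyl.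
  congr (pr nu _); apply/seteqP; split=> z; rewrite /= gact_uX => -[Ez xz]; split.
  - exact/(iEk k).
  - by apply: agree_trans (agree_sym kxy) _; apply/agree_iter_odo.
  - exact/(iEk k).
  - by apply/(agree_iter_odo _ k); apply: agree_trans kxy _.
have rm := real_measure_restr nu mE.
have h n x : pr nu (E `&` cyl n x) = pr nu E * 2%:R ^- n.
  elim: n => [|n IH] in x *; first by rewrite cyl0 setIT expr0 invr1 mulr1.
  apply: (mulfI (x := 2%:R)) => //.
  have := IH x; rewrite (real_measure_cylS _ _ rm) big_bool /=.
  rewrite (eqc _ _ x) (eqc _ (upd x n false) x) => e.
  have h2 : 2 ^+ n != 0 :> R by rewrite expf_neq0.
  rewrite (_ : 2 * (pr nu E * _) = pr nu E / 2 ^+ n); last by rewrite exprS; field.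
  by rewrite -e; lra.
have hE : pr nu (E `&` E) = pr nu E * pr nu E.
  apply: (@real_measure_unique _ _ _ (fun F => pr nu (E `&` F))
    (fun F => pr nu E * pr nu F) 0) => //.
    by apply: real_measureZ; [exact: pr_ge0|exact: real_measure_pr].
  by move=> n x _; rewrite h nu_cyl.
move: hE; rewrite setIid => /eqP; rewrite -subr_eq0 -{1}[pr nu E]mulr1 -mulrBr.
rewrite mulf_eq0 => /orP[/eqP->|]; first by left.
by rewrite subr_eq0 => /eqP <-; right.
Qed.

End Ergodic.

(** * Generating all cylinders from one half *)

Local Notation bcyl := (@cyl bool false).

Definition half (b : bool) : set bits := [set x | x 0 = b].

Lemma measurable_half b : measurable (half b).
Proof.
by apply: (measurable_dep_set (n := 1)) => x y xy; rewrite /half /= (xy 0).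
Qed.

Lemma cyl_hypV n (y : bits) : (2 <= n)%N -> y 0 ->
  bcyl n.+1 (hypV y) = hyp @^-1` bcyl n y.
Proof.
move=> n2 y0; apply/seteqP; split=> z; have := agree_hypV y (hyp z) n2;
  by rewrite hypK /level y0 => -[].
Qed.

Lemma cyl_odo n x y : exists k, bcyl n y = gact (gu ^+ k)%g @^-1` bcyl n x.
Proof.
have [k kyx] := odo_transitive n y x; exists k.
apply/seteqP; split=> z; rewrite /cyl /= gact_uX => h.
  by apply: agree_trans (agree_sym kyx) _; apply/agree_iter_odo.
by apply/(agree_iter_odo _ k); apply: agree_trans kyx _.
Qed.

(** [hypV] lengthens cylinders inside the half of first bit 1 by one bit, and the odometer reaches
    all others of that length. This is the induction step from length [n] to [n + 1]. *)
Lemma exists_first_true n x : (2 <= n)%N ->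
  exists k (y : bits), y 0 /\ bcyl n.+1 x = gact (gu ^+ k)%g @^-1` (hyp @^-1` bcyl n y).
Proof.
move=> n2; pose y : bits := fun=> true.
by have [k ->] := cyl_odo n.+1 (hypV y) x; exists k, y; rewrite cyl_hypV.
Qed.

Lemma hyp0 x : hyp x 0 = x 0 && x 1%N.
Proof.
rewrite /hyp /stretch !scat_small//.
by case: (x 0); case x1: (x 1%N); rewrite /= ?scat_small.
Qed.

Lemma hyp01 x : x 0 = false <-> quarter false false (hyp x).
Proof.
rewrite /quarter /hyp /stretch /= !scat_small//.
case x0: (x 0) => /=; last by rewrite ?scat_small// ?x0.
by case x1: (x 1%N) => /=; split=> // -[]; rewrite ?scat_small// ?x1.
Qed.

(** The odometer gives both halves; the cylinder of [10] consists of the points of the half 1 that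
    [hyp] sends to the half 0; longer cylinders follow by [exists_first_true]. *)
Lemma measurable_generated (C : set (set bits)) : sigma_algebra setT C ->
  (forall g E, C E -> C (gact g @^-1` E)) -> C (half false) ->
  forall E, measurable E -> C E.
Proof.
move=> [C0 CC CU] Cg Ch; apply: smallest_sub; first by split.
have CT : C setT by rewrite -(setD0 setT); exact: CC.
have Cn A : C A -> C (~` A) by move=> /CC; rewrite setTD.
have CI A B : C A -> C B -> C (A `&` B).
  move=> CA CB; rewrite -[A `&` B]setCK setCI; apply: (Cn).
  rewrite (_ : _ `|` _ = \bigcup_n (if n is 0%N then ~` A else ~` B)).
    by apply: CU => -[|n]; exact: Cn.
  apply/seteqP; split=> x; first by case=> h; [exists 0%N|exists 1%N].
  by move=> [[|n] _]; [left|right].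
have C1 x : C (bcyl 1 x).
  have [k ->] := cyl_odo 1 (fun=> false) x; apply: (Cg (gu ^+ k)%g).
  rewrite (_ : bcyl _ _ = half false)//; apply/seteqP; split=> z; rewrite /cyl /half /=.
    by move=> /(_ 0 isT).
  by move=> z0 [|i].
have C2 x : C (bcyl 2 x).
  pose y : bits := fun i => i == 0%N.
  have [k ->] := cyl_odo 2 y x; apply: (Cg (gu ^+ k)%g).
  rewrite (_ : bcyl _ _ = bcyl 1 y `&` gact gh @^-1` half false).
    by apply: CI => //; exact: Cg.
  rewrite gact_h; apply/seteqP; split=> z; rewrite /cyl /half /= hyp0.
    move=> yz; split; first exact: agree_le yz.
    by rewrite -(yz 0)// -(yz 1%N).
  move=> [yz]; have := yz 0 isT => /= <- /= z1.
  apply/agreeS; split=> //; by rewrite z1.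
have Cn2 n x : C (bcyl n.+2 x).
  elim: n x => [|n IH] x; first exact: C2.
  have [k [y [_ ->]]] := @exists_first_true n.+2 x isT.
  by apply: (Cg (gu ^+ k)%g); apply: (Cg gh).
by move=> _ [[|[|n]] [x ->]]; rewrite ?cyl0.
Qed.

(** * Sigma-algebras balanced between the two halves *)

Section Balanced.
Variable R : realType.
Local Notation nu := (nu R).

Lemma nu_half b E : measurable E -> pr nu (E `&` half b) =
  pr nu (quarter b false `&` E) + pr nu (quarter b true `&` E).
Proof.
move=> mE; have mh := measurable_half b.
rewrite (nu_quarters R (measurableI _ _ mE mh)).
have e a c : pr nu (quarter a c `&` (E `&` half b)) =
    if a == b then pr nu (quarter a c `&` E) else 0.
  case: eqP => ab.
    congr (pr nu _); apply/seteqP; split=> x [qx]; first by case.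
    by move=> Ex; split=> //; split=> //; rewrite /half /= -ab; case: qx.
  rewrite (_ : _ `&` _ = set0) ?pr0//; apply/seteqP; split=> // x [[x0 _] [_]].
  by rewrite /half /= x0.
by rewrite !e; case: b {mh e} => /=; lra.
Qed.

(* Balance of a set and of its preimage under [hyp] forces equal measure on the four
   quarters; as [hypV] maps cylinders to smaller ones, equal measure on all cylinders of
   each level follows by induction. *)
Lemma balanced_trivial (C : set (set bits)) : (forall E, C E -> measurable E) ->
  (forall g E, C E -> C (gact g @^-1` E)) ->
  (forall E, C E -> pr nu (E `&` half false) = pr nu (E `&` half true)) ->
  forall E, C E -> pr nu E = 0 \/ pr nu E = 1.
Proof.
move=> mC Cg bal.
have mq := measurable_quarter.
have sum E : C E ->
    pr nu (quarter false false `&` E) + pr nu (quarter false true `&` E) = pr nu E / 2 /\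
    pr nu (quarter true false `&` E) + pr nu (quarter true true `&` E) = pr nu E / 2.
  move=> CE; have mE := mC _ CE; have := bal _ CE.
  by rewrite !nu_half// (nu_quarters R mE); lra.
(* If [a] is the measure of the part of [E] in the quarter [00] and [p] that of [E], balance of the
   preimage of [E] under [hyp] reads [2 a = (a + p / 2 + p / 4) / 2]. *)
have q00 E : C E -> pr nu (quarter false false `&` E) = pr nu E / 4.
  move=> CE; have mE := mC _ CE; have CE' := Cg gh _ CE; rewrite gact_h in CE'.
  have := bal _ CE'; have := sum _ CE'; rewrite !nu_half; try exact: mC.
  have -> : pr nu (hyp @^-1` E) / 2 = pr nu (hyp @^-1` E `&` half false).
    rewrite nu_half; last exact: mC.
    by have [-> _] := sum _ CE'.
  have -> : hyp @^-1` E `&` half false = hyp @^-1` (quarter false false `&` E).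
    by apply/seteqP; split=> x /= [h1 h2]; split=> //; apply/hyp01.
  have [s1 s2] := sum _ CE; rewrite nu_hyp; last exact: measurableI.
  have z a c : (a || c) -> pr nu (quarter a c `&` (quarter false false `&` E)) = 0.
    move=> ac; rewrite (_ : _ `&` _ = set0) ?pr0//.
    apply/seteqP; split=> // x [[x0 x1] [[x0' x1'] _]].
    by move: ac; rewrite -x0 -x1 x0' x1'.
  rewrite (z false true)// (z true false)// (z true true)// setIA setIid => -[e1 e2] _.
  have [e3 _] := sum _ CE'; have := nu_hyp R mE; lra.
have q E a c : C E -> pr nu (quarter a c `&` E) = pr nu E / 4.
  move=> CE; have [s1 s2] := sum _ CE; have h0 := q00 _ CE.
  have h1 := q00 _ (Cg gu _ CE).
  rewrite gact_u nu_quarter_odo ?nu_odo in h1; try exact: mC.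
  by case: a; case: c; rewrite /= in h1 *; lra.
have cylE n x E : C E -> pr nu (E `&` bcyl n.+2 x) = pr nu E / 2 ^+ n.+2.
  elim: n x E => [|n IH] x E CE.
    rewrite (_ : bcyl _ _ = quarter (x 0) (x 1%N)); first by rewrite setIC q//; lra.
    apply/seteqP; split=> y; rewrite /cyl /quarter /=.
      by move=> xy; rewrite (xy 0)// (xy 1%N).
    by move=> [y0 y1] [|[|i]].
  have [k [y [y0 ->]]] := @exists_first_true n.+2 x isT.
  pose E' := gact (gu ^+ k)^-1%g @^-1` E.
  have CE' : C E' by exact: Cg.
  have EE' : E = gact (gu ^+ k)%g @^-1` E' by apply/funext => z; rewrite /E' /= gactK.
  have mcy : measurable (bcyl n.+2 y) by exact: measurable_cyl.
  rewrite EE' -preimage_setI !nu_odoX; last first.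
  - apply: measurableI; first exact: mC.
    by rewrite -gact_h; exact: measurable_gact_pre.
  - exact: mC.
  have -> : E' `&` hyp @^-1` bcyl n.+2 y = hyp @^-1` (hypV @^-1` E' `&` bcyl n.+2 y).
    by apply/seteqP; split=> z /= []; rewrite hypK.
  have CE2 : C (hypV @^-1` E') by have := Cg gh^-1%g _ CE'; rewrite gact_hV.
  have mF : measurable (hypV @^-1` E' `&` bcyl n.+2 y) by apply: measurableI => //; exact: mC.
  have z c : pr nu (quarter false c `&` (hypV @^-1` E' `&` bcyl n.+2 y)) = 0.
    rewrite (_ : _ `&` _ = set0) ?pr0//.
    apply/seteqP; split=> // t [[t0 _] [_ yt]].
    by move: y0; rewrite (yt 0)// t0.
  transitivity (2^-1 * pr nu (hypV @^-1` E' `&` bcyl n.+2 y)).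
    by have := nu_quarters R mF; rewrite nu_hyp// !z; lra.
  (* The weights 1/2, 1/2, 1, 2 of [hypV] add up to 4, so a set spread evenly over the quarters
     keeps its measure. *)
  rewrite IH//; have -> : pr nu (hypV @^-1` E') = pr nu E'.
    by rewrite nu_hypV ?q//; [lra|exact: mC].
  have h2 : 2 ^+ n != 0 :> R by rewrite expf_neq0.
  by rewrite !exprS; field.
move=> E CE; have mE := mC _ CE.
have hE : pr nu (E `&` E) = pr nu E * pr nu E.
  apply: (@real_measure_unique _ _ _ (fun F => pr nu (E `&` F))
    (fun F => pr nu E * pr nu F) 2) => //.
  - exact: real_measure_restr.
  - by apply: real_measureZ; [exact: pr_ge0|exact: real_measure_pr].
  - by move=> [|[|n]] x // _; rewrite cylE// nu_cyl.
move: hE; rewrite setIid => /eqP; rewrite -subr_eq0 -{1}[pr nu E]mulr1 -mulrBr.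
rewrite mulf_eq0 => /orP[/eqP->|]; first by left.
by rewrite subr_eq0 => /eqP <-; right.
Qed.

End Balanced.

(** Two increments always produce exactly one carry out of the first bit. So [u^2] on either half is
    a copy of the odometer, whence its ergodicity there. *)
Lemma odo_scons b x : odo (odo (scons b x)) = scons b (odo x) :> bits.
Proof.
have cS (y : bits) n : carry n.+1 y = y 0 && carry n (fun i => y i.+1).
  rewrite /carry /=; congr andb.
  by rewrite -[1%N]addn0 iotaDl all_map; apply: eq_all.
have h (c : bool) (y : bits) : odo (scons c y) = scons (~~ c) (if c then odo y else y).
  apply/funext => -[|n]; first by case: c.
  by rewrite /odo /tri cS /=; case: c => //=; rewrite addbF.
by rewrite h; case: b => /=; rewrite h.
Qed.

Lemma nu_scons (R : realType) b (E : set bits) : measurable E ->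
  pr (nu R) (scons b @^-1` E) = 2 * pr (nu R) (E `&` half b).
Proof.
move=> mE; rewrite [in RHS]coin_self_similar; last first.
  by apply: measurableI => //; exact: measurable_half.
rewrite card_bool big_bool /=.
have e c : pr (nu R) (scons c @^-1` (E `&` half b)) =
    if c == b then pr (nu R) (scons b @^-1` E) else 0.
  case: eqP => [->|cb].
    by congr (pr _ _); apply/seteqP; split=> x; [case|].
  rewrite (_ : _ @^-1` _ = set0) ?pr0//.
  by apply/seteqP; split=> // x [_].
rewrite -/(nu R) !e; case: b {mE e} => /=; lra.
Qed.

(** The separating sets are the preimages of balls of radius [1/(n+1)] around a countable dense set,
    with interiors taken because balls of a pseudometric structure may fail to be open. *)
Lemma standard_borel_separated (R : realType) d (Y : measurableType d) :
  standard_borel R Y ->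
  exists V : nat -> set Y, (forall k, measurable (V k)) /\
    forall y z, (forall k, V k y <-> V k z) -> y = z.
Proof.
move=> [P [f [hP [Q cQ dQ] bf mf]]].
have /countable_injP[i ii] := cQ.
pose W (p : nat * nat) : set P :=
  \bigcup_(q in [set q | Q q /\ i q = p.1]) (ball q (p.2.+1%:R^-1 : R))°.
have oW p : open (W p) by apply: bigcup_open => q _; exact: open_interior.
have [g gK bg] : exists2 g : P -> Y, cancel f g & cancel g f.
  by case: bf => g; exists g.
exists (fun k => if unpickle k is Some p then f @^-1` W p else set0); split.
  move=> k; case: unpickle => // p; apply/mf; rewrite image_preimage.
    exact: sub_sigma_algebra.
  by apply/seteqP; split=> // z _; exists (g z).
move=> y z h; apply: (can_inj gK); apply/eqP/negPn/negP => ne.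
move: hP; rewrite ball_hausdorff => /(_ _ _ ne)[[r s] /= /eqP rs].
have [n hn] : exists n, 0 + n.+1%:R^-1 < r%:num / 2 by exact: ltr_add_invr.
rewrite add0r in hn; set e : R := n.+1%:R^-1 in hn.
have e0 : 0 < e by rewrite invr_gt0.
have e2 : 0 < e / 2 by rewrite divr_gt0.
have [q [qb Qq]] : exists q, (ball (f y) (e / 2))° q /\ Q q.
  have := dQ (ball (f y) (e / 2))°; case.
  - by exists (f y); apply/nbhsx_ballx.
  - exact: open_interior.
  - by move=> q []; exists q.
have {}qb := interior_subset qb.
have Wy : W (i q, n) (f y).
  exists q => //=; apply/nbhs_ballP; exists (e / 2) => //= t yt.
  rewrite -/e [e]splitr; apply: ball_triangle yt; exact: ball_sym.
have := (h (pickle (i q, n))).1; rewrite pickleK => /(_ Wy)[q' [Qq' iq] /interior_subset qz].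
rewrite (ii q' q) ?inE// -/e in qz.
have : (ball (f y) r%:num `&` ball (f z) s%:num) (f z); last by rewrite rs.
split; last exact: ballxx.
by apply: le_ball (ball_triangle qb qz); lra.
Qed.

(** Choosing from each separating set and its complement the one of full measure gives a countable
    intersection of full measure that contains a single point. *)
Lemma zero_one_point (R : realType) d (Y : measurableType d) (P : probability Y R) :
  standard_borel R Y -> (forall B, measurable B -> pr P B = 0 \/ pr P B = 1) ->
  exists y, {ae P, forall z, z = y}.
Proof.
move=> bY h01; have [V [mV sV]] := standard_borel_separated bY.
pose W k := if `[< pr P (V k) = 1 >] then V k else ~` V k.
have mW k : measurable (W k) by rewrite /W; case: ifP => // _; exact: measurableC.
have mWC k : measurable (~` W k) by exact: measurableC.
have W1 k : pr P (~` W k) = 0.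
  rewrite /W; case: asboolP => h; first by rewrite pr_setC// h subrr.
  by rewrite setCK; case: (h01 _ (mV k)).
have mU : measurable (\bigcup_k ~` W k) by exact: bigcupT_measurable.
have U0 : pr P (\bigcup_k ~` W k) = 0 by exact: pr_bigcup0.
have [y hy] : exists y, ~ (\bigcup_k ~` W k) y.
  apply/existsNP => h; have : pr P setT = 0.
    by rewrite -U0; congr (pr _ _); apply/seteqP; split.
  by rewrite prT; lra.
exists y, (\bigcup_k ~` W k); split=> //; first by rewrite prE// U0.
move=> z /= ne; apply: contrapT => nz; apply: ne; apply: sV => k.
have Wz : W k z by apply: contrapT => h; apply: nz; exists k.
have Wy : W k y by apply: contrapT => h; apply: hy; exists k.
by move: Wz Wy; rewrite /W; case: ifP.
Qed.

(** * Factors of the Cantor system *)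

Section Factor.
Variables (R : realType) (Y : gspace R (fgroup 'I_2)).
Variables (D : set bits) (D' : set Y) (f : bits -> Y).
Hypothesis stY : stationary_space (tau R) Y.
Hypothesis gf : @gmap R (fgroup 'I_2) (bits_space R) Y D D' f.
Local Notation nu := (nu R).

Definition lifted (B : set Y) : set bits := D `&` f @^-1` B.

Lemma measurable_factor_domain : measurable D. Proof. by case: gf => -[[]]. Qed.

Lemma domain_gact g x : D (gact g x) <-> D x.
Proof.
case: gf => -[[_ _ h] _] _ _ _ _; split; last exact: (h g).
by move=> /(h g^-1%g); rewrite /= gactK.
Qed.

Lemma pr_domainC : pr nu (~` D) = 0.
Proof.
have mD := measurable_factor_domain; rewrite pr_setC//.
by case: gf => -[[_ + _] _] _ _ _ _; rewrite /pr /= => ->; rewrite subrr.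
Qed.

Lemma measurable_lifted B : measurable B -> measurable (lifted B).
Proof. by move=> mB; case: gf => _ mf _ _ _; exact: mf measurable_factor_domain _ mB. Qed.

Lemma factor_gact g x : D x -> f (gact g x) = gs_act g (f x).
Proof. by case: gf => _ _ _ h _; exact: h. Qed.

Lemma factor_law B : measurable B -> gs_law Y B = nu (lifted B).
Proof. by case: gf => _ _ _ _ h; exact: h. Qed.

Lemma lifted_act g B : lifted (gs_act g @^-1` B) = gact g @^-1` lifted B.
Proof.
apply/seteqP; split=> x [] /=.
  by move=> Dx; rewrite -factor_gact// => Bx; split=> //; apply/domain_gact.
by move=> /domain_gact Dx; rewrite /= factor_gact// => Bx; split.
Qed.

Lemma measurable_act_pre g (B : set Y) : measurable B -> measurable (gs_act g @^-1` B).
Proof. by move=> mB; case: stY => _ _ h _; rewrite -[X in measurable X]setTI; exact: h. Qed.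

(** [Q b] is the image on the factor of [nu] conditioned on one half. Comparing the two laws on [Y]
    itself produces a Hahn set that belongs to the sigma-algebra of the factor. *)
Lemma half_law : exists Q : bool -> probability Y R,
  forall b B, measurable B -> pr (Q b) B = 2 * pr nu (lifted B `&` half b).
Proof.
(* [f] is known to be measurable only on [D]; a constant value on the null complement makes it
   measurable everywhere. *)
pose ft x : Y := if pselect (D x) is left _ then f x else point.
have mD := measurable_factor_domain.
have mDC : measurable (~` D) by exact: measurableC.
have ftE B : ft @^-1` B = lifted B `|` (if `[< B point >] then ~` D else set0).
  apply/seteqP; split=> x; rewrite /ft /=.
    case: pselect => Dx Bx; first by left.
    by right; rewrite asboolT.
  case=> [[Dx Bx]|]; first by case: pselect.
  by case: asboolP => // Bp /= nD; case: pselect.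
have mft : measurable_fun setT ft.
  move=> _ B mB; rewrite setTI ftE; apply: measurableU; first exact: measurable_lifted.
  by case: asboolP.
have mc b : measurable_fun setT (fun x => ft (scons b x)).
  by apply: measurableT_comp mft _; exact: measurable_scons.
exists (fun b => projT1 (cid (pushforward_probability nu (mc b)))) => b B mB.
have mh := measurable_half b; have ml := measurable_lifted mB.
have mfB : measurable (ft @^-1` B) by rewrite -[X in measurable X]setTI; exact: mft.
rewrite /pr (projT2 (cid (pushforward_probability nu (mc b)))) -/(pr nu _).
rewrite (nu_scons R b mfB); congr (_ * _).
apply: (pr_ae_eq _ _ mDC pr_domainC); try exact: measurableI.
apply/seteqP; split=> x [[h hb] nD]; split=> //; split=> //.
  by move: h; rewrite ftE => -[//|]; case: asboolP => // _ /nD.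
by rewrite ftE; left.
Qed.

Lemma lifted_half_odo b B : measurable B ->
  pr nu (lifted (gs_act gu @^-1` B) `&` half b) = pr nu (lifted B `&` half (~~ b)).
Proof.
move=> mB; rewrite lifted_act -[RHS](nu_odo R); last first.
  by apply: measurableI; [exact: measurable_lifted|exact: measurable_half].
congr (pr nu _); apply/seteqP; split=> x [h]; rewrite /half /= => xb; split=> //.
  by rewrite /odo /tri /carry /= xb addbT.
by move: xb; rewrite /odo /tri /carry /= addbT => /negb_inj.
Qed.

Lemma lifted_halfC b B : measurable B ->
  pr nu (lifted (~` B) `&` half b) = 1 / 2 - pr nu (lifted B `&` half b).
Proof.
move=> mB; have [Q hQ] := half_law; have := pr_setC (Q b) mB.
by rewrite !hQ//; [lra|exact: measurableC].
Qed.

(** By ergodicity of [u^2] on the halves, the invariant Hahn set has measure 0 or 1 for each of the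
    two laws. If the values differ, it or its complement lifts to a half; if they agree, one law
    dominates the other. *)
Lemma factor_dichotomy :
  (exists B, [/\ measurable B, pr nu (lifted B `&` half false) = 1 / 2 &
     pr nu (lifted B `&` half true) = 0]) \/
  (forall B, measurable B ->
     pr nu (lifted B `&` half false) = pr nu (lifted B `&` half true)).
Proof.
have [Q hQ] := half_law; pose S := @gs_act R _ Y (gu ^+ 2)%g.
have mS : measurable_fun setT S by case: stY => _ _ h _; exact: h.
have gu2 x : gact (gu ^+ 2)%g x = odo (odo x) by exact: (gact_uX 2).
have QS b B : measurable B -> pr (Q b) (S @^-1` B) = pr (Q b) B.
  move=> mB; rewrite !hQ//; last exact: measurable_act_pre.
  rewrite (_ : S @^-1` B = gs_act gu @^-1` (gs_act gu @^-1` B)).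
    by rewrite !lifted_half_odo ?negbK//; exact: measurable_act_pre.
  by apply/funext => y; case: stY => _ [_ h] _ _; rewrite /S /= expgS expg1 h.
have [B [mB SB pB nB]] := invariant_hahn mS (QS false) (QS true).
have erg b : pr nu (scons b @^-1` lifted B) = 0 \/ pr nu (scons b @^-1` lifted B) = 1.
  apply: odo_ergodic.
    rewrite -[X in measurable X]setTI; apply: measurable_scons => //.
    exact: measurable_lifted.
  move=> x; rewrite /preimage /= -odo_scons -gu2.
  by rewrite -[X in _ <-> X]/(lifted B (scons b x)) -{2}SB lifted_act.
(* [u] exchanges the two halves, so applying a one-sided domination to a translate gives the reverse
   inequality. *)
have half_odo_le : (forall B', measurable B' ->
      pr nu (lifted B' `&` half false) <= pr nu (lifted B' `&` half true)) \/
    (forall B', measurable B' ->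
      pr nu (lifted B' `&` half true) <= pr nu (lifted B' `&` half false)) ->
    forall B', measurable B' ->
      pr nu (lifted B' `&` half false) = pr nu (lifted B' `&` half true).
  move=> h B' mB'; have mB2 := measurable_act_pre gu mB'.
  have e0 := lifted_half_odo false mB'; have e1 := lifted_half_odo true mB'.
  by case: h => h; have := h _ mB'; have := h _ mB2; rewrite e0 e1 /=; lra.
have mlB := measurable_lifted mB.
have := erg false; have := erg true; rewrite !nu_scons// -!hQ//.
have split_le b B' : measurable B' ->
    pr (Q b) B' = pr (Q b) (B' `&` B) + pr (Q b) (B' `&` ~` B).
  by move=> mB'; exact: pr_split.
move=> [q1|q1] [q0|q0].
- right; apply: half_odo_le; left => B' mB'.
  have mD1 : measurable (B' `&` B) by exact: measurableI.
  have mD2 : measurable (B' `&` ~` B) by apply: measurableI => //; exact: measurableC.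
  have := nB _ mD2 (_ : B' `&` ~` B `&` B = set0).
  rewrite -setIA setICl setI0 => /(_ erefl).
  have := split_le false _ mB'; have := split_le true _ mB'.
  rewrite !(pr_eq0_sub mD1 mB (@subIsetr _ _ _))// !hQ//; lra.
- left; exists B; split=> //; move: q0 q1; rewrite !hQ//; lra.
- left; exists (~` B); split; first exact: measurableC.
    by rewrite lifted_halfC//; move: q0 q1; rewrite !hQ//; lra.
  by rewrite lifted_halfC//; move: q0 q1; rewrite !hQ//; lra.
- right; apply: half_odo_le; right => B' mB'.
  have mD1 : measurable (B' `&` B) by exact: measurableI.
  have mBC : measurable (~` B) by exact: measurableC.
  have mD2 : measurable (B' `&` ~` B) by exact: measurableI.
  have := pB _ mD1 (@subIsetr _ _ _).
  have := split_le false _ mB'; have := split_le true _ mB'.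
  have z b : pr (Q b) B = 1 -> pr (Q b) (B' `&` ~` B) = 0.
    move=> qb; apply: (pr_eq0_sub mD2 mBC (@subIsetr _ _ _)).
    by rewrite pr_setC// qb subrr.
  rewrite !z// !hQ//; lra.
Qed.

Lemma balanced_factor_trivial : (forall B, measurable B ->
    pr nu (lifted B `&` half false) = pr nu (lifted B `&` half true)) ->
  essentially_point Y.
Proof.
move=> bal; apply: zero_one_point; first by case: stY.
move=> B mB; have -> : pr (gs_law Y) B = pr nu (lifted B) by exact: congr1 (factor_law mB).
apply: (@balanced_trivial R [set E | exists2 B, measurable B & E = lifted B]).
- by move=> _ [C mC ->]; exact: measurable_lifted.
- move=> g _ [C mC ->]; exists (gs_act g @^-1` C); first exact: measurable_act_pre.
  by rewrite lifted_act.
- by move=> _ [C mC ->]; exact: bal.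
- by exists B.
Qed.

Definition equal_mod_null (E F : set bits) : Prop :=
  exists N, [/\ measurable N, pr nu N = 0 & forall x, ~ N x -> (E x <-> F x)].

(** Sets that agree modulo null sets with a lifted one form an invariant sigma-algebra, and [B0]
    puts a half of the space into it; [measurable_generated] concludes. *)
Lemma factor_generates B0 : measurable B0 ->
  pr nu (lifted B0 `&` half false) = 1 / 2 -> pr nu (lifted B0 `&` half true) = 0 ->
  forall E, measurable E -> exists2 B, measurable B & equal_mod_null E (lifted B).
Proof.
move=> mB0 h0 h1.
have mDC : measurable (~` D) by apply: measurableC; exact: measurable_factor_domain.
have U0 N N' : measurable N -> measurable N' -> pr nu N = 0 -> pr nu N' = 0 ->
    pr nu (N `|` N') = 0.
  move=> mN mN' z z'; apply/le_anti; rewrite pr_ge0 andbT.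
  by rewrite (le_trans (pr_setU_le _ mN mN'))// z z' addr0.
apply: measurable_generated; first split.
- exists set0 => //; exists set0; split=> //; first exact: pr0.
  by move=> x _; split=> // -[].
- move=> E [B mB [N [mN N0 hN]]]; exists (~` B); first exact: measurableC.
  exists (N `|` ~` D); split; [exact: measurableU|exact: U0 pr_domainC|].
  move=> x /not_orP[/hN EB /contrapT Dx]; split.
    by move=> [_ nE]; split=> // Bx; apply: nE; apply/EB.
  by move=> [_ nB]; split=> // /EB[].
- move=> E hE.
  have /choice[B hB] (k : nat) : exists B, measurable B /\ equal_mod_null (E k) (lifted B).
    by have [B mB eB] := hE k; exists B.
  have /choice[N hN] (k : nat) : exists N, [/\ measurable N, pr nu N = 0 &
    forall x, ~ N x -> (E k x <-> lifted (B k) x)] by exact: (hB k).2.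
  exists (\bigcup_k B k); first by apply: bigcupT_measurable => k; exact: (hB k).1.
  exists (\bigcup_k N k); split.
  + by apply: bigcupT_measurable => k; case: (hN k).
  + by apply: pr_bigcup0 => k; case: (hN k).
  + move=> x nx; have h k : E k x <-> lifted (B k) x.
      by case: (hN k) => _ _; apply=> Nx; apply: nx; exists k.
    split; first by move=> [k _ /h[Dx Bx]]; split=> //; exists k.
    by move=> [Dx [k _ Bx]]; exists k => //; apply/h.
- move=> g E [B mB [N [mN N0 hN]]].
  exists (gs_act g @^-1` B); first exact: measurable_act_pre.
  exists (gact g @^-1` N); split; [exact: measurable_gact_pre|exact: nu_gact0|].
  by move=> x /hN h; rewrite lifted_act.
- exists B0 => //; pose N0 := lifted (~` B0) `&` half false.
  pose N1 := lifted B0 `&` half true.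
  have mh := measurable_half; have mC : measurable (~` B0) by exact: measurableC.
  have m0 : measurable N0 by apply: measurableI => //; exact: measurable_lifted.
  have m1 : measurable N1 by apply: measurableI => //; exact: measurable_lifted.
  have m01 : measurable (N0 `|` N1) by exact: measurableU.
  exists (N0 `|` N1 `|` ~` D); split; first exact: measurableU.
    apply: (U0 _ _ m01 mDC _ pr_domainC); apply: (U0 N0 N1) => //.
    by rewrite /N0 lifted_halfC// h0 subrr.
  move=> x /not_orP[/not_orP[n0 n1] /contrapT Dx]; split=> [x0|Bx].
    by split=> //; apply: contrapT => nB; apply: n0.
  by case e: (x 0) => //; exfalso; apply: n1; split.
Qed.

(** The candidate inverse of the factor map: when [B n] lifts, modulo null sets, to the set of
    sequences whose bit [n] is 1, membership in [B n] reads that bit. *)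
Definition recover (B : nat -> set Y) (y : Y) : bits := fun n => `[< B n y >].

Lemma measurable_recover B : (forall n, measurable (B n)) ->
  measurable_fun setT (recover B).
Proof.
move=> mB; apply: measurable_seqs => n x; elim: n => [|n IH].
  by rewrite cyl0 preimage_setT; exact: measurableT.
rewrite (_ : _ @^-1` _ = recover B @^-1` cyl n x `&` (if x n then B n else ~` B n)).
  by apply: measurableI => //; case: (x n) => //; exact: measurableC.
apply/seteqP; split=> y; rewrite /cyl /= agreeS /recover => -[h e]; split=> //.
  by move: e; case: (x n) => /esym/asboolP.
by move: e; case: (x n) => h'; apply/esym/asboolP.
Qed.

Lemma factor_iso B0 : measurable B0 ->
  pr nu (lifted B0 `&` half false) = 1 / 2 -> pr nu (lifted B0 `&` half true) = 0 ->
  @gmap_iso R _ (bits_space R) Y D D' f.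
Proof.
move=> mB0 h0 h1; have gen := factor_generates mB0 h0 h1.
have mD := measurable_factor_domain.
pose C n : set bits := [set x | x n].
have mC n : measurable (C n).
  by apply: (measurable_dep_set (n := n.+1)) => x y xy; rewrite /C /= xy.
have /choice[B hB] n : exists B, measurable B /\ equal_mod_null (C n) (lifted B).
  by have [B mB eB] := gen _ (mC n); exists B.
have /choice[N hN] (n : nat) : exists N, [/\ measurable N, pr nu N = 0 &
  forall x, ~ N x -> (C n x <-> lifted (B n) x)] by exact: (hB n).2.
have mB n : measurable (B n) by case: (hB n).
have mlB n := measurable_lifted (mB n).
pose f' := recover B; have mf' := measurable_recover mB.
pose K : set bits := [set x | D x /\ f' (f x) = x].
have mK : measurable K.
  rewrite (_ : K = D `&` \bigcap_n
    ((lifted (B n) `&` C n) `|` (~` lifted (B n) `&` ~` C n))).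
    apply: measurableI => //; apply: bigcapT_measurable => n.
    by apply: measurableU; apply: measurableI => //; exact: measurableC.
  apply/seteqP; split=> x [Dx].
    move=> fx; split=> // n _; rewrite /C /= -{2 4}fx /f' /recover.
    by case: asboolP => h; [left|right; split=> // -[]].
  move=> h; split=> //; apply/funext => n; rewrite /f' /recover.
  case: (h n Logic.I) => -[h2 h3].
    by rewrite [x n]h3; apply/asboolP; case: h2.
  have -> : x n = false by apply/negbTE/negP.
  by apply/asboolPn => Bx; apply: h2.
have K0 : pr nu (~` K) = 0.
  have mN : measurable (\bigcup_n N n) by apply: bigcupT_measurable => n; case: (hN n).
  have N0 : pr nu (\bigcup_n N n) = 0 by apply: pr_bigcup0 => n; case: (hN n).
  have mDC : measurable (~` D) by exact: measurableC.
  apply: (@pr_eq0_sub _ _ _ _ _ (\bigcup_n N n `|` ~` D)); first exact: measurableC.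
  - exact: measurableU.
  - move=> x nK; apply: contrapT => /not_orP[nN /contrapT Dx]; apply: nK; split=> //.
    apply/funext => n; rewrite /f' /recover.
    have h : C n x <-> lifted (B n) x.
      by case: (hN n) => _ _; apply=> Nx; apply: nN; exists n.
    apply/asboolP; case e: (x n); first by have /h[] : C n x.
    by move=> Bx; have /h : lifted (B n) x by []; rewrite /C /= e.
  - apply/le_anti; rewrite pr_ge0 andbT.
    by rewrite (le_trans (pr_setU_le _ mN mDC))// N0 pr_domainC addr0.
(* The largest invariant subset of [K]; its complement is a countable union of preimages of a null
   set. *)
pose E : set bits := [set x | forall w, K (wact w x)].
have EC : ~` E = \bigcup_w (wact w @^-1` (~` K)).
  apply/seteqP; split=> x; first by move=> /existsNP[w nw]; exists w.
  by move=> [w _ nw] h; apply: nw; exact: h.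
have [mEC EC0] : measurable (~` E) /\ pr nu (~` E) = 0.
  rewrite EC; apply: pr_bigcup_count0 => w; have mKC : measurable (~` K) by exact: measurableC.
    exact: measurable_wact_pre.
  exact: nu_wact0.
have mE : measurable E by rewrite -[E]setCK; exact: measurableC.
have E1 : pr nu E = 1 by have := pr_setC nu mE; rewrite EC0; lra.
have EK x : E x -> K x by move=> /(_ [::]).
have Eg g x : E x -> E (gact g x) by move=> h w; rewrite -wact_cat.
have [V [mV sV]] := standard_borel_separated (let: And4 h _ _ _ := stY in h).
case: (gf) => -[[_ D1 Dg] [mD' D'1 D'g]] mf fD' fg law.
(* This is the image of [E], described through [f'] so that its measurability can be tested on the
   separating sets [V k]. *)
pose E' : set Y := [set y | [/\ D' y, E (f' y) & f (f' y) = y]].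
have mpre (A : set bits) : measurable A -> measurable (f' @^-1` A).
  by move=> mA; rewrite -[X in measurable X]setTI; exact: mf'.
have mE' : measurable E'.
  rewrite (_ : E' = D' `&` (f' @^-1` E) `&` \bigcap_k
    ((f' @^-1` lifted (V k) `&` V k) `|` (f' @^-1` (~` lifted (V k)) `&` ~` V k))).
    apply: measurableI; first by apply: measurableI => //; exact: mpre.
    have mlV k := measurable_lifted (mV k).
    apply: bigcapT_measurable => k; apply: measurableU; apply: measurableI => //.
    - exact: mpre.
    - exact: mV.
    - by apply: (mpre (~` lifted (V k))); apply: measurableC.
    - by apply: measurableC; exact: mV.
  apply/seteqP; split=> y.
    move=> [D'y Ey fy]; split=> // k _; have [Vy|nV] := pselect (V k y).
      by left; split=> //; split; rewrite /= ?fy//; case: (EK _ Ey).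
    by right; split=> // -[_]; rewrite /= fy.
  move=> [[D'y Ey] h]; split=> //; apply: sV => k.
  case: (h k Logic.I) => -[h2 h3]; first by split=> // _; case: h2.
  by split=> // Vf; exfalso; apply: h2; split=> //; case: (EK _ Ey).
have EE' x : E x -> E' (f x).
  by move=> Ex; have [Dx fx] := EK _ Ex; split; rewrite ?fx//; exact: fD'.
have prE' : gs_law Y E' = 1%E.
  have ml := measurable_lifted mE'.
  rewrite law// -[_ `&` _]/(lifted E') prE//; congr EFin; apply/le_anti.
  rewrite pr_le1//= -E1; apply: le_pr => // x Ex; split; last exact: EE'.
  by case: (EK _ Ex).
have E'g g y : E' y -> E' (gs_act g y).
  move=> [D'y Ey fy]; have [Dx _] := EK _ Ey.
  have gy : gs_act g y = f (gact g (f' y)) by rewrite (fg g)// fy.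
  by rewrite gy; apply: EE'; exact: Eg.
have cE : @invariant_conull R _ (bits_space R) E.
  by split=> //=; rewrite prE// E1.
have cE' : invariant_conull E' by [].
have ae_eq (A A' : set bits) : measurable A -> measurable A' ->
    (forall x, E x -> (A x <-> A' x)) -> nu A = nu A'.
  move=> mA mA' h; rewrite !prE//; congr EFin.
  apply: (pr_ae_eq mA mA' mEC EC0); rewrite setCK.
  by apply/seteqP; split=> x [Ax Ex]; split=> //; apply/(h x Ex).
have ED : E `<=` D by move=> x /EK[].
exists E, E', f'; split=> //.
- by split=> // y [].
- split=> //.
  + exact: measurable_funS ED mf.
  + by move=> g x Ex; apply: fg; exact: ED.
  + move=> A mA; have ml := measurable_lifted mA; rewrite law//.
    apply: ae_eq => //; last by move=> x Ex; split=> -[_ h]; split=> //; exact: ED.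
    rewrite (_ : _ `&` _ = E `&` lifted A); first exact: measurableI.
    by apply/seteqP; split=> x [Ex]; [split=> //; split=> //; exact: ED|move=> []].
- split=> //.
  + exact: measurable_funS mf'.
  + by move=> y [].
  + move=> g y [D'y Ey fy]; have [Dx _] := EK _ Ey.
    have gy : gs_act g y = f (gact g (f' y)) by rewrite (fg g)// fy.
    by rewrite gy; have /EK[] := Eg g _ Ey.
  + move=> A mA; have mA' : measurable (E' `&` f' @^-1` A).
      by apply: measurableI => //; exact: mpre.
    rewrite law//; apply: ae_eq => //; first exact: measurable_lifted mA'.
    move=> x Ex; have [Dx fx] := EK _ Ex; split=> [Ax|[_ [_]]].
      by split=> //; split; [exact: EE'|rewrite /= fx].
    by rewrite /= fx.
- by move=> x /EK[].
- by move=> y [].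
Qed.

End Factor.

Theorem prime_space_bits (R : realType) : prime_space (tau R) (bits_space R).
Proof.
split.
  move=> [x [N [mN N0 hN]]]; have [m1 z1] := pr_point R x.
  have : pr (nu R) (~` [set x]) = 0.
    apply: (pr_eq0_sub _ mN) => //; first exact: measurableC.
    by rewrite /pr (_ : nu R N = 0%E).
  by rewrite pr_setC// z1; lra.
move=> Y D D' f stY gf.
have [[B [mB h0 h1]]|bal] := factor_dichotomy stY gf.
  by left; exact: (factor_iso stY gf mB h0 h1).
by right; exact: (balanced_factor_trivial stY gf bal).
Qed.

Theorem corollary1p10 (R : realType) :
  exists (r : nat) (G : groupType) (tau : G -> R),
    [/\ (2 <= r)%N, free_of_rank G r, measured_group tau,
        finite_set (mass_support tau)
      & exists X : gspace R G,
          [/\ boundary tau X, prime_space tau X & essentially_free X]].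
Proof.
exists 2%N, (fgroup 'I_2), (tau R); split=> //.
- exact: free_fgroup.
- exact: tau_measured_group.
- exact: tau_finite_support.
- exists (bits_space R); split.
  + exact: boundary_bits.
  + exact: prime_space_bits.
  + exact: essentially_free_bits.
Qed.
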